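(* Let the Finsler space $F^N$ be conformally isomorphic to the Riemannian space $R^N=\{M,a_{mn}(x)\}$ by means of a fibrewise transformation $y\mapsto\zeta(x,y)$, positively homogeneous of degree $h(x)>0$ in $y$ and sending unit vectors to unit vectors, such that $$g_{mn}(x,y)=\varkappa^2\,\frac{\partial \zeta^i}{\partial y^m}\,\frac{\partial \zeta^j}{\partial y^n}\,a_{ij}(x),\qquad \varkappa=\frac1hK^{1-h}.$$ Then in any dimension $N$ and at each point $x\in M$ $$\frac{\text{AREA}_{\text{Finsleroid Indicatrix}}}{\text{AREA}_{\text{Euclidean Unit Sphere}}}=\frac1{h^{N-1}},\qquad \frac{\text{VOLUME}_{\text{Finsleroid}}}{\text{VOLUME}_{\text{Euclidean Unit Ball}}}=\frac1{h^{N-1}} .$$ Consequently $$\frac{\text{AREA}_{\text{Finsleroid Indicatrix}}}{\text{VOLUME}_{\text{Finsleroid}}}=\frac{\text{AREA}_{\text{Euclidean Unit Sphere}}}{\text{VOLUME}_{\text{Euclidean Unit Ball}}}\quad(N\ge3),$$ and, when $N=2$, $$\frac{\text{LENGTH}_{\text{Finsleroid Indicatrix}}}{\text{AREA}_{\text{Finsleroid}}}=\frac{2\pi/h}{\pi/h}=2.$$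
   Context: $M$ is an $N$-dimensional differentiable manifold with local coordinates $x^i$, and $y^i$ are the induced components of tangent vectors $y\in T_xM$. The Finsler space $F^N$ is given by a Finsler metric function $K(x,y)>0$ on $TM\setminus 0$ (positively homogeneous of degree 1 in $y$ and strongly convex), with metric tensor $g_{mn}=\frac12\,\partial^2K^2/\partial y^m\partial y^n$. $a_{mn}(x)$ is a Riemannian metric tensor on $M$ and $S(x,\zeta)=\sqrt{a_{mn}(x)\zeta^m\zeta^n}$. The fibrewise transformation is, for each $x\in M$, a diffeomorphism $y\mapsto\zeta(x,y)$ of $T_xM\setminus\{0\}$ onto itself, of class $C^5$ in $y$ and $C^4$ in $x$. Homogeneity means $\zeta^i(x,\gamma y)=\gamma^{h(x)}\zeta^i(x,y)$ for all $\gamma>0$; sending unit vectors to unit vectors means $K(x,y)=1$ if and only if $S(x,\zeta(x,y))=1$. The Finsleroid at $x$ is $\{y\in T_xM:K(x,y)\le1\}$; its volume is $\int\sqrt{\det(g_{mn}(x,y))}\,d^Ny$ over the Finsleroid. The Finsleroid indicatrix is $\{y\in T_xM:K(x,y)=1\}$; its area is the Riemannian volume $\int\sqrt{\det(i_{ab})}\,du^1\dots du^{N-1}$ for the metric $i_{ab}$ induced on it from the tangent Riemannian space $(T_xM,g_{mn}(x,\cdot))$ ($x$ fixed). For $N=2$ ''area'' and ''volume'' are called length and area. *)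

(* Defs.v *)
From HB Require Import structures.
From mathcomp Require Import all_boot all_order all_algebra.
From mathcomp Require Import all_classical all_reals all_analysis.

Set Implicit Arguments.
Unset Strict Implicit.
Unset Printing Implicit Defensive.

Import Order.TTheory GRing.Theory Num.Theory.
Import numFieldNormedType.Exports.

Local Open Scope classical_set_scope.
Local Open Scope ring_scope.

(** * Lebesgue measure on 'rV[R]_n *)

(* 'rV[R]_n carries the sigma-algebra generated by the coordinate maps; this
   is the Borel sigma-algebra of its topology. *)
Section measurable_rV.
Context (R : realType) (n : nat).

Definition rv_coord (i : 'I_n) (v : 'rV[R]_n) : measurableTypeR R := v ord0 i.

Let rv_set0 : g_sigma_preimage rv_coord set0.
Proof. exact: sigma_algebra0. Qed.

Let rv_setC A :
  g_sigma_preimage rv_coord A -> g_sigma_preimage rv_coord (~` A).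
Proof. exact: sigma_algebraC. Qed.

Let rv_bigcup (F : (set 'rV[R]_n)^nat) :
  (forall i, g_sigma_preimage rv_coord (F i)) ->
  g_sigma_preimage rv_coord (\bigcup_i (F i)).
Proof. exact: sigma_algebra_bigcup. Qed.

HB.instance Definition _ := @isMeasurable.Build
  default_measure_display 'rV[R]_n
  (g_sigma_preimage rv_coord) rv_set0 rv_setC rv_bigcup.

End measurable_rV.

Section rv_measurable_fun.
Context (R : realType).

Lemma measurable_rv_coord n (i : 'I_n) :
  measurable_fun [set: 'rV[R]_n] (rv_coord i).
Proof.
move=> _ Y mY; rewrite setTI; apply: sub_sigma_algebra => /=.
rewrite -bigcup_seq/=; exists i => /=; first by rewrite mem_index_enum.
by exists Y => //; rewrite setTI.
Qed.

Lemma measurable_fun_rvP d (T : measurableType d) n (f : T -> 'rV[R]_n) :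
  (forall i, measurable_fun [set: T] (rv_coord i \o f)) ->
  measurable_fun [set: T] f.
Proof.
move=> mf; have : g_sigma_preimage (fun i => rv_coord i \o f) `<=` measurable.
  apply: smallest_sub; first exact: sigma_algebra_measurable.
  case: n => [|n] in f mf *; first by rewrite big_ord0.
  rewrite -bigcup_mkord_ord; apply: bigcup_sub => i Ii.
  by move=> A [B mB <-]; exact: mf.
rewrite g_sigma_preimage_comp => sub _ A mA.
by rewrite setTI; apply: sub; exists A => //; rewrite setTI.
Qed.

Definition rv_cons n (p : measurableTypeR R * 'rV[R]_n) : 'rV[R]_n.+1 :=
  row_mx (p.1%:M : 'rV_1) p.2.

Lemma measurable_rv_cons n : measurable_fun [set: _] (@rv_cons n).
Proof.
apply: measurable_fun_rvP => i; case: (split_ordP (i : 'I_(1 + n))) => j ->.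
  rewrite (_ : _ \o _ = fst) //; apply/funext => p.
  by apply: etrans (row_mxEl _ _ _ _) _; rewrite mxE (ord1 j) eqxx mulr1n.
rewrite (_ : _ \o _ = rv_coord j \o snd); last first.
  by apply/funext => p; exact: row_mxEr.
exact: measurableT_comp (@measurable_rv_coord _ j) measurable_snd.
Qed.

Let rv_uncons n (v : 'rV[R]_n.+1) : measurableTypeR R * 'rV[R]_n :=
  (v ord0 ord0, rsubmx (v : 'rV_(1 + n))).

Let measurable_rv_uncons n : measurable_fun [set: _] (@rv_uncons n).
Proof.
apply/measurable_fun_prod; first exact: measurable_rv_coord.
apply: measurable_fun_rvP => i.
rewrite (_ : _ \o _ = rv_coord (rshift 1 i : 'I_n.+1)) ?measurable_rv_coord//.
  exact: measurable_rv_coord.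
by apply/funext => v; rewrite /rv_coord /= mxE.
Qed.

Let rv_consK n : cancel (@rv_cons n) (@rv_uncons n).
Proof.
move=> [t v]; congr pair; rewrite /= /rv_cons; last exact: row_mxKr.
have -> : (ord0 : 'I_n.+1) = lshift n (ord0 : 'I_1) by exact/val_inj.
by apply: etrans (row_mxEl _ _ _ _) _; rewrite mxE mulr1n.
Qed.

Section rv_pushforward.
Context n (mu : {sigma_finite_measure set 'rV[R]_n -> \bar R}).

Definition rv_cons_measure : set 'rV[R]_n.+1 -> \bar R :=
  pushforward (@lebesgue_measure R \x mu)%E (@rv_cons n).

Let rv_cons_measure0 : rv_cons_measure set0 = 0%E.
Proof. by rewrite /rv_cons_measure /pushforward preimage_set0 measure0. Qed.

Let rv_cons_measure_ge0 A : (0 <= rv_cons_measure A)%E.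
Proof. exact: (measure_ge0 (@lebesgue_measure R \x mu)%E). Qed.

Let rv_cons_measure_sigma_additive : semi_sigma_additive rv_cons_measure.
Proof.
exact: (@measure_semi_sigma_additive _ _ _
  (measure_function_pushforward__canonical__measure_function_Measure
    (@lebesgue_measure R \x mu)%E (@measurable_rv_cons n))).
Qed.

HB.instance Definition _ := isMeasure.Build _ _ _ rv_cons_measure
  rv_cons_measure0 rv_cons_measure_ge0 rv_cons_measure_sigma_additive.

Let rv_cons_sigma_finite : sigma_finite setT rv_cons_measure.
Proof.
have /sigma_finiteP[F [TF ndF Foo]] := sigma_finiteT (@lebesgue_measure R).
have /sigma_finiteP[G [TG ndG Goo]] := sigma_finiteT mu.
exists (fun k => @rv_uncons n @^-1` (F k `*` G k)).
  apply/esym/seteqP; split=> // v _.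
  have [k _ Fk] : (\bigcup_k F k) (rv_uncons v).1 by rewrite -TF.
  have [l _ Gl] : (\bigcup_k G k) (rv_uncons v).2 by rewrite -TG.
  exists (maxn k l) => //; split.
    by move: Fk; exact/subsetPset/ndF/leq_maxl.
  by move: Gl; exact/subsetPset/ndG/leq_maxr.
move=> k; have [mF Fk] := Foo k; have [mG Gk] := Goo k; split.
  rewrite -[X in measurable X]setTI; apply: measurable_rv_uncons => //.
  exact: measurableX.
rewrite /rv_cons_measure /pushforward -comp_preimage.
rewrite (_ : _ \o _ = id); last by apply/funext => p /=; rewrite rv_consK.
by rewrite preimage_id product_measure1E// lte_mul_pinfty// ge0_fin_numE.
Qed.

HB.instance Definition _ := Measure_isSigmaFinite.Build _ _ _ rv_cons_measure
  rv_cons_sigma_finite.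

End rv_pushforward.

(* The N-dimensional Lebesgue measure d^N y: the iterated product of the
   one-dimensional one along 'rV_n.+1 = R * 'rV_n. *)
Fixpoint lebesgue_rV n : {sigma_finite_measure set 'rV[R]_n -> \bar R} :=
  match n with
  | 0 => dirac (0 : 'rV[R]_0)
  | n'.+1 => rv_cons_measure (lebesgue_rV n')
  end.

End rv_measurable_fun.

(** * Differential calculus *)

(* f is of class C^k on the (open) set U. *)
Fixpoint class_C (R : realType) (V W : normedModType R) (k : nat) (U : set V)
    (f : V -> W) : Prop :=
  match k with
  | 0 => forall x, U x -> {for x, continuous f}
  | k'.+1 => (forall x, U x -> differentiable f x) /\
             forall v, class_C k' U (fun x => 'D_v f x)
  end.

Definition nonzero (V : nmodType) : set V := [set y | y != 0].

(** * Volume and area in a tangent Riemannian space *)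

Section riemannian_volume.
Context (R : realType) (N : nat).
(* a Riemannian metric tensor on 'rV_N, given by its matrices g_mn(y) *)
Variable g : 'rV[R]_N -> 'M[R]_N.

Definition riem_volume (B : set 'rV[R]_N) : \bar R :=
  (\int[lebesgue_rV R N]_(y in B) (Num.sqrt (\det (g y)))%:E)%E.

(* p parametrizes a piece of the hypersurface H by the open set U; since
   'J p has entries (a, m) |-> d p^m / d u^a, row_free says that p is an
   immersion. *)
Definition local_param (H : set 'rV[R]_N) (U : set 'rV[R]_N.-1)
    (p : 'rV[R]_N.-1 -> 'rV[R]_N) : Prop :=
  [/\ open U, class_C 1 U p, set_inj U p, p @` U `<=` H &
      forall u, U u -> row_free ('J p u)].

(* i_ab = g_mn (d p^m / d u^a) (d p^n / d u^b) *)
Definition induced_metric (p : 'rV[R]_N.-1 -> 'rV[R]_N) (u : 'rV[R]_N.-1) :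
    'M[R]_N.-1 :=
  'J p u *m g (p u) *m ('J p u)^T.

Definition param_area (D : set 'rV[R]_N.-1) (p : 'rV[R]_N.-1 -> 'rV[R]_N) :
    \bar R :=
  (\int[lebesgue_rV R N.-1]_(u in D)
      (Num.sqrt (\det (induced_metric p u)))%:E)%E.

(* A is the Riemannian volume of the hypersurface H: H is cut into countably
   many disjoint Borel pieces p_k(D_k), each in the range of a local
   parametrization, and A is the sum of the integrals of sqrt(det i_ab). *)
Definition is_riem_area (H : set 'rV[R]_N) (A : \bar R) : Prop :=
  exists (U D : (set 'rV[R]_N.-1)^nat) (p : ('rV[R]_N.-1 -> 'rV[R]_N)^nat),
    [/\ forall k, local_param H (U k) (p k),
        forall k, measurable (D k) /\ D k `<=` U k,
        trivIset setT (fun k => p k @` D k),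
        \bigcup_k (p k @` D k) = H &
        A = (\sum_(0 <= k <oo) param_area (D k) (p k))%E].

(* For a C^1 hypersurface and a continuous metric the value does not depend on
   the decomposition; riem_area is 0 by convention when there is none. *)
Definition riem_area (H : set 'rV[R]_N) : \bar R :=
  xget 0%E [set A | is_riem_area H A].

End riemannian_volume.

Definition euclidean_metric (R : realType) N (_ : 'rV[R]_N) : 'M[R]_N := 1%:M.

Definition euclidean_ball (R : realType) N : set 'rV[R]_N :=
  [set y | Num.sqrt (\sum_i y ord0 i ^+ 2) <= 1].

Definition euclidean_sphere (R : realType) N : set 'rV[R]_N :=
  [set y | Num.sqrt (\sum_i y ord0 i ^+ 2) = 1].

Definition volume_unit_ball (R : realType) N : \bar R :=
  riem_volume (@euclidean_metric R N) (@euclidean_ball R N).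

Definition area_unit_sphere (R : realType) N : \bar R :=
  riem_area (@euclidean_metric R N) (@euclidean_sphere R N).

(** * Differentiable manifolds *)

(* An N-dimensional smooth manifold with its atlas: the chart i is
   chart_coord i : chart_dom i -> 'rV_N, with inverse chart_inv i. *)
Record manifold (R : realType) (N : nat) := Manifold {
  carrier :> topologicalType;
  charts : Type;
  chart_dom : charts -> set carrier;
  chart_coord : charts -> carrier -> 'rV[R]_N;
  chart_inv : charts -> 'rV[R]_N -> carrier;
  carrier_hausdorff : hausdorff_space carrier;
  carrier_second_countable : @second_countable carrier;
  dom_cover : forall x, exists i, chart_dom i x;
  dom_open : forall i, open (chart_dom i);
  coord_open : forall i, open (chart_coord i @` chart_dom i);
  coordK : forall i x, chart_dom i x -> chart_inv i (chart_coord i x) = x;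
  coord_continuous : forall i x, chart_dom i x ->
    {for x, continuous (chart_coord i)};
  chart_inv_continuous : forall i x, chart_dom i x ->
    {for chart_coord i x, continuous (chart_inv i)};
  transition_smooth : forall i j k,
    class_C k (chart_coord i @` (chart_dom i `&` chart_dom j))
      (chart_coord j \o chart_inv i)
}.

Section tensors.
Context (R : realType) (N : nat) (M : manifold R N).

(* The entry (m, n) is d x_j^n / d x_i^m at x, for x_i, x_j the coordinates
   of the charts i and j. A tangent vector at x with components y in the
   chart i has components y *m transition i j x in the chart j. *)
Definition transition (i j : charts M) (x : M) : 'M[R]_N :=
  'J (chart_coord j \o @chart_inv R N M i) (chart_coord i x).

(* Geometric objects on M are given by their components in every chart,
   related on overlaps by the transformation law of their type: *)

(* functions K(x, y) of a tangent vector y at x *)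
Definition tangent_scalar (K : charts M -> M -> 'rV[R]_N -> R) : Prop :=
  forall i j x, chart_dom i x -> chart_dom j x ->
  forall y, K j x (y *m transition i j x) = K i x y.

(* twice covariant tensors a_mn(x) *)
Definition covariant2 (a : charts M -> M -> 'M[R]_N) : Prop :=
  forall i j x, chart_dom i x -> chart_dom j x ->
  transition i j x *m a j x *m (transition i j x)^T = a i x.

(* fibrewise maps y |-> zeta(x, y) of T_x M \ 0 *)
Definition fibre_map (zeta : charts M -> M -> 'rV[R]_N -> 'rV[R]_N) : Prop :=
  forall i j x, chart_dom i x -> chart_dom j x ->
  forall y, y != 0 ->
  zeta j x (y *m transition i j x) = zeta i x y *m transition i j x.

(* f(x, y), defined for y != 0, is of class C^k in y and C^l in x: for fixed
   x, resp. fixed y, and in every chart. *)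
Definition class_C_fibre (W : normedModType R) (k l : nat)
    (f : charts M -> M -> 'rV[R]_N -> W) : Prop :=
  (forall i x, chart_dom i x -> class_C k (@nonzero _) (f i x)) /\
  (forall i y, y != 0 ->
     class_C l (chart_coord i @` chart_dom i) (fun u => f i (chart_inv i u) y)).

End tensors.

(** * Finsler and Riemannian spaces *)

Section finsler.
Context (R : realType) (N : nat).

Definition partial (W : normedModType R) (m : 'I_N) (f : 'rV[R]_N -> W)
    (y : 'rV[R]_N) : W :=
  'D_(delta_mx ord0 m) f y.

(* g_mn = 1/2 d^2 K^2 / dy^m dy^n *)
Definition finsler_tensor (K : 'rV[R]_N -> R) (y : 'rV[R]_N) : 'M[R]_N :=
  \matrix_(m, n)
    (2^-1 * partial m (partial n (fun z => K z ^+ 2 : R^o)) y).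

Definition posdef (A : 'M[R]_N) : Prop :=
  A^T = A /\ forall v : 'rV[R]_N, v != 0 -> 0 < (v *m A *m v^T) ord0 ord0.

(* K lives on the nonzero tangent vectors; it is extended by 0 at the origin,
   so that the origin belongs to {K <= 1}. *)
Definition finsler_norm (K : 'rV[R]_N -> R) : Prop :=
  [/\ K 0 = 0,
      forall y, y != 0 -> 0 < K y,
      forall c y, 0 < c -> K (c *: y) = c * K y &
      forall y, y != 0 -> posdef (finsler_tensor K y)].

Definition finsleroid (K : 'rV[R]_N -> R) : set 'rV[R]_N :=
  [set y | K y <= 1].

Definition indicatrix (K : 'rV[R]_N -> R) : set 'rV[R]_N :=
  [set y | K y = 1].

Definition volume_finsleroid (K : 'rV[R]_N -> R) : \bar R :=
  riem_volume (finsler_tensor K) (finsleroid K).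

Definition area_indicatrix (K : 'rV[R]_N -> R) : \bar R :=
  riem_area (finsler_tensor K) (indicatrix K).

(* S(z) = sqrt (a_mn z^m z^n) *)
Definition riem_norm (a : 'M[R]_N) (z : 'rV[R]_N) : R :=
  Num.sqrt ((z *m a *m z^T) ord0 ord0).

(* z is a diffeomorphism of class C^k of 'rV_N \ 0 onto itself. *)
Definition punctured_diffeo (k : nat) (z : 'rV[R]_N -> 'rV[R]_N) : Prop :=
  class_C k (@nonzero _) z /\
  exists w : 'rV[R]_N -> 'rV[R]_N,
    [/\ class_C k (@nonzero _) w,
        forall y, y != 0 -> z y != 0 /\ w (z y) = y &
        forall y, y != 0 -> w y != 0 /\ z (w y) = y].

Variable M : manifold R N.

Definition finsler_metric (K : charts M -> M -> 'rV[R]_N -> R) : Prop :=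
  [/\ tangent_scalar K,
      class_C_fibre 5 4 (K : _ -> _ -> _ -> R^o) &
      forall i x, chart_dom i x -> finsler_norm (K i x)].

Definition riemannian_metric (a : charts M -> M -> 'M[R]_N) : Prop :=
  [/\ covariant2 a,
      forall i, class_C 4 (chart_coord i @` chart_dom i)
        (fun u => a i (chart_inv i u)) &
      forall i x, chart_dom i x -> posdef (a i x)].

Definition fibrewise_transformation
    (zeta : charts M -> M -> 'rV[R]_N -> 'rV[R]_N) : Prop :=
  [/\ fibre_map zeta,
      class_C_fibre 5 4 zeta &
      forall i x, chart_dom i x -> punctured_diffeo 5 (zeta i x)].

Definition homogeneous_of_degree (h : M -> R)
    (zeta : charts M -> M -> 'rV[R]_N -> 'rV[R]_N) : Prop :=
  forall i x, chart_dom i x -> forall c y, 0 < c -> y != 0 ->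
    zeta i x (c *: y) = (c `^ h x) *: zeta i x y.

Definition unit_to_unit (K : charts M -> M -> 'rV[R]_N -> R)
    (a : charts M -> M -> 'M[R]_N)
    (zeta : charts M -> M -> 'rV[R]_N -> 'rV[R]_N) : Prop :=
  forall i x, chart_dom i x -> forall y, y != 0 ->
    K i x y = 1 <-> riem_norm (a i x) (zeta i x y) = 1.

(* g_mn = varkappa^2 (d zeta^i / dy^m) (d zeta^j / dy^n) a_ij with
   varkappa = h^-1 K^(1 - h); the matrix 'J zeta has the entries
   (m, i) |-> d zeta^i / dy^m. *)
Definition conformal_relation (K : charts M -> M -> 'rV[R]_N -> R)
    (a : charts M -> M -> 'M[R]_N) (h : M -> R)
    (zeta : charts M -> M -> 'rV[R]_N -> 'rV[R]_N) : Prop :=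
  forall i x, chart_dom i x -> forall y, y != 0 ->
    let varkappa := (h x)^-1 * (K i x y `^ (1 - h x)) in
    finsler_tensor (K i x) y =
      varkappa ^+ 2 *:
        ('J (zeta i x) y *m a i x *m ('J (zeta i x) y)^T).

End finsler.

(* Main.v *)
Require Import Defs.
From HB Require Import structures.
From mathcomp Require Import all_boot all_order all_algebra.
From mathcomp Require Import all_classical all_reals all_analysis.
From mathcomp Require Import measurable_realfun.
From mathcomp Require Import ring lra.

Import Order.TTheory GRing.Theory Num.Theory.
Import numFieldNormedType.Exports.

Set Implicit Arguments.
Unset Strict Implicit.
Unset Printing Implicit Defensive.

Local Open Scope classical_set_scope.
Local Open Scope ring_scope.

(** Fix a point x, write g for the Finsler metric tensor in the tangent space
   and N = n + 1.  If a = P P^T, the map z = zeta P replaces the Riemannian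
   tensor a by the Euclidean one, homogeneity and the condition on unit vectors
   give |z(y)| = K(y)^h, and g is (K^(1 - h) / h)^2 times the pull-back of the
   Euclidean metric under z.

   Area.  On the indicatrix K = 1, so there g is h^-2 times the pull-back, and
   z maps the indicatrix onto the unit sphere.  Lengths along the indicatrix
   are 1 / h times those of their images, hence the (N - 1)-dimensional areas
   are h^-(N - 1) times as large [is_riem_area_pullback].

   Volume.  The map Z = |z|^(1/h - 1) z is homogeneous of degree 1 with
   |Z| = K, so it maps the punctured Finsleroid bijectively onto the punctured
   ball.  The radial map v |-> |v|^(1/h - 1) v has the Jacobian determinant
   |v|^(N (1/h - 1)) / h [det_radial_jac]; therefore
   sqrt (det g) = h^-(N - 1) |det JZ| [sqrt_det_finsler_tensor], and the volume
   is h^-(N - 1) times that of the ball by change of variables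
   [lebesgue_image_integral].

   The area of a hypersurface is given by cutting it into parametrized pieces,
   so for the sphere it has to be shown that such a decomposition exists and
   that its value does not depend on the choice.  The cones over the pieces
   tile the punctured ball, and in polar coordinates the cone over a piece has
   1 / N times its area as volume [lebesgue_cone]; so every decomposition has
   the value N vol(ball) [is_riem_area_sphere].  Stereographic projection gives
   a decomposition [is_riem_area_stereo], which the inverse of z carries to the
   indicatrix [decomposition_comp].  For N = 2 stereographic projection also
   evaluates the length of the circle, as the integral of 2 / (1 + t^2)
   [lebesgue_disc].

   Change of variables for an injective C^1 map f with invertible Jacobian
   follows from three facts: an invertible affine map scales Lebesgue measure
   by its determinant [scales_lebesgue_unit]; a map that does not decrease
   distances by more than a factor L does not decrease measure by more than
   L^n [lebesgue_expanding]; and, up to its linear part, f is locally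
   Lipschitz with constants close to 1 in both directions
   [change_of_variables_local].  Borel sets have Borel images under f because
   open sets are countable unions of compact ones [measurable_image_inj]. *)

(** * Dyadic cells and the Borel sets of the space of row vectors *)

Section dyadic_cells.
Context (R : realType) (n : nat).
Implicit Types (v w : 'rV[R]_n) (E : set 'rV[R]_n).

(** The open half-lines generate the Borel sets of the line. *)
Lemma rv_measurable_ind (C : set (set 'rV[R]_n)) : sigma_algebra setT C ->
  (forall i (r : R), C [set v : 'rV[R]_n | v ord0 i < r]) -> measurable `<=` C.
Proof.
move=> sC Cray; case: (sC) => C0 CC CU.
apply: smallest_sub => //.
rewrite -bigcup_seq; apply: bigcup_sub => /= i _ _ [B mB <-].
have {}mB : <<s @RGenInftyO.G R >> B.
  have -> : <<s @RGenInftyO.G R >> = <<s @ocitv R >>.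
    exact/esym/RGenInftyO.measurableE.
  exact: mB.
rewrite setTI; move: B mB; apply: smallest_sub.
  split=> [|A CA|F CF].
  - by rewrite preimage_set0.
  - by rewrite setTD preimage_setC -setTD; exact: CC.
  - by rewrite preimage_bigcup; exact: CU.
move=> _ [x ->] /=.
suff <- : [set v : 'rV[R]_n | v ord0 i < x] = rv_coord i @^-1` `]-oo, x[%classic.
  exact: Cray.
by apply/seteqP; split => v /=; rewrite in_itv.
Qed.

(** Cells are the fibres of a map to integer vectors, so that a union of cells
   of one level is the preimage of a set of integer vectors. *)
Definition grid k v : 'rV[int]_n :=
  \row_i Num.floor (2 ^+ k * v ord0 i).

Definition cell k (c : 'rV[int]_n) : set 'rV[R]_n := grid k @^-1` [set c].

Lemma gridP k v i (m : int) :
  (m <= grid k v ord0 i) = (m%:~R <= 2 ^+ k * v ord0 i).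
Proof. by rewrite mxE floor_ge_int. Qed.

(** A cell of level l lies in a single cell of every coarser level k. *)
Lemma eq_grid_le k l v w : (k <= l)%N -> grid l v = grid l w ->
  grid k v = grid k w.
Proof.
move=> kl e; apply/rowP => i.
have H u (m : int) :
    (m <= grid k u ord0 i) = (m * 2 ^+ (l - k) <= grid l u ord0 i).
  rewrite !gridP intrM rmorphXn/=.
  have k0 : 0 < 2 ^+ (l - k) :> R by rewrite exprn_gt0.
  by rewrite -[LHS](ler_pM2r k0) mulrAC -exprD subnKC.
by apply/eqP; rewrite eq_le; apply/andP; split;
  [rewrite H -e -H | rewrite H e -H].
Qed.

Lemma countable_grid : countable [set: 'rV[int]_n].
Proof. exact: countableP. Qed.

Lemma measurable_grid k (P : set 'rV[int]_n) : measurable (grid k @^-1` P).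
Proof.
rewrite (_ : _ @^-1` _ = \bigcup_(c : 'rV[int]_n)
    (if pselect (P c) then cell k c else set0)); last first.
  apply/seteqP; split => [v /= Pv|v [c _]].
    by exists (grid k v) => //; case: pselect => //= nP; exact: nP.
  by case: pselect => //= Pc; rewrite /cell /= => ->.
apply: countable_bigcupT_measurable; first exact: countable_grid.
move=> c; case: (pselect (P c)) => [_|_] /=; last exact: measurable0.
rewrite (_ : cell k c = \bigcap_(i in [set: 'I_n])
   (rv_coord i @^-1` [set r | Num.floor (2 ^+ k * r) = c ord0 i])).
  apply: fin_bigcap_measurable => // i _; rewrite -[X in measurable X]setTI.
  apply: measurable_rv_coord => //.
  rewrite (_ : [set _ | _] =
      `[(c ord0 i)%:~R / 2 ^+ k, (c ord0 i + 1)%:~R / 2 ^+ k[%classic) //.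
  apply/seteqP; split => r /=; rewrite in_itv/= ler_pdivrMr ?exprn_gt0//
    ltr_pdivlMr ?exprn_gt0// [r * _]mulrC.
    by move=> /eqP; rewrite floor_eq.
  by rewrite -floor_eq => /eqP.
apply/seteqP; split => v /=.
  by rewrite /cell/= => <- i _ /=; rewrite mxE.
by move=> H; apply/rowP => i; rewrite mxE; exact: H.
Qed.

Lemma measurable_cell k c : measurable (cell k c).
Proof. exact: measurable_grid. Qed.

Lemma cell_dist k c v w i : cell k c v -> cell k c w ->
  `|v ord0 i - w ord0 i| <= (2 ^+ k)^-1.
Proof.
rewrite /cell /= => <- /rowP/(_ i); rewrite !mxE => e.
have k0 : 0 < 2 ^+ k :> R by rewrite exprn_gt0.
have := floor_itv (2 ^+ k * v ord0 i); have := floor_itv (2 ^+ k * w ord0 i).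
rewrite e intrD; set x := (Num.floor _)%:~R => /andP[w1 w2] /andP[v1 v2].
rewrite -(ler_pM2l k0) divff ?gt_eqF// -[X in X * _](gtr0_norm k0) -normrM.
by rewrite mulrBr ler_norml; apply/andP; split; lra.
Qed.

Lemma mx_norm_leP v (r : R) : 0 <= r ->
  (forall i, `|v ord0 i| <= r) <-> `|v| <= r.
Proof.
move=> r0; rewrite -[`|v|]/(mx_norm v) mx_normrE; split.
  move=> H; apply/bigmax_leP; split => //= -[a b] _ /=.
  by rewrite (ord1 a).
by move=> /bigmax_leP[_ H] i; exact: (H (ord0, i)).
Qed.

Lemma cell_normB k c v w : cell k c v -> cell k c w ->
  `|v - w| <= (2 ^+ k)^-1.
Proof.
move=> cv cw; apply/mx_norm_leP; first by rewrite invr_ge0 exprn_ge0.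
by move=> i; rewrite !mxE; exact: cell_dist cv cw.
Qed.

Lemma expr2V_lt (e : R) : 0 < e -> exists k, (2 ^+ k)^-1 < e.
Proof.
move=> e0; exists (Num.truncn e^-1).+1.
rewrite invf_plt ?posrE ?exprn_gt0//.
apply: lt_trans (truncnS_gt _) _.
by rewrite -natrX ltr_nat ltn_expl.
Qed.

(** An open set is the union of the dyadic cells that it contains. *)
Lemma open_measurable_rv (U : set 'rV[R]_n) : open U -> measurable U.
Proof.
move=> oU; rewrite (_ : U = \bigcup_k
    (grid k @^-1` [set c | cell k c `<=` U])).
  by apply: bigcupT_measurable => k; exact: measurable_grid.
apply/seteqP; split => [v Uv|v [k _ /=]]; last exact.
have /nbhs_ballP[e /= e0 eU] : nbhs v U by exact: open_nbhs_nbhs.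
have [k ke] := expr2V_lt e0; exists k => // w cw; apply: eU.
rewrite -ball_normE/=; apply: le_lt_trans ke.
exact: (@cell_normB k (grid k v)).
Qed.

Lemma closed_measurable_rv (F : set 'rV[R]_n) : closed F -> measurable F.
Proof.
move=> cF; rewrite -[F]setCK; apply: measurableC.
by apply: open_measurable_rv; exact: closed_openC.
Qed.

End dyadic_cells.

Section approximation.
Context (R : realType) (n : nat).
Implicit Types (E : set 'rV[R]_n).
Local Notation grid := (@grid R n).
Local Notation cell := (@cell R n).

(** The sets that are unions of cells of one level form an algebra generating
   the Borel sets, so that they approximate them for any finite measure. *)
Lemma grid_approx (m : {measure set 'rV[R]_n -> \bar R}) E (d : R) :
  (m setT < +oo)%E -> measurable E -> 0 < d ->
  exists k (P : set 'rV[int]_n), (m (E `+` (grid k @^-1` P)) < d%:E)%E.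
Proof.
move=> moo mE; move: d.
pose good E := measurable E /\ forall d : R, 0 < d ->
  exists k (P : set 'rV[int]_n), (m (E `+` (grid k @^-1` P)) < d%:E)%E.
suff : measurable `<=` good by move=> /(_ E mE)[].
have mY k P A : measurable A -> measurable (A `+` (grid k @^-1` P)).
  by move=> mA; apply: measurableU; apply: measurableD => //;
    exact: measurable_grid.
have fm A : measurable A -> (m A < +oo)%E.
  by move=> mA; apply: le_lt_trans moo; apply: le_measure; rewrite ?inE.
have good_grid k (P : set 'rV[int]_n) : good (grid k @^-1` P).
  split; first exact: measurable_grid.
  move=> d d0; exists k, P; rewrite (_ : _ `+` _ = set0) ?measure0//.
  by rewrite setYK.
have goodU A B : good A -> good B -> good (A `|` B).
  move=> [mA gA] [mB gB]; split; first exact: measurableU.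
  move=> d d0; have d20 : 0 < d / 2 by rewrite divr_gt0.
  have [k [P kP]] := gA _ d20; have [l [Q lQ]] := gB _ d20.
  exists (maxn k l).
  exists [set c | exists v, grid (maxn k l) v = c /\ (P (grid k v) \/ Q (grid l v))].
  rewrite (_ : d%:E = (d / 2)%:E + (d / 2)%:E)%E; last first.
    by rewrite -EFinD -splitr.
  apply: le_lt_trans (lteD kP lQ).
  apply: le_trans (measureU2 _ (mY _ _ _ mA) (mY _ _ _ mB)).
  apply: le_measure; rewrite ?inE.
  - by apply: mY; exact: measurableU.
  - by apply: measurableU; exact: mY.
  have eG v : [set c | exists v, grid (maxn k l) v = c /\
      (P (grid k v) \/ Q (grid l v))] (grid (maxn k l) v) <->
      (P (grid k v) \/ Q (grid l v)).
    split=> [[w [e]]|]; last by exists v.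
    by rewrite (eq_grid_le (leq_maxl k l) e) (eq_grid_le (leq_maxr k l) e).
  move=> v [[ABv nG]|[/(iffLR (eG v)) PQv nAB]].
    have nPQ : ~ (P (grid k v) \/ Q (grid l v)) by move=> /(iffRL (eG v)).
    by have [Av|Bv] := ABv; [left|right]; left; split => //= ?; apply: nPQ; [left|right].
  by have [Pv|Qv] := PQv; [left|right]; right; split => //= ?; apply: nAB; [left|right].
have goodbigcup (F : (set 'rV[R]_n)^nat) :
    (forall k, good (F k)) -> good (\bigcup_k F k).
  move=> gF; pose G k := \big[setU/set0]_(i < k) F i.
  have gG k : good (G k).
    apply: (big_ind good) => [|A B gA gB|i _]; last exact: gF.
      by have := good_grid 0%N set0; rewrite preimage_set0.
    exact: goodU.
  have mF : measurable (\bigcup_k F k).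
    by apply: bigcupT_measurable => k; have [] := gF k.
  split=> // d d0; have d20 : 0 < d / 2 by rewrite divr_gt0.
  have cvg0 : m \o (fun k => \bigcup_k F k `\` G k) @ \oo --> (0 : \bar R)%E.
    rewrite -(measure0 m).
    have <- : \bigcap_k (\bigcup_k F k `\` G k) = set0.
      apply/seteqP; split => // v /= H; have [[k _ Fk] _] := H 0%N I.
      have [_] := H k.+1 I; apply.
      by rewrite /G big_ord_recr/=; right.
    apply: nonincreasing_cvg_mu => [|k||].
    - by apply: fm; apply: measurableD => //; have [] := gG 0%N.
    - by apply: measurableD => //; have [] := gG k.
    - apply: bigcapT_measurable => k.
      by apply: measurableD => //; have [] := gG k.
    - apply/nonincreasing_seqP => k; apply/subsetPset; apply: setDS.
      by rewrite /G big_ord_recr/=; exact: subsetUl.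
  have d2E : (0 < (d / 2)%:E)%E by rewrite lte_fin.
  have [k _ /(_ k (leqnn _)) /= kd] := cvg0 _ (open_ereal_lt' d2E).
  have [l [P lP]] := (gG k).2 _ d20.
  exists l, P; rewrite (_ : d%:E = (d / 2)%:E + (d / 2)%:E)%E; last first.
    by rewrite -EFinD -splitr.
  have mG := (gG k).1.
  apply: le_lt_trans (lteD kd lP).
  have mD : measurable (\bigcup_k F k `\` G k) by exact: measurableD.
  apply: le_trans (measureU2 m mD (mY _ _ _ mG)).
  apply: le_measure; rewrite ?inE.
  - exact: mY.
  - by apply: measurableU => //; exact: mY.
  have GF : G k `<=` \bigcup_k F k.
    by rewrite /G -bigcup_mkord; exact: bigcup_subset.
  move=> v /= [[Fv nP]|[Pv nF]].
    by have [Gv|Gv] := pselect (G k v); [right; left|left].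
  by right; right; split => // /GF.
apply: rv_measurable_ind; last first.
  move=> i r; pose F k := grid k @^-1` [set c : 'rV[int]_n | (c ord0 i + 1)%:~R <= 2 ^+ k * r].
  rewrite (_ : [set v : 'rV[R]_n | v ord0 i < r] = \bigcup_k (F k)).
    by apply: goodbigcup => k; exact: good_grid.
  apply/seteqP; split => [v /= vr|v [k _]] /=.
    have [k kr] := expr2V_lt (etrans (subr_gt0 _ _) vr).
    exists k => //; rewrite /F/= mxE intrD.
    have k0 : 0 < 2 ^+ k :> R by rewrite exprn_gt0.
    move: kr; rewrite -(ltr_pM2l k0) divff ?gt_eqF// mulrBr => kr.
    have := floor_le (2 ^+ k * v ord0 i); lra.
  rewrite /F/= mxE => h; have k0 : 0 < 2 ^+ k :> R by rewrite exprn_gt0.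
  rewrite -(ltr_pM2l k0); apply: lt_le_trans h; exact: floorD1_gt.
split=> //.
- by have := good_grid 0%N set0; rewrite preimage_set0.
- move=> A [mA gA]; rewrite setTD; split; first exact: measurableC.
  move=> d d0; have [k [P kP]] := gA _ d0; exists k, (~` P).
  rewrite -preimage_setC (_ : _ `+` _ = A `+` (grid k @^-1` P))//.
  apply/seteqP; split => v /=.
    by move=> [[nA /contrapT Pv]|[nP /contrapT Av]]; [right|left].
  by move=> [[Av nP]|[Pv nA]]; [right|left]; split => //; apply.
Qed.

(** The cells of level k form a countable partition. *)
Lemma le_measure_split (m1 m2 : {measure set 'rV[R]_n -> \bar R}) k E :
  measurable E ->
  (forall c, (m1 (E `&` cell k c) <= m2 (E `&` cell k c))%E) ->
  (m1 E <= m2 E)%E.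
Proof.
move=> mE H; pose F j := E `&` grid k @^-1` [set c : 'rV[int]_n | pickle c = j].
have mF j : measurable (F j) by apply: measurableI => //; exact: measurable_grid.
have EF : E = \bigcup_j F j.
  apply/seteqP; split => [v Ev|v [j _ []]//].
  by exists (pickle (grid k v)).
have tF : trivIset setT F.
  by move=> i j _ _ [v [[_ /= <-] [_ /= <-]]].
rewrite EF !measure_semi_bigcup//; last 2 first.
- by rewrite -EF.
- by rewrite -EF.
apply: lee_nneseries => // j _.
case: (pselect (exists c : 'rV[int]_n, pickle c = j)) => [[c cj]|nc].
  rewrite (_ : F j = E `&` cell k c) //.
  apply/seteqP; split => v [Ev /= e]; split => //=; last by rewrite e.
  by apply: (pcan_inj pickleK); rewrite cj.
rewrite (_ : F j = set0) ?measure0//.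
by apply/seteqP; split => // v [_ /= e]; apply: nc; exists (grid k v).
Qed.

(** Inside a cell of level 0 both measures are finite, so that a Borel set can
   be replaced by a union of small cells at a small cost for both. *)
Lemma le_measure_cell (m1 m2 : {measure set 'rV[R]_n -> \bar R}) :
  (forall k c, (m1 (cell k c) <= m2 (cell k c))%E) ->
  (forall c, (m2 (cell 0 c) < +oo)%E) ->
  forall E, measurable E -> (m1 E <= m2 E)%E.
Proof.
move=> H H0.
have Hg k (P : set 'rV[int]_n) : (m1 (grid k @^-1` P) <= m2 (grid k @^-1` P))%E.
  apply: (@le_measure_split _ _ k); first exact: measurable_grid.
  move=> c; case: (pselect (P c)) => Pc.
    rewrite (_ : _ `&` _ = cell k c) //; apply/setIidPr => v.
    by rewrite /cell /= => ->.
  rewrite (_ : _ `&` _ = set0) ?measure0//.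
  by apply/seteqP; split => // v []; rewrite /cell /= => + e; rewrite e.
move=> E mE; apply: (@le_measure_split _ _ 0) => // c.
have mc := @measurable_cell R n 0 c.
pose m := mrestr (measure_add m1 m2) mc.
apply/lee_addgt0Pr => d d0.
have moo : (m setT < +oo)%E.
  rewrite /m /mrestr setTI [ltLHS]measure_addE.
  by rewrite lte_add_pinfty// (le_lt_trans (H _ _)).
have [k [P]] := grid_approx moo mE d0.
rewrite /m/= /mrestr [ltLHS]measure_addE => mP.
have mPk : measurable (grid k @^-1` P) := measurable_grid k P.
set Q := grid k @^-1` P in mP mPk *.
have mEQ : measurable ((E `+` Q) `&` cell 0 c).
  by apply: measurableI => //; apply: measurableU; exact: measurableD.
apply: (@le_trans _ _ (m1 (Q `&` cell 0 c) + m1 ((E `+` Q) `&` cell 0 c))%E).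
  apply: le_trans (measureU2 _ _ _) => //; last exact: measurableI.
  apply: le_measure; rewrite ?inE; [exact: measurableI| |].
    by apply: measurableU => //; exact: measurableI.
  move=> v [Ev cv]; case: (pselect (Q v)) => Qv; first by left.
  by right; split => //; left.
have h1 : (m1 (Q `&` cell 0 c) <= m2 (Q `&` cell 0 c))%E.
  rewrite (_ : Q `&` _ = grid k @^-1` [set b | P b /\
      exists v, grid k v = b /\ grid 0 v = c]) //.
  apply/seteqP; split => v /=.
    by move=> [Qv cv]; split => //; exists v.
  by move=> [Pv [w [/(eq_grid_le (leq0n k)) e <-]]]; split.
have h2 : (m2 (Q `&` cell 0 c) <= m2 (E `&` cell 0 c) +
    m2 ((E `+` Q) `&` cell 0 c))%E.
  apply: le_trans (measureU2 _ _ _) => //; last exact: measurableI.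
  apply: le_measure; rewrite ?inE; [exact: measurableI| |].
    by apply: measurableU => //; exact: measurableI.
  move=> v [Qv cv]; case: (pselect (E v)) => Ev; first by left.
  by right; split => //; right.
apply: le_trans (leeD (le_trans h1 h2) (lexx _)) _.
by rewrite -addeA leeD2l// addeC ltW.
Qed.

End approximation.

(** * Continuity and measurability in the space of row vectors *)

Section continuity.
Context (R : realType).

Lemma continuous_dist (T : topologicalType) (f : T -> R) x (e : R) :
  {for x, continuous f} -> 0 < e -> \forall t \near x, `|f x - f t| <= e.
Proof. by move=> /cvgrPdist_le; apply. Qed.

Lemma mx_continuousP (T : topologicalType) m n (f : T -> 'M[R]_(m, n)) x :
  (forall i j, {for x, continuous (fun t => f t i j)}) ->
  {for x, continuous f}.
Proof.
move=> cf; apply/cvgrPdist_le => e e0.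
have : \forall t \near x, forall i j, `|f x i j - f t i j| <= e.
  apply: filter_forall => i; apply: filter_forall => j.
  exact: continuous_dist.
apply: filterS => t H; rewrite [leLHS]/Num.Def.normr/= mx_normrE.
by apply: bigmax_le => [|[i j] _]; [exact: ltW|rewrite !mxE].
Qed.

Lemma rv_continuousP (T : topologicalType) n (f : T -> 'rV[R]_n) x :
  (forall j, {for x, continuous (fun t => f t ord0 j)}) ->
  {for x, continuous f}.
Proof. by move=> cf; apply: mx_continuousP => i j; rewrite (ord1 i). Qed.

Lemma mx_entry_continuous (T : topologicalType) m n (f : T -> 'M[R]_(m, n)) x i j :
  {for x, continuous f} -> {for x, continuous (fun t => f t i j)}.
Proof.
move=> cf; apply: (@continuous_comp _ _ _ f (fun M : 'M[R]_(m, n) => M i j)) => //.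
exact: coord_continuous.
Qed.

Lemma mx_continuous_dist (T : topologicalType) m n (f : T -> 'M[R]_(m, n)) x (e : R) :
  {for x, continuous f} -> 0 < e ->
  \forall t \near x, forall i j, `|f x i j - f t i j| <= e.
Proof.
move=> cf e0; apply: filter_forall => i; apply: filter_forall => j.
apply: continuous_dist => //; exact: mx_entry_continuous.
Qed.

Lemma sum_continuous_at (T : topologicalType) (I : Type) (r : seq I)
    (f : I -> T -> R) x :
  (forall i, {for x, continuous (f i)}) ->
  {for x, continuous (fun t => \sum_(i <- r) f i t)}.
Proof.
move=> cf; elim: r => [|i r IH].
  rewrite (_ : (fun _ => _) = cst 0); first exact: cst_continuous.
  by apply/funext => t; rewrite big_nil.
rewrite (_ : (fun _ => _) = (fun t => f i t + \sum_(i <- r) f i t)).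
  exact: cvgD (cf i) IH.
by apply/funext => t; rewrite big_cons.
Qed.

Lemma mulmx_coord_continuous (T : topologicalType) m n p
    (f : T -> 'M[R]_(m, n)) (g : T -> 'M[R]_(n, p)) x i j :
  {for x, continuous f} -> {for x, continuous g} ->
  {for x, continuous (fun t => (f t *m g t) i j)}.
Proof.
move=> cf cg; rewrite (_ : (fun t => _) = fun t => \sum_k f t i k * g t k j).
  by apply: sum_continuous_at => k; apply: cvgM; exact: mx_entry_continuous.
by apply/funext => t; rewrite mxE.
Qed.

Lemma mulmxr_continuous m n (A : 'M[R]_(m, n)) :
  continuous (fun v : 'rV[R]_m => v *m A).
Proof.
move=> v; apply: rv_continuousP => j.
by apply: mulmx_coord_continuous => //; exact: cst_continuous.
Qed.

Lemma open_continuous_preimage (T : topologicalType) (S : topologicalType)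
    (U : set T) (f : T -> S) (V : set S) :
  open U -> (forall x, U x -> {for x, continuous f}) -> open V ->
  open (U `&` f @^-1` V).
Proof.
move=> oU cf oV; rewrite openE => x [Ux Vfx].
rewrite /interior; apply: filterI; first exact: open_nbhs_nbhs.
by apply: cf => //; exact: open_nbhs_nbhs.
Qed.

Lemma continuous_measurable_rv n (U D : set 'rV[R]_n) (f : 'rV[R]_n -> R) :
  open U -> (forall x, U x -> {for x, continuous f}) ->
  measurable D -> D `<=` U -> measurable_fun D f.
Proof.
move=> oU cf mD DU.
apply: (@measurable_funS _ _ _ _ U) => //; first exact: open_measurable_rv.
apply: (measurability _ (RGenOpens.measurableE R)) => _ [_ [a [b ->] <-]].
by apply: open_measurable_rv; apply: open_continuous_preimage.
Qed.

Lemma measurable_fun_rv_on d (T : measurableType d) n (D : set T)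
    (f : T -> 'rV[R]_n) : measurable D ->
  (forall i, measurable_fun D (fun t => f t ord0 i)) -> measurable_fun D f.
Proof.
move=> mD mf; apply/(measurable_restrictT _ mD).
apply: measurable_fun_rvP => i.
have /(measurable_restrictT _ mD) := mf i.
rewrite (_ : _ \_ D = rv_coord i \o (f \_ D))//.
apply/funext => t; rewrite /patch /rv_coord /=; case: ifP => // _.
by rewrite /point/= mxE.
Qed.

Lemma continuous_measurable_rv_rv m n (U D : set 'rV[R]_m)
    (f : 'rV[R]_m -> 'rV[R]_n) :
  open U -> (forall x, U x -> {for x, continuous f}) ->
  measurable D -> D `<=` U -> measurable_fun D f.
Proof.
move=> oU cf mD DU; apply: measurable_fun_rv_on => // i.
apply: (@continuous_measurable_rv _ U) => // x Ux.
by apply: mx_entry_continuous; exact: cf.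
Qed.

Lemma measurable_affine m n (A : 'M[R]_(m, n)) (b : 'rV[R]_n) :
  measurable_fun setT (fun v : 'rV[R]_m => v *m A + b).
Proof.
apply: (@continuous_measurable_rv_rv _ _ setT) => //; first exact: openT.
move=> v _; apply: continuousD; first exact: mulmxr_continuous.
exact: cst_continuous.
Qed.

End continuity.

(** * Lebesgue measure of boxes; maps that do not decrease distances *)

Section boxes.
Context (R : realType).
Local Notation lam := (lebesgue_rV R).

Lemma rv_cons0 n (p : measurableTypeR R * 'rV[R]_n) :
  rv_cons p ord0 ord0 = p.1.
Proof.
rewrite /rv_cons; have -> : (ord0 : 'I_n.+1) = lshift n (ord0 : 'I_1).
  exact/val_inj.
by apply: etrans (row_mxEl _ _ _ _) _; rewrite mxE mulr1n.
Qed.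

Lemma rv_consS n (p : measurableTypeR R * 'rV[R]_n) i :
  rv_cons p ord0 (lift ord0 i) = p.2 ord0 i.
Proof.
rewrite /rv_cons; have -> : lift ord0 i = rshift 1 i by exact/val_inj.
exact: row_mxEr.
Qed.

Lemma lebesgue_rVS n (E : set 'rV[R]_n.+1) :
  lam n.+1 E = (@lebesgue_measure R \x lam n)%E (@rv_cons R n @^-1` E).
Proof. by []. Qed.

Definition rv_box n (A : 'I_n -> set R) : set 'rV[R]_n :=
  [set v | forall i, A i (v ord0 i)].

Lemma measurable_rv_box n (A : 'I_n -> set R) :
  (forall i, measurable (A i : set (measurableTypeR R))) ->
  measurable (rv_box A).
Proof.
move=> mA; rewrite (_ : rv_box A = \bigcap_(i in [set: 'I_n]) (rv_coord i @^-1` A i)).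
  apply: fin_bigcap_measurable => // i _; rewrite -[X in measurable X]setTI.
  exact: measurable_rv_coord.
by apply/seteqP; split => v /= H; [move=> i _; exact: H|move=> i; exact: H].
Qed.

Lemma lebesgue_rV_box n (A : 'I_n -> set R) (l : 'I_n -> R) :
  (forall i, measurable (A i : set (measurableTypeR R))) ->
  (forall i, lebesgue_measure (A i) = (l i)%:E) ->
  lam n (rv_box A) = (\prod_i l i)%:E.
Proof.
elim: n A l => [|n IH] A l mA lA.
  rewrite big_ord0 /= diracE mem_set//.
  by case.
rewrite lebesgue_rVS.
rewrite (_ : _ @^-1` _ = A ord0 `*` rv_box (fun i : 'I_n => A (lift ord0 i))).
  rewrite product_measure1E//; last exact: measurable_rv_box.
  by rewrite big_ord_recl EFinM -(IH (fun i => A (lift ord0 i)))// -lA.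
apply/seteqP; split => -[t v] /=.
  move=> H; split; first by have := H ord0; rewrite rv_cons0.
  by move=> i; have := H (lift ord0 i); rewrite rv_consS.
move=> [At Av] i; case: (unliftP ord0 i) => [j ->|->].
  by rewrite rv_consS; exact: Av.
by rewrite rv_cons0.
Qed.

Lemma lebesgue_cell n k c : lam n (cell k c) = (((2 ^+ k)^-1) ^+ n)%:E.
Proof.
have k0 : 0 < 2 ^+ k :> R by rewrite exprn_gt0.
rewrite (_ : cell k c = rv_box (fun i =>
    `[(c ord0 i)%:~R / 2 ^+ k, (c ord0 i + 1)%:~R / 2 ^+ k[%classic)).
  rewrite (@lebesgue_rV_box _ _ (fun=> (2 ^+ k)^-1)).
  - by rewrite prodr_const card_ord.
  - by move=> i; exact: measurable_itv.
  move=> i; rewrite lebesgue_measure_itv/= lte_fin ltr_pM2r ?invr_gt0//.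
  by rewrite ltr_int ltrDl ltr01 -EFinB -mulrBl -intrB addrAC subrr add0r mul1r.
apply/seteqP; split => v /=.
  move=> <- i; rewrite /= in_itv/= !mxE ler_pdivrMr// ltr_pdivlMr//.
  by rewrite mulrC floor_itv.
move=> H; apply/rowP => i; rewrite mxE; apply/eqP; rewrite floor_eq.
have := H i; rewrite /= in_itv/= ler_pdivrMr// ltr_pdivlMr//.
by rewrite mulrC.
Qed.

(** A set of diameter at most d for the sup norm lies in a cube of side d. *)
Lemma lebesgue_diam n (S : set 'rV[R]_n) (d : R) : measurable S -> 0 <= d ->
  (forall v w, S v -> S w -> `|v - w| <= d) -> (lam n S <= (d ^+ n)%:E)%E.
Proof.
move=> mS d0 Sd.
have [->|/set0P[v0 Sv0]] := eqVneq S set0.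
  by rewrite measure0 lee_fin exprn_ge0.
pose b i := inf [set v ord0 i | v in S].
have lb i v : S v -> lbound [set v ord0 i | v in S] (v ord0 i - d).
  move=> Sv _ [w Sw <-].
  have := Sd _ _ Sv Sw => /(mx_norm_leP _ d0)/(_ i); rewrite !mxE.
  by rewrite ler_norml => /andP[_]; rewrite lerBlDr -lerBlDl.
have sub : S `<=` rv_box (fun i => `[b i, b i + d]%classic).
  move=> v Sv i /=; rewrite in_itv/=; apply/andP; split.
    apply: ge_inf; last by exists v.
    by exists (v0 ord0 i - d); exact: lb.
  rewrite -lerBlDr; apply: lb_le_inf; last exact: lb.
  by exists (v0 ord0 i), v0.
have mbox : measurable (rv_box (fun i => `[b i, b i + d]%classic)).
  by apply: measurable_rv_box => i; exact: measurable_itv.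
have bE : lam n (rv_box (fun i => `[b i, b i + d]%classic)) = (d ^+ n)%:E.
  rewrite (@lebesgue_rV_box _ _ (fun=> d)).
  - by rewrite prodr_const card_ord.
  - by move=> i; exact: measurable_itv.
  move=> i; rewrite lebesgue_measure_itv/= lte_fin ltrDl.
  have [_|] := ltrP 0 d; first by rewrite -EFinB addrAC subrr add0r.
  by move=> d0'; congr EFin; apply/eqP; rewrite eq_le d0 d0'.
by rewrite -bE; apply: le_measure; rewrite ?inE.
Qed.

(** The preimage of a cell has small diameter, hence small measure, and a
   comparison of two measures on cells extends to all Borel sets. *)
Lemma lebesgue_expanding n (F : set 'rV[R]_n) (g : 'rV[R]_n -> 'rV[R]_n) (L : R) :
  measurable F -> measurable_fun F g -> 0 <= L ->
  (forall v w, F v -> F w -> `|v - w| <= L * `|g v - g w|) ->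
  forall E, measurable E ->
  (lam n (F `&` g @^-1` E) <= (L ^+ n)%:E * lam n E)%E.
Proof.
move=> mF mg L0 gL E mE.
have mg' : measurable_fun setT (g \_ F) by apply/(measurable_restrictT _ mF).
pose m1 : {measure set 'rV[R]_n -> \bar R} :=
  measure_function_pushforward__canonical__measure_function_Measure
    (mrestr (lam n) mF) mg'.
pose m2 : {measure set 'rV[R]_n -> \bar R} := mscale (NngNum (exprn_ge0 n L0)) (lam n).
have m1E A : m1 A = lam n (F `&` g @^-1` A).
  rewrite /m1/= /pushforward/= /mrestr; congr (lam n _).
  apply/seteqP; split => v /=; rewrite /patch.
    by move=> [+ Fv]; rewrite mem_set.
  by move=> [Fv]; rewrite mem_set.
have := @le_measure_cell R n m1 m2 _ _ E mE; rewrite m1E; apply.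
- move=> k c; rewrite m1E /m2/= /mscale/= lebesgue_cell -EFinM -exprMn.
  apply: lebesgue_diam.
  + by apply: mg => //; exact: measurable_cell.
  + by rewrite mulr_ge0// invr_ge0 exprn_ge0.
  move=> v w [Fv gv] [Fw gw]; apply: le_trans (gL _ _ Fv Fw) _.
  by rewrite ler_wpM2l//; exact: cell_normB gv gw.
by move=> c; rewrite /m2/= /mscale/= lebesgue_cell -EFinM ltry.
Qed.

End boxes.

(** * Invertible affine maps scale Lebesgue measure by the determinant *)

Section skew_products.
Local Open Scope ereal_scope.
Context d1 d2 (X : measurableType d1) (Y : measurableType d2) (R : realType).
Variables (mu : {sigma_finite_measure set X -> \bar R}).
Variables (nu : {sigma_finite_measure set Y -> \bar R}).

Lemma integral_scaled d (T : measurableType d) (m : {measure set T -> \bar R})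
    (f : T -> T) (c : {nonneg R}) (h : T -> \bar R) :
  measurable_fun setT f ->
  (forall B, measurable B -> m (f @^-1` B) = c%:num%:E * m B) ->
  measurable_fun setT h -> (forall x, 0 <= h x) ->
  \int[m]_x h (f x) = c%:num%:E * \int[m]_x h x.
Proof.
move=> mf fc mh h0; rewrite -ge0_integral_mscale//.
transitivity (\int[pushforward m f]_x h x).
  by rewrite ge0_integral_pushforward.
by apply: eq_measure_integral => A mA _; exact: fc.
Qed.

(** F is the preimage of E under a map (x, y) |-> (f x, s x y) whose maps
   s x scale nu by d; integrating over x multiplies by the factor c of f. *)
Lemma skew_product1 (f : X -> X) (c d : {nonneg R}) (E F : set (X * Y)) :
  measurable_fun setT f ->
  (forall B, measurable B -> mu (f @^-1` B) = c%:num%:E * mu B) ->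
  measurable E -> measurable F ->
  (forall x, nu (xsection F x) = d%:num%:E * nu (xsection E (f x))) ->
  (mu \x nu) F = c%:num%:E * (d%:num%:E * (mu \x nu) E).
Proof.
move=> mf fc mE mF FE.
have mxE := measurable_fun_xsection nu mE.
rewrite {1}/product_measure1/=; under eq_integral do rewrite /= FE.
rewrite ge0_integralZl//; last exact: measurableT_comp mxE mf.
by have /= -> := integral_scaled mf fc mxE (fun x => measure_ge0 _ _);
  rewrite muleCA.
Qed.

Lemma skew_product2 (f : Y -> Y) (c d : {nonneg R}) (E F : set (X * Y)) :
  measurable_fun setT f ->
  (forall B, measurable B -> nu (f @^-1` B) = c%:num%:E * nu B) ->
  measurable E -> measurable F ->
  (forall y, mu (ysection F y) = d%:num%:E * mu (ysection E (f y))) ->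
  (mu \x nu) F = c%:num%:E * (d%:num%:E * (mu \x nu) E).
Proof.
have P12 G : measurable G -> (mu \x nu) G = (mu \x^ nu) G.
  move=> mG; apply: product_measure_unique => // A B mA mB.
  exact: product_measure2E.
move=> mf fc mE mF FE; rewrite !P12//.
have myE := measurable_fun_ysection mu mE.
rewrite {1}/product_measure2/=; under eq_integral do rewrite /= FE.
rewrite ge0_integralZl//; last exact: measurableT_comp myE mf.
by have /= -> := integral_scaled mf fc myE (fun x => measure_ge0 _ _);
  rewrite muleCA.
Qed.

End skew_products.

Section affine_maps.
Context (R : realType).
Local Notation lam := (lebesgue_rV R).

Lemma lebesgue_affine1 (a b : R) (B : set (measurableTypeR R)) : a != 0 ->
  measurable B ->
  lebesgue_measure ((fun t : measurableTypeR R => a * t + b) @^-1` B) =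
  (`|a|^-1%:E * lebesgue_measure B)%E.
Proof.
move=> a0 mB; pose f (t : measurableTypeR R) : measurableTypeR R := a * t + b.
have mf : measurable_fun setT f.
  by apply: measurable_funD => //; exact: measurable_funM.
pose m : {measure set (measurableTypeR R) -> \bar R} := mscale (NngNum (normr_ge0 a))
  (measure_function_pushforward__canonical__measure_function_Measure
    (@lebesgue_measure R) mf).
have a0' : 0 < `|a| by rewrite normr_gt0.
suff /(_ B mB) -> : forall A, measurable A -> lebesgue_measure A = m A.
  by rewrite /m/= /mscale/= muleA -EFinM mulVf ?gt_eqF// mul1e.
apply: lebesgue_measure_unique => _ [[x y] /= _ <-].
rewrite /m/= /mscale/= /pushforward.
have [a_gt0|a_lt0|a_eq0] := ltrgt0P a; last by rewrite a_eq0 eqxx in a0.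
  rewrite (_ : f @^-1` _ = `](x - b) / a, (y - b) / a]%classic); last first.
    apply/seteqP; split => t /=; rewrite !in_itv/= ltr_pdivrMr// ler_pdivlMr//
      ltrBlDr lerBrDr [t * a]mulrC//.
  rewrite !lebesgue_measure_itv/= !lte_fin ltr_pM2r ?invr_gt0// ltrD2r.
  case: ifPn => _; last by rewrite mule0.
  rewrite -!EFinB -EFinM; congr EFin; field; exact: a0.
rewrite (_ : f @^-1` _ = `[(y - b) / a, (x - b) / a[%classic); last first.
  apply/seteqP; split => t /=; rewrite !in_itv/= ler_ndivrMr// ltr_ndivlMr//
    lerBrDr ltrBlDr [t * a]mulrC andbC//.
rewrite !lebesgue_measure_itv/= !lte_fin ltr_nM2r ?invr_lt0// ltrD2r.
case: ifPn => _; last by rewrite mule0.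
rewrite -!EFinB -EFinM; congr EFin; field; exact: a0.
Qed.

(** Preimages are used because they are measurable at once; the translation
   part makes the block triangular case an instance of a skew product. *)
Definition scales_lebesgue n (A : 'M[R]_n) :=
  forall (b : 'rV[R]_n) (E : set 'rV[R]_n), measurable E ->
  lam n ((fun v : 'rV[R]_n => v *m A + b) @^-1` E) =
  (`|\det A|^-1%:E * lam n E)%E.

Lemma scales_lebesgue_mul n (A B : 'M[R]_n) :
  scales_lebesgue A -> scales_lebesgue B -> scales_lebesgue (A *m B).
Proof.
move=> sA sB b E mE; rewrite det_mulmx normrM invfM EFinM -muleA -(sB b)//.
rewrite -(sA 0); last first.
  by rewrite -[X in measurable X]setTI; exact: measurable_affine.
congr (lam n _); apply/seteqP; split => v /=; by rewrite addr0 mulmxA.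
Qed.

Lemma rv_cons_eta n (b : 'rV[R]_n.+1) : exists (b0 : R) (b1 : 'rV[R]_n),
  b = rv_cons ((b0 : measurableTypeR R), b1).
Proof.
exists (b ord0 ord0), (\row_i b ord0 (lift ord0 i)).
apply/rowP => i; case: (unliftP ord0 i) => [j ->|->].
  by rewrite rv_consS/= mxE.
by rewrite rv_cons0.
Qed.

Lemma measurable_affine_preimage n (A : 'M[R]_n) b (E : set 'rV[R]_n) :
  measurable E -> measurable ((fun v : 'rV[R]_n => v *m A + b) @^-1` E).
Proof. by move=> mE; rewrite -[X in measurable X]setTI; exact: measurable_affine. Qed.

Lemma measurable_rv_cons_preimage n (E : set 'rV[R]_n.+1) :
  measurable E -> measurable (@rv_cons R n @^-1` E).
Proof. by move=> mE; rewrite -[X in measurable X]setTI; exact: measurable_rv_cons. Qed.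

Lemma rv_cons_lblock n (a : R) (c : 'cV[R]_n) (B : 'M[R]_n) t v b0 b1 :
  rv_cons ((t : measurableTypeR R), v) *m
    (block_mx (a%:M : 'M[R]_1) 0 c B : 'M[R]_n.+1) +
    rv_cons ((b0 : measurableTypeR R), b1) =
  rv_cons ((a * t + ((v *m c) ord0 ord0 + b0) : measurableTypeR R), v *m B + b1).
Proof.
rewrite /rv_cons/=.
apply: (etrans (congr1 (fun x => x + _) (@mul_row_block R 1 1 n 1 n _ _ _ _ _ _))).
apply: etrans (add_row_mx _ _ _ _) _.
rewrite mulmx0 add0r -scalar_mxM [v *m c]mx11_scalar -!raddfD/=.
by rewrite addrA [t * a]mulrC [_%:M ord0 ord0]mxE mulr1n.
Qed.

Lemma rv_cons_ublock n (a : R) (u : 'rV[R]_n) (B : 'M[R]_n) t v b0 b1 :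
  rv_cons ((t : measurableTypeR R), v) *m
    (block_mx (a%:M : 'M[R]_1) u 0 B : 'M[R]_n.+1) +
    rv_cons ((b0 : measurableTypeR R), b1) =
  rv_cons ((a * t + b0 : measurableTypeR R), v *m B + (t *: u + b1)).
Proof.
rewrite /rv_cons/=.
apply: (etrans (congr1 (fun x => x + _) (@mul_row_block R 1 1 n 1 n _ _ _ _ _ _))).
apply: etrans (add_row_mx _ _ _ _) _.
rewrite mulmx0 addr0 -scalar_mxM mul_scalar_mx -raddfD/=.
by rewrite [v *m B + (_ + _)]addrCA addrA (mulrC (t : R) a).
Qed.

Lemma scales_lebesgue_lblock n (a : R) (c : 'cV[R]_n) (B : 'M[R]_n) : a != 0 ->
  scales_lebesgue B ->
  @scales_lebesgue n.+1 (block_mx (a%:M : 'M[R]_1) 0 c B).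
Proof.
move=> a0 sB b E mE; have [b0 [b1 ->]] := rv_cons_eta b.
rewrite (det_lblock (a%:M : 'M[R]_1)) det_scalar1 normrM invfM EFinM.
rewrite !lebesgue_rVS muleAC muleC.
have i0 (x : R) : 0 <= `|x|^-1 by rewrite invr_ge0.
pose f (v : 'rV[R]_n) := v *m B + b1.
rewrite (@skew_product2 _ _ _ _ _ (@lebesgue_measure R) (lam n) f
  (NngNum (i0 (\det B))) (NngNum (i0 a)) (@rv_cons R n @^-1` E))/=.
- by [].
- exact: measurable_affine.
- exact: sB.
- exact: measurable_rv_cons_preimage.
- apply: measurable_rv_cons_preimage.
  exact: (@measurable_affine_preimage n.+1).
move=> v; rewrite -(@lebesgue_affine1 a ((v *m c) ord0 ord0 + b0))//; last first.
  by apply: measurable_ysection; exact: measurable_rv_cons_preimage.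
congr lebesgue_measure; apply/seteqP; split => t;
  by rewrite /ysection/= !inE/= rv_cons_lblock.
Qed.

Lemma scales_lebesgue_ublock n (a : R) (u : 'rV[R]_n) (B : 'M[R]_n) : a != 0 ->
  scales_lebesgue B ->
  @scales_lebesgue n.+1 (block_mx (a%:M : 'M[R]_1) u 0 B).
Proof.
move=> a0 sB b E mE; have [b0 [b1 ->]] := rv_cons_eta b.
rewrite (det_ublock (a%:M : 'M[R]_1)) det_scalar1 normrM invfM EFinM.
rewrite !lebesgue_rVS.
have i0 (x : R) : 0 <= `|x|^-1 by rewrite invr_ge0.
pose f (t : measurableTypeR R) : measurableTypeR R := a * t + b0.
rewrite (@skew_product1 _ _ _ _ _ (@lebesgue_measure R) (lam n) f
  (NngNum (i0 a)) (NngNum (i0 (\det B))) (@rv_cons R n @^-1` E))/=.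
- by rewrite muleA.
- by apply: measurable_funD => //; exact: measurable_funM.
- by move=> A mA; exact: lebesgue_affine1.
- exact: measurable_rv_cons_preimage.
- apply: measurable_rv_cons_preimage.
  exact: (@measurable_affine_preimage n.+1).
move=> t; rewrite -(sB (t *: u + b1))//; last first.
  by apply: measurable_xsection; exact: measurable_rv_cons_preimage.
congr (lam n _); apply/seteqP; split => v;
  by rewrite /xsection/= !inE/= rv_cons_ublock.
Qed.

Lemma scales_lebesgue1 n : scales_lebesgue (1%:M : 'M[R]_n).
Proof.
elim: n => [|n IH].
  move=> b E mE; rewrite det1 normr1 invr1 mul1e; congr (lam 0 _).
  by apply/seteqP; split => v /=; rewrite [_ + _]thinmx0 [v]thinmx0.
rewrite (_ : 1%:M = block_mx (1%:M : 'M[R]_1) 0 0 1%:M); last first.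
  by rewrite -[1%:M]/((1%:M : 'M[R]_(1 + n))) scalar_mx_block.
by apply: scales_lebesgue_lblock => //; exact: oner_neq0.
Qed.

(** Gaussian elimination reduces to block triangular matrices; a zero corner
   is first made nonzero by adding multiples of columns to the first one. *)
Lemma scales_lebesgue_unit n (A : 'M[R]_n) : A \in unitmx -> scales_lebesgue A.
Proof.
elim: n A => [|n IH] A.
  move=> _; rewrite (_ : A = 1%:M); first exact: scales_lebesgue1.
  by rewrite [LHS]thinmx0 [RHS]thinmx0.
have corner (a : R) (u : 'rV[R]_n) (c : 'cV[R]_n) (D : 'M[R]_n) : a != 0 ->
    @scales_lebesgue n.+1 (block_mx (a%:M : 'M[R]_1) u c D) \/
    block_mx (a%:M : 'M[R]_1) u c D \notin unitmx.
  move=> a0; pose S := D - c *m (a^-1 *: u).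
  have E : block_mx (a%:M : 'M[R]_1) u c D =
     block_mx (a%:M : 'M[R]_1) 0 c S *m block_mx (1%:M : 'M[R]_1) (a^-1 *: u) 0 1%:M.
    rewrite mulmx_block !mulmx0 !mul0mx !mulmx1 !addr0 mul_scalar_mx scalerA.
    by rewrite divff// scale1r /S addrC subrK.
  have [uS|nS] := boolP (S \in unitmx); [left|right].
    rewrite E; apply: (@scales_lebesgue_mul n.+1).
      exact/scales_lebesgue_lblock/IH.
    by apply: scales_lebesgue_ublock; [exact: oner_neq0|exact: scales_lebesgue1].
  rewrite E unitmx_mul negb_and; apply/orP; left.
  rewrite unitmxE det_lblock det_scalar1 unitrM negb_and; apply/orP; right.
  by rewrite -unitmxE.
have [a [u [c [D ->]]]] : exists (a : R) (u : 'rV[R]_n) (c : 'cV[R]_n)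
    (D : 'M[R]_n), A = block_mx (a%:M : 'M[R]_1) u c D.
  pose A' : 'M[R]_(1 + n) := A.
  exists (ulsubmx A' 0 0), (ursubmx A'), (dlsubmx A'), (drsubmx A').
  by rewrite -mx11_scalar submxK.
set M : 'M[R]_(1 + n) := block_mx _ _ _ _ => uA.
have [a0|a0] := eqVneq a 0; last first.
  have [//|] := corner a u c D a0.
  by rewrite -/M uA.
(* the corner of M L is u u^T, nonzero since the first row of M is not 0 *)
pose L e : 'M[R]_(1 + n) := block_mx (1%:M : 'M[R]_1) 0 (e *: u^T) 1%:M.
have LK : L 1 *m L (- 1) = 1%:M.
  rewrite /L mulmx_block !mulmx0 !mul0mx !mulmx1 !mul1mx !addr0 !add0r.
  by rewrite -scalerDl subrr scale0r -scalar_mx_block.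
have sL e : @scales_lebesgue n.+1 (L e).
  by apply: scales_lebesgue_lblock; [exact: oner_neq0|exact: scales_lebesgue1].
have uL : @scales_lebesgue n.+1 (M *m L 1).
  have E : M *m L 1 = block_mx (((u *m u^T) 0 0)%:M : 'M[R]_1) u (c + D *m u^T) D.
    rewrite /M /L mulmx_block !mulmx0 !mulmx1 !add0r a0 scale1r.
    by rewrite (_ : (0 : R)%:M = 0) ?raddf0// add0r -mx11_scalar.
  have nz : (u *m u^T) 0 0 != 0.
    apply/eqP => uu0; have u0 : u = 0.
      apply/rowP => j; rewrite mxE; apply/eqP; rewrite -sqrf_eq0; apply/eqP.
      have : \sum_j u 0 j ^+ 2 = 0.
        by rewrite -[RHS]uu0 mxE; apply: eq_bigr => k _; rewrite mxE expr2.
      by move/psumr_eq0P => H; apply: H => // k _; exact: sqr_ge0.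
    move: uA; rewrite unitmxE (_ : \det M = 0) ?unitr0// /M u0.
    by apply: etrans (@det_lblock R 1 n _ _ _) _; rewrite det_scalar1 a0 mul0r.
  have [|] := corner _ u (c + D *m u^T) D nz; rewrite -E => //.
  rewrite unitmx_mul uA /= => /negP[].
  by rewrite unitmxE det_lblock !det1 mulr1 unitr1.
have -> : M = (M *m L 1) *m L (- 1) by rewrite -mulmxA LK mulmx1.
exact: (@scales_lebesgue_mul n.+1).
Qed.

Lemma lebesgue_linear_image n (A : 'M[R]_n) (E : set 'rV[R]_n) :
  A \in unitmx -> measurable E ->
  measurable ((fun v : 'rV[R]_n => v *m A) @` E) /\
  lam n ((fun v : 'rV[R]_n => v *m A) @` E) = (`|\det A|%:E * lam n E)%E.
Proof.
move=> uA mE.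
have -> : (fun v : 'rV[R]_n => v *m A) @` E =
    (fun v : 'rV[R]_n => v *m invmx A + 0) @^-1` E.
  apply/seteqP; split => [_ [v Ev <-]|v] /=; rewrite ?addr0 ?mulmxK// => Ev.
  by exists (v *m invmx A) => //; rewrite mulmxKV.
split; first exact: measurable_affine_preimage.
rewrite (@scales_lebesgue_unit _ (invmx A)) ?unitmx_inv//.
by rewrite det_inv normrV ?invrK// -unitmxE.
Qed.

End affine_maps.

(** * Borel images under continuous injections *)

Section borel_image.
Context (R : realType) (m n : nat).
Variables (U : set 'rV[R]_m) (f : 'rV[R]_m -> 'rV[R]_n).
Hypotheses (oU : open U) (cf : forall x, U x -> {for x, continuous f}).
Hypothesis injf : set_inj U f.

(* A compact exhaustion of U. *)
Let K k : set 'rV[R]_m :=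
  [set v | `|v| <= k%:R /\ forall w, ~ U w -> k.+1%:R^-1 <= `|w - v|].

Let compactK k : compact (K k).
Proof.
apply: bounded_closed_compact.
  exists k%:R; split; first exact: num_real.
  by move=> M kM v [vk _]; apply: le_trans vk (ltW kM).
rewrite (_ : K k = [set v | `|v| <= k%:R] `&`
    \bigcap_(w in ~` U) [set v | k.+1%:R^-1 <= `|w - v|]).
  apply: closedI.
    apply: (@preimage_closed _ _ (fun v : 'rV[R]_m => `|v|) [set r | r <= k%:R]).
      by move=> v _; exact: norm_continuous.
    exact: closed_le.
  apply: closed_bigI => w _.
  apply: (@preimage_closed _ _ (fun v : 'rV[R]_m => `|w - v|) [set r | k.+1%:R^-1 <= r]).
    move=> v _; apply: (@continuous_comp _ _ _ (fun v : 'rV[R]_m => w - v) (fun v : 'rV[R]_m => `|v|)).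
      by apply: continuousB; [exact: cst_continuous|exact: cvg_id].
    exact: norm_continuous.
  exact: closed_ge.
by apply/seteqP; split => v /= [? H]; split => // w Uw; exact: H.
Qed.

Let K_U k : K k `<=` U.
Proof.
move=> v [_ H]; apply: contrapT => nU; have := H _ nU.
by rewrite subrr normr0 leNgt invr_gt0 ltr0n.
Qed.

Let U_K : U = \bigcup_k K k.
Proof.
apply/seteqP; split => [v Uv|v [k _ /K_U]//].
have /nbhs_ballP[e /= e0 eU] : nbhs v U by exact: open_nbhs_nbhs.
pose k := maxn (Num.truncn `|v|).+1 (Num.truncn e^-1).+1.
exists k => //; split.
  apply: (le_trans (ltW (truncnS_gt _))); by rewrite ler_nat leq_maxl.
move=> w nUw; rewrite leNgt; apply/negP => wv; apply: nUw; apply: eU.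
rewrite -ball_normE/= -normrN opprB; apply: lt_le_trans wv _.
rewrite -[e]invrK lef_pV2 ?posrE ?invr_gt0//.
apply: (le_trans (ltW (truncnS_gt _))); rewrite ler_nat.
by apply: leq_trans (leq_maxr _ _) (leqnSn _).
Qed.

Let measurable_image_closed C : closed C -> measurable (f @` (U `&` C)).
Proof.
move=> cC; rewrite U_K setI_bigcupl image_bigcup.
apply: bigcupT_measurable => k; apply: closed_measurable_rv.
apply: compact_closed; first exact: norm_hausdorff.
apply: continuous_compact; last by apply: compact_closedI.
apply/subspace_continuousP => x [Kx _]; apply: cvg_within_filter.
exact/cf/(K_U Kx).
Qed.

(** U is a countable union of compact sets, so the sets with a Borel image
   form a sigma-algebra that contains the closed sets. *)
Lemma measurable_image_inj E : measurable E -> E `<=` U ->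
  measurable (f @` E).
Proof.
move=> mE EU; rewrite -(setIidr EU); move: E mE {EU}.
have imD A : f @` (U `\` A) = f @` U `\` f @` (U `&` A).
  apply/seteqP; split => [_ [x [Ux nA] <-]|_ [[x Ux <-] nA]].
    split; first by exists x.
    by move=> [y [Uy Ay] /injf]; rewrite !inE => /(_ Uy Ux) e; apply: nA; rewrite -e.
  by exists x => //; split => // Ax; apply: nA; exists x.
have mU : measurable (f @` U).
  by rewrite -[U]setIT; exact: measurable_image_closed closedT.
apply: rv_measurable_ind => [|i r].
  split => [|A mA|F mF].
  - by rewrite setI0 image_set0.
  - by rewrite setTD -setDE imD; exact: measurableD.
  - by rewrite setI_bigcupr image_bigcup; exact: bigcupT_measurable.
rewrite -[mkset _]setCK -setDE imD; apply: measurableD => //.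
apply: measurable_image_closed.
rewrite (_ : ~` _ = [set v : 'rV[R]_m | r <= v ord0 i]).
  apply: (@preimage_closed _ _ (fun v : 'rV[R]_m => v ord0 i) [set s | r <= s]).
    by move=> v _; exact: coord_continuous.
  exact: closed_ge.
by apply/seteqP; split => v /=; rewrite leNgt => /negP.
Qed.

End borel_image.

(** * Linear approximation of continuously differentiable maps *)

Section linear_approximation.
Context (R : realType).

Lemma mulmx_norm_le m n (u : 'rV[R]_m) (M : 'M[R]_(m, n)) (e : R) : 0 <= e ->
  (forall i j, `|M i j| <= e) -> `|u *m M| <= m%:R * e * `|u|.
Proof.
move=> e0 Me; apply/mx_norm_leP => [|j].
  by rewrite !mulr_ge0.
rewrite mxE; apply: le_trans (ler_norm_sum _ _ _) _.
rewrite -mulrA mulr_natl -[X in _ *+ X]card_ord -sumr_const.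
apply: ler_sum => i _; rewrite normrM mulrC ler_pM//.
exact: (iffRL (mx_norm_leP u (normr_ge0 u))).
Qed.

Lemma continuous_at_near (T S : topologicalType) (f g : T -> S) x :
  (\forall y \near x, f y = g y) -> {for x, continuous f} ->
  {for x, continuous g}.
Proof.
move=> fg cf; have e := nbhs_singleton fg.
have : f @ x --> g x by rewrite -e; exact: cf.
by apply: cvg_trans; exact: near_eq_cvg.
Qed.

Lemma jacobian_continuous m n (U : set 'rV[R]_m) (f : 'rV[R]_m -> 'rV[R]_n) x :
  open U -> class_C 1 U f -> U x -> {for x, continuous (fun y => 'J f y)}.
Proof.
move=> oU [df cf] Ux.
apply: mx_continuousP => i j.
apply: (@continuous_at_near _ _ (fun y => ('D_(delta_mx ord0 i) f y) ord0 j)).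
  apply: filterS (open_nbhs_nbhs (conj oU Ux)) => y Uy.
  by rewrite deriveEjacobian -?rowE ?mxE//; exact: df.
by apply: mx_entry_continuous; exact: cf.
Qed.

Lemma line_derive (V : normedModType R) (g : V -> R) (w d : V) (t : R) :
  derivable g (w + t *: d) d ->
  is_derive t 1 (fun s : R => g (w + s *: d)) ('D_d g (w + t *: d)).
Proof.
move=> dg.
have E : (fun h : R => h^-1 *: (((fun s : R => g (w + s *: d)) \o shift t) (h *: 1)
            - g (w + t *: d))) =
         (fun h : R => h^-1 *: ((g \o shift (w + t *: d)) (h *: d)
            - g (w + t *: d))).
  apply/funext => h /=; congr (_ *: (g _ - _)).
  by rewrite [h *: 1]mulr1 scalerDl addrCA.
by apply: DeriveDef; [rewrite /derivable E|rewrite /derive E].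
Qed.

Lemma ball_segment (V : normedModType R) (x v w : V) (r t : R) :
  0 <= t <= 1 -> ball x r v -> ball x r w -> ball x r (w + t *: (v - w)).
Proof.
move=> /andP[t0 t1]; rewrite -!ball_normE /= => xv xw.
have -> : x - (w + t *: (v - w)) = (1 - t) *: (x - w) + t *: (x - v).
  rewrite scalerBl scale1r -addrA [- _ + _]addrC -scalerBr opprB.
  have -> : x - v + (w - x) = w - v by rewrite addrC addrA subrK.
  by rewrite opprD addrA -scalerN opprB.
apply: le_lt_trans (ler_normD _ _) _.
rewrite !normrZ (ger0_norm t0) ger0_norm ?subr_ge0//.
have [->|tn0] := eqVneq t 0.
  by rewrite subr0 mul1r mul0r addr0.
have tp : 0 < t by rewrite lt_neqAle eq_sym tn0.
apply: (@le_lt_trans _ _ ((1 - t) * r + t * `|x - v|)).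
  by rewrite lerD2r ler_wpM2l ?subr_ge0// ltW.
apply: (@lt_le_trans _ _ ((1 - t) * r + t * r)).
  by rewrite ltrD2l ltr_pM2l.
by rewrite -mulrDl subrK mul1r.
Qed.

(** The mean value theorem along segments, one component at a time; the ball
   is chosen so that the Jacobian hardly varies on it. *)
Lemma class_C1_linear_approx m n (U : set 'rV[R]_m) (f : 'rV[R]_m -> 'rV[R]_n)
    x (e : R) :
  open U -> class_C 1 U f -> U x -> 0 < e ->
  exists2 r, 0 < r & ball x r `<=` U /\
    forall v w, ball x r v -> ball x r w ->
      `|f v - f w - (v - w) *m 'J f x| <= e * `|v - w|.
Proof.
move=> oU Cf Ux e0.
pose eta := e / m.+1%:R.
have eta0 : 0 < eta by rewrite divr_gt0.
have : \forall y \near x, U y /\ forall i j, `|'J f y i j - 'J f x i j| <= eta.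
  apply: filterI; first exact: open_nbhs_nbhs.
  have := mx_continuous_dist (jacobian_continuous oU Cf Ux) eta0.
  by apply: filterS => y H i j; rewrite distrC; exact: H.
move=> /nbhs_ballP[r /= r0 rH]; exists r => //; split; first by move=> y /rH[].
move=> v w xv xw; apply/mx_norm_leP => [|j]; first by rewrite mulr_ge0// ltW.
pose F (s : R) : R := f (w + s *: (v - w)) ord0 j.
pose dF (s : R) : R := ((v - w) *m 'J f (w + s *: (v - w))) ord0 j.
have dl (t : R) : t \in `[0, 1]%R -> is_derive t 1 F (dF t).
  rewrite in_itv/= => t01.
  have [Uy _] := rH _ (ball_segment t01 xv xw).
  have df := Cf.1 _ Uy.
  have dv : derivable f (w + t *: (v - w)) (v - w) by exact: diff_derivable.
  have dj := (iffLR (derivable_mxP _ _ _) dv) ord0 j.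
  have := line_derive dj; rewrite (_ : 'D_(v - w) _ _ = dF t)// /dF.
  by rewrite -deriveEjacobian// derive_mx// mxE.
have dF01 (t : R) : t \in `]0, 1[%R -> is_derive t 1 F (dF t).
  by move=> t01; apply: dl; exact: subset_itv_oo_cc.
have cF : {within `[0, 1], continuous F}.
  apply: derivable_within_continuous => t t01.
  by have [] := dl t t01.
have [t t01 E] := MVT_segment ler01 dF01 cF.
move: E; rewrite /F /dF scale1r scale0r addr0 addrCA subrr addr0 subr0 mulr1 => E.
have -> : (f v - f w - (v - w) *m 'J f x) ord0 j =
    ((v - w) *m ('J f (w + t *: (v - w)) - 'J f x)) ord0 j.
  have sub (A B : 'rV[R]_n) : (A - B) ord0 j = A ord0 j - B ord0 j by rewrite !mxE.
  move: E; move: ('J f _) ('J f x) => A B E.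
  by rewrite sub (sub (f v)) E -sub -(mulmxBr (v - w) A B).
rewrite in_itv/= in t01; have [_ HJ] := rH _ (ball_segment t01 xv xw).
apply: le_trans (iffRL (mx_norm_leP _ (normr_ge0 _)) (lexx _) j) _.
apply: le_trans (mulmx_norm_le _ (ltW eta0) _) _.
  by move=> i k; rewrite mxE [X in _ + X]mxE.
rewrite ler_wpM2r// /eta mulrCA ger_pMr// ler_pdivrMr// mul1r ler_nat.
exact: leqnSn.
Qed.

End linear_approximation.

(** * Change of variables *)

Section change_of_variables.
Context (R : realType).
Local Notation lam := (lebesgue_rV R).

Lemma prod_continuous_at (T : topologicalType) (I : Type) (r : seq I)
    (f : I -> T -> R) x :
  (forall i, {for x, continuous (f i)}) ->
  {for x, continuous (fun t => \prod_(i <- r) f i t)}.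
Proof.
move=> cf; elim: r => [|i r IH].
  rewrite (_ : (fun _ => _) = cst 1); first exact: cst_continuous.
  by apply/funext => t; rewrite big_nil.
rewrite (_ : (fun _ => _) = (fun t => f i t * \prod_(i <- r) f i t)).
  exact: cvgM (cf i) IH.
by apply/funext => t; rewrite big_cons.
Qed.

Lemma det_continuous_at (T : topologicalType) n (f : T -> 'M[R]_n) x :
  {for x, continuous f} -> {for x, continuous (fun t => \det (f t))}.
Proof.
move=> cf; rewrite /determinant; apply: sum_continuous_at => s.
apply: cvgM; first exact: cvg_cst.
by apply: prod_continuous_at => i; exact: mx_entry_continuous.
Qed.

Lemma normr_continuous_at (T : topologicalType) (f : T -> R) x :
  {for x, continuous f} -> {for x, continuous (fun t => `|f t|)}.
Proof.
move=> cf; apply: (@continuous_comp _ _ _ f (fun r : R => `|r|)) => //.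
exact: norm_continuous.
Qed.

Lemma det_jacobian_continuous n (U : set 'rV[R]_n) (f : 'rV[R]_n -> 'rV[R]_n) x :
  open U -> class_C 1 U f -> U x ->
  {for x, continuous (fun y => `|\det ('J f y)|)}.
Proof.
move=> oU Cf Ux; apply: normr_continuous_at; apply: det_continuous_at.
exact: (jacobian_continuous oU Cf Ux).
Qed.

Lemma exprn_continuous_at (T : topologicalType) (f : T -> R) k x :
  {for x, continuous f} -> {for x, continuous (fun t => f t ^+ k)}.
Proof.
move=> cf; rewrite (_ : (fun t => _) = (fun t => \prod_(i < k) f t)).
  exact: prod_continuous_at.
by apply/funext => t; rewrite prodr_const card_ord.
Qed.

Lemma integral_between d (T : measurableType d)
    (mu : {measure set T -> \bar R}) (D : set T) (h : T -> R) (a b : R) :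
  measurable D -> measurable_fun D (EFin \o h) -> 0 <= a ->
  (forall x, D x -> a <= h x <= b) ->
  (a%:E * mu D <= \int[mu]_(x in D) (h x)%:E)%E /\
  (\int[mu]_(x in D) (h x)%:E <= b%:E * mu D)%E.
Proof.
move=> mD mh a0 hab; split; rewrite -integral_cst//.
  apply: ge0_le_integral => // x Dx; rewrite lee_fin.
  by have /andP[] := hab x Dx.
apply: ge0_le_integral => // x Dx; rewrite lee_fin; have /andP[ah hb] := hab x Dx.
- exact: le_trans ah.
- exact: hb.
Qed.

(** The factors by which a map e-close to the identity can distort measure,
   together with the variation of its Jacobian determinant, stay below s. *)
Lemma exists_small (n : nat) (s : R) : 1 < s -> exists e : R,
  [/\ 0 < e, e < 1, (1 + e) ^+ n <= s * (1 - e) & 1 + e <= s * (1 - e) ^+ n].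
Proof.
move=> s1.
have lin (c : R) : {for 0, continuous (fun e => 1 + c * e)}.
  by apply: cvgD; [exact: cvg_cst|apply: cvgM; [exact: cvg_cst|exact: cvg_id]].
have lim0 (c d : R) (k l : nat) :
    s * (1 + c * e) ^+ k - (1 + d * e) ^+ l @[e --> (0 : R)^'+] -->
    s * (1 + c * 0) ^+ k - (1 + d * 0) ^+ l.
  have h1 := @exprn_continuous_at _ _ k _ (lin c); have h2 := @exprn_continuous_at _ _ l _ (lin d).
  by apply: cvg_at_right_filter; exact: cvgB (cvgM (cvg_cst s) h1) h2.
have c1 := lim0 (- 1) 1 1%N n; have c2 := lim0 (- 1) 1 n 1%N.
have s10 : 0 < s - 1 by rewrite subr_gt0.
rewrite !mulr0 addr0 !expr1n mulr1 in c1; rewrite !mulr0 addr0 !expr1n mulr1 in c2.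
near (0 : R)^'+ => e; exists e.
have e1 : 0 < s * (1 + - 1 * e) ^+ 1 - (1 + 1 * e) ^+ n.
  by near: e; exact: cvgr_gt c1 _ s10.
have e2 : 0 < s * (1 + - 1 * e) ^+ n - (1 + 1 * e) ^+ 1.
  by near: e; exact: cvgr_gt c2 _ s10.
split.
- by near: e; exact: nbhs_right_gt.
- by near: e; exact: nbhs_right_lt.
- by move: e1; rewrite subr_gt0 mulN1r mul1r expr1 => /ltW.
- by move: e2; rewrite subr_gt0 mulN1r mul1r expr1 => /ltW.
Unshelve. all: by end_near. Qed.

(** Near x, the map v |-> f v *m (J f x)^-1 and its inverse are Lipschitz with
   constants close to 1, so that both are comparable with the identity. *)
Lemma change_of_variables_local n (U : set 'rV[R]_n) (f : 'rV[R]_n -> 'rV[R]_n)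
    x (s : R) :
  open U -> class_C 1 U f -> set_inj U f -> U x -> 'J f x \in unitmx -> 1 < s ->
  exists2 r, 0 < r & ball x r `<=` U /\
    forall B, measurable B -> B `<=` ball x r ->
    (lam n (f @` B) <= s%:E * \int[lam n]_(u in B) (`|\det ('J f u)|)%:E)%E /\
    (\int[lam n]_(u in B) (`|\det ('J f u)|)%:E <= s%:E * lam n (f @` B))%E.
Proof.
move=> oU Cf injf Ux uJ s1.
have [e [e0 e1 ens esn]] := exists_small n s1.
have e1' : 0 < 1 - e by rewrite subr_gt0.
set A := 'J f x in uJ *.
pose d : R := `|\det A|.
have d0 : 0 < d by rewrite normr_gt0 -unitfE -unitmxE.
pose C : R := n%:R * `|invmx A|.
have C0 : 0 <= C by rewrite mulr_ge0.
have [r1 r10 [r1U r1f]] := class_C1_linear_approx oU Cf Ux (divr_gt0 e0 (ltr_wpDl C0 ltr01)).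
have [r2 r20 r2f] : exists2 r2 : R, 0 < r2 &
    ball x r2 `<=` [set t | `|d - `|\det ('J f t)| | <= e * d].
  apply/nbhs_ballP.
  exact: (continuous_dist (det_jacobian_continuous oU Cf Ux) (mulr_gt0 e0 d0)).
exists (Num.min r1 r2); first by rewrite lt_min r10.
have b1 : ball x (Num.min r1 r2) `<=` ball x r1 by apply: le_ball; rewrite ge_min lexx.
have b2 : ball x (Num.min r1 r2) `<=` ball x r2.
  by apply: le_ball; rewrite ge_min lexx orbT.
split; first exact: subset_trans b1 r1U.
move=> B mB Bb.
have BU : B `<=` U by exact: subset_trans Bb (subset_trans b1 r1U).
have cf y : U y -> {for y, continuous f}.
  by move=> Uy; apply: differentiable_continuous; exact: Cf.1.
pose g v := f v *m invmx A.
have gdist v w : B v -> B w -> `|g v - g w - (v - w)| <= e * `|v - w|.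
  move=> Bv Bw; have := r1f _ _ (b1 _ (Bb _ Bv)) (b1 _ (Bb _ Bw)).
  rewrite -/A => H.
  have -> : g v - g w - (v - w) = (f v - f w - (v - w) *m A) *m invmx A.
    by rewrite mulmxBl mulmxBl mulmxK.
  apply: le_trans (mulmx_norm_le _ (normr_ge0 (invmx A)) _) _.
    move=> i j; rewrite [leRHS]/Num.Def.normr/= mx_normrE.
    exact: (@le_bigmax _ _ _ 0 (fun ij => `|invmx A ij.1 ij.2|) (i, j)).
  rewrite -/C; apply: le_trans (ler_wpM2l C0 H) _.
  rewrite mulrA ler_wpM2r// mulrA ler_pdivrMr ?ltr_wpDl//.
  by rewrite mulrDr mulr1 mulrC lerDl ltW.
have gle v w : B v -> B w -> `|g v - g w| <= (1 + e) * `|v - w|.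
  move=> Bv Bw; rewrite mulrDl mul1r -lerBlDl.
  exact: le_trans (lerB_dist _ _) (gdist _ _ Bv Bw).
have gge v w : B v -> B w -> `|v - w| <= (1 - e)^-1 * `|g v - g w|.
  move=> Bv Bw; rewrite ler_pdivlMl// mulrBl mul1r lerBlDr -lerBlDl.
  apply: le_trans (gdist _ _ Bv Bw).
  by rewrite [leRHS]distrC; exact: lerB_dist.
have uJV : invmx A \in unitmx by rewrite unitmx_inv.
have mf E : measurable E -> E `<=` U -> measurable (f @` E).
  by move=> mE EU; exact: (measurable_image_inj oU cf injf mE EU).
have gE E : g @` E = (fun v => v *m invmx A) @` (f @` E) by rewrite image_comp.
have mg E : measurable E -> E `<=` B -> measurable (g @` E).
  move=> mE EB; rewrite gE.
  by have [] := lebesgue_linear_image uJV (mf _ mE (subset_trans EB BU)).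
have lfB : lam n (f @` B) = (d%:E * lam n (g @` B))%E.
  have [_] := lebesgue_linear_image uJV (mf _ mB BU).
  rewrite -gE => ->; rewrite muleA -EFinM det_inv normrV -?unitmxE//.
  by rewrite -/d divff ?gt_eqF// mul1e.
have mBg : measurable_fun B g.
  apply: (@measurableT_comp _ _ _ _ _ _ (fun v : 'rV[R]_n => v *m invmx A)).
    have := measurable_affine (invmx A) (0 : 'rV[R]_n).
    by congr measurable_fun; apply/funext => v; rewrite addr0.
  exact: (continuous_measurable_rv_rv oU cf).
have h1 : (lam n B <= ((1 - e)^-1 ^+ n)%:E * lam n (g @` B))%E.
  have := lebesgue_expanding mB mBg _ gge (mg _ mB (@subset_refl _ B)).
  rewrite (_ : B `&` _ = B); first by apply; rewrite invr_ge0 ltW.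
  by apply/setIidPl => v Bv; exists v.
have h2 : (lam n (g @` B) <= ((1 + e) ^+ n)%:E * lam n B)%E.
  pose k y := xget 0 [set v | B v /\ g v = y].
  have ginj v w : B v -> B w -> g v = g w -> v = w.
    move=> Bv Bw gvw; apply/eqP; rewrite -subr_eq0 -normr_le0.
    by apply: le_trans (gge _ _ Bv Bw) _; rewrite gvw subrr normr0 mulr0.
  have kg v : B v -> k (g v) = v.
    move=> Bv; rewrite /k; case: xgetP => [w _ [Bw /ginj]|]; first exact.
    by move=> /(_ v)/=; case.
  have mk : measurable_fun (g @` B) k.
    move=> _ E mE; rewrite (_ : _ `&` _ = g @` (B `&` E)).
      by apply: mg => //; exact: measurableI.
    apply/seteqP; split => [_ [[v Bv <-]]|_ [v [Bv Ev] <-]] /=.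
      by rewrite kg// => Ev; exists v.
    by split; [exists v|rewrite kg].
  have := lebesgue_expanding (mg _ mB (@subset_refl _ B)) mk _ _ mB.
  rewrite (_ : _ `&` k @^-1` B = g @` B); last first.
    by apply/setIidPl => _ [v Bv <-] /=; rewrite kg.
  apply; first by rewrite addr_ge0 ?ler01// ltW.
  by move=> _ _ [v Bv <-] [w Bw <-]; rewrite !kg//; exact: gle.
have mdet : measurable_fun B (fun u => (`|\det ('J f u)|)%:E).
  apply/measurable_EFinP.
  by apply: (continuous_measurable_rv oU) => // y; exact: det_jacobian_continuous.
have dJ u : B u -> (1 - e) * d <= `|\det ('J f u)| <= (1 + e) * d.
  move=> Bu; have /= := r2f _ (b2 _ (Bb _ Bu)); rewrite ler_norml => /andP[lo hi].
  rewrite mulrBl mulrDl mul1r; move: lo hi; move: (e * d) => ed lo hi.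
  by apply/andP; split; lra.
have d1 : 0 <= (1 - e) * d by rewrite mulr_ge0// ltW.
have [i1 i2] :=
  @integral_between _ _ (lam n) B (fun u => `|\det ('J f u)|) _ _ mB mdet d1 dJ.
split.
  rewrite lfB; apply: (@le_trans _ _ (d%:E * (((1 + e) ^+ n)%:E * lam n B))%E).
    by rewrite lee_pmul2l// lte_fin.
  apply: (@le_trans _ _ (s%:E * (((1 - e) * d)%:E * lam n B))%E).
    rewrite !muleA -!EFinM lee_wpmul2r// lee_fin mulrC mulrA.
    by rewrite ler_wpM2r// ltW.
  by rewrite lee_pmul2l// lte_fin (lt_trans _ s1).
apply: le_trans i2 _; rewrite lfB.
apply: (@le_trans _ _ ((s * (1 - e) ^+ n * d)%:E * lam n B)%E).
  by rewrite lee_wpmul2r// lee_fin ler_wpM2r// ltW.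
apply: le_trans (lee_wpmul2l _ h1) _.
  by rewrite lee_fin !mulr_ge0// ?ltW// ?(lt_trans _ s1) ?exprn_gt0.
rewrite !muleA -!EFinM lee_wpmul2r// lee_fin.
by rewrite exprVn mulrAC -(mulrA s) divff ?mulr1// expf_neq0// gt_eqF.
Qed.

Lemma lee_mul1_gt (x y : \bar R) : (0 <= y)%E ->
  (forall s : R, 1 < s -> (x <= s%:E * y)%E) -> (x <= y)%E.
Proof.
case: y => [y| |] //; last by move=> _ _; rewrite leey.
rewrite lee_fin => y0 H; apply/lee_addgt0Pr => e e0.
have y1 : 0 < y + 1 by rewrite ltr_wpDl.
apply: le_trans (H (1 + e / (y + 1)) _) _.
  by rewrite ltrDl divr_gt0.
rewrite -EFinM -EFinD lee_fin mulrDl mul1r lerD2l -mulrA.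
by rewrite ger_pMr// mulrC ler_pdivrMr// mul1r lerDl.
Qed.

(** Countably many cells carry the local comparison with factor s; summing
   over them and letting s tend to 1 gives the equality. *)
Theorem lebesgue_image_integral n (U B : set 'rV[R]_n) (f : 'rV[R]_n -> 'rV[R]_n) :
  open U -> class_C 1 U f -> set_inj U f ->
  (forall x, U x -> 'J f x \in unitmx) ->
  measurable B -> B `<=` U ->
  measurable (f @` B) /\
  lam n (f @` B) = (\int[lam n]_(u in B) (`|\det ('J f u)|)%:E)%E.
Proof.
move=> oU Cf injf uJ mB BU.
have cf y : U y -> {for y, continuous f}.
  by move=> Uy; apply: differentiable_continuous; exact: Cf.1.
have mf E : measurable E -> E `<=` U -> measurable (f @` E).
  by move=> mE EU; exact: (measurable_image_inj oU cf injf mE EU).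
have mfB := mf _ mB BU; split => //.
have mdet : measurable_fun B (fun u => (`|\det ('J f u)|)%:E).
  apply/measurable_EFinP.
  by apply: (continuous_measurable_rv oU) => // y; exact: det_jacobian_continuous.
pose X := lam n (f @` B).
pose Y := (\int[lam n]_(u in B) (`|\det ('J f u)|)%:E)%E.
suff H s : 1 < s -> (X <= s%:E * Y)%E /\ (Y <= s%:E * X)%E.
  apply/eqP; rewrite eq_le; apply/andP; split; apply: lee_mul1_gt.
  - exact: integral_ge0.
  - by move=> s /H[].
  - exact: measure_ge0.
  - by move=> s /H[].
move=> s1; have s0 : 0 <= s by rewrite ltW// (lt_trans _ s1).
pose good (kc : nat * 'rV[int]_n) := forall E, measurable E ->
    E `<=` B -> E `<=` cell kc.1 kc.2 ->
    (lam n (f @` E) <= s%:E * \int[lam n]_(u in E) (`|\det ('J f u)|)%:E)%E /\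
    (\int[lam n]_(u in E) (`|\det ('J f u)|)%:E <= s%:E * lam n (f @` E))%E.
pose F j : set 'rV[R]_n := if unpickle j is Some kc then
  (if pselect (good kc) then B `&` cell kc.1 kc.2 else set0) else set0.
have mF j : measurable (F j).
  rewrite /F; case: (unpickle j) => [kc|] //.
  case: pselect => //= _; apply: measurableI => //; exact: measurable_cell.
have FE j E : measurable E -> E `<=` F j ->
    (lam n (f @` E) <= s%:E * \int[lam n]_(u in E) (`|\det ('J f u)|)%:E)%E /\
    (\int[lam n]_(u in E) (`|\det ('J f u)|)%:E <= s%:E * lam n (f @` E))%E.
  move=> mE; rewrite /F.
  have triv : E `<=` set0 ->
    (lam n (f @` E) <= s%:E * \int[lam n]_(u in E) (`|\det ('J f u)|)%:E)%E /\
    (\int[lam n]_(u in E) (`|\det ('J f u)|)%:E <= s%:E * lam n (f @` E))%E.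
    by rewrite subset0 => ->; rewrite image_set0 measure0 integral_set0 mule0.
  case: (unpickle j) => [kc|//].
  by case: pselect => //= g; rewrite subsetI => -[EB Ec]; exact: g.
have BF : B = \bigcup_j F j.
  apply/seteqP; split => [v Bv|v [j _]]; last first.
    by rewrite /F; case: (unpickle j) => [kc|//]; case: pselect => // _ [].
  have [r r0 [rU rf]] := change_of_variables_local oU Cf injf (BU _ Bv) (uJ _ (BU _ Bv)) s1.
  have [k kr] := expr2V_lt r0.
  exists (pickle (k, grid k v)) => //; rewrite /F pickleK.
  case: pselect => // -[] E mE EB Ec; apply: rf => // w /Ec cw.
  rewrite -ball_normE/=; apply: le_lt_trans kr.
  exact: (@cell_normB _ _ k (grid k v)).
have mD j : measurable (seqDU F j).
  by apply: measurableD => //; apply: bigsetU_measurable => i _; exact: mF.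
have DB j : seqDU F j `<=` B.
  by rewrite BF seqDU_bigcup_eq; exact: bigcup_sup.
have XE : X = (\sum_(j <oo) lam n (f @` seqDU F j))%E.
  rewrite /X {1}BF seqDU_bigcup_eq image_bigcup measure_semi_bigcup//.
  - by move=> j; apply: mf => //; exact: subset_trans (DB j) BU.
  - move=> i j _ _ [_ [[v Dv <-] [w Dw]]] /injf.
    rewrite !inE => /(_ (BU _ (DB _ _ Dw)) (BU _ (DB _ _ Dv))) wv.
    by apply: (trivIset_seqDU F) => //; exists v; split => //; rewrite -wv.
  by rewrite -image_bigcup -seqDU_bigcup_eq -BF.
have YE : Y = (\sum_(j <oo) \int[lam n]_(u in seqDU F j) (`|\det ('J f u)|)%:E)%E.
  rewrite /Y {1}BF seqDU_bigcup_eq ge0_integral_bigcup//.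
  by rewrite -seqDU_bigcup_eq -BF.
have DF j : seqDU F j `<=` F j by exact: subDsetl.
rewrite XE YE; split; rewrite -nneseriesZl//.
- by apply: lee_nneseries => // j _; have [] := FE j _ (mD j) (DF j).
- by move=> j _; exact: integral_ge0.
- apply: lee_nneseries => [j _ _|j _]; first exact: integral_ge0.
  by have [] := FE j _ (mD j) (DF j).
Qed.

End change_of_variables.

(** * Differentials of maps between spaces of row vectors *)

Section differentials.
Context (R : realType).

Lemma is_diff_mul (V : normedModType R) (f g df dg : V -> R) x :
  is_diff x f df -> is_diff x g dg ->
  is_diff x (fun v => f v * g v) (fun v => f x * dg v + g x * df v).
Proof.
move=> Hf Hg; have H : is_diff x (f * g) (f x \*: dg + g x \*: df).
  exact: is_diffM.
by move: H; congr (is_diff_def _ _ _); apply/funext => v.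
Qed.

Lemma is_diff_sum (V : normedModType R) n (f df : 'I_n -> V -> R) x :
  (forall i, is_diff x (f i) (df i)) ->
  is_diff x (fun v => \sum_i f i v) (fun v => \sum_i df i v).
Proof.
move=> H.
have E (g : 'I_n -> V -> R) : (fun v => \sum_i g i v) = \sum_i g i.
  by apply/funext => v; rewrite fct_sumE.
have D : differentiable (fun v => \sum_i f i v) x.
  by rewrite E; apply: differentiable_sum => i; have [] := H i.
apply: DiffDef => //; apply/funext => v.
rewrite -deriveE// E derive_sum => [|i]; last first.
  by apply: diff_derivable; have [] := H i.
by apply: eq_bigr => i _; have [Di <-] := H i; rewrite deriveE.
Qed.

Lemma is_diff_comp1 (V : normedModType R) (f df : V -> R) (phi : R -> R) (d : R) x :
  is_derive (f x) 1 phi d -> is_diff x f df ->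
  is_diff x (fun v => phi (f v)) (fun v => df v * d).
Proof.
move=> [Dphi Ephi] Hf.
have Hp : is_diff (f x) phi (fun t => t * d).
  apply: DiffDef; first exact/derivable1_diffP.
  by rewrite deriv1E// derive1E Ephi.
exact: (is_diff_comp Hf Hp).
Qed.

Lemma is_diff_linear (V W : normedModType R) (L : {linear V -> W}) x :
  continuous L -> is_diff x L L.
Proof.
move=> cL; apply: DiffDef; first exact: linear_differentiable.
exact: diff_lin.
Qed.

Lemma is_diff_coord m n (x : 'M[R]_(m, n)) i j :
  is_diff x (fun M : 'M[R]_(m, n) => M i j) (fun M => M i j).
Proof.
have @f : {linear 'M[R]_(m, n) -> R}.
  by exists (fun N : 'M[R]_(_, _) => N i j); do 2![eexists]; do ?[constructor];
     rewrite ?mxE// => ? *; rewrite ?mxE//; move=> ?; rewrite !mxE.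
apply: (@is_diff_linear _ _ f); exact: coord_continuous.
Qed.

Lemma is_diff_const (V W : normedModType R) (c : W) (x : V) :
  is_diff x (fun=> c) (fun=> 0).
Proof. by have := is_diff_cst c x; congr (is_diff_def _ _ _). Qed.

Lemma is_diff_rvP m n (f : 'rV[R]_m -> 'rV[R]_n) (A : 'M[R]_(m, n)) x :
  is_diff x f (fun v => v *m A) <->
  forall j, is_diff x (fun v => f v ord0 j) (fun v => (v *m A) ord0 j).
Proof.
split=> [Hf j|H].
  exact: (is_diff_comp Hf (is_diff_coord (f x) ord0 j)).
have D : differentiable f x.
  rewrite (_ : f = \sum_(j < n) (fun v => f v ord0 j *: (delta_mx ord0 j : 'rV[R]_n))).
    by apply: differentiable_sum => j; apply: differentiableZl; have [] := H j.
  by apply/funext => v; rewrite fct_sumE [LHS]row_sum_delta.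
apply: DiffDef => //; apply/funext => v; rewrite -deriveE//.
rewrite derive_mx; last exact: diff_derivable.
apply/rowP => j; rewrite mxE; have [Dj Ej] := H j.
by rewrite deriveE// Ej.
Qed.

Lemma is_diff_jacobianE m n (f : 'rV[R]_m -> 'rV[R]_n) (A : 'M[R]_(m, n)) x :
  is_diff x f (fun v => v *m A) -> 'J f x = A.
Proof.
move=> [Df Ef]; apply/row_matrixP => i.
by rewrite !rowE -deriveEjacobian// deriveE// Ef.
Qed.

Lemma differentiable_is_diff m n (f : 'rV[R]_m -> 'rV[R]_n) x :
  differentiable f x -> is_diff x f (fun v => v *m 'J f x).
Proof.
move=> Df; apply: DiffDef => //; apply/funext => v.
by rewrite -deriveEjacobian// deriveE.
Qed.

(** A continuous Jacobian makes every directional derivative continuous. *)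
Lemma class_C1P m n (U : set 'rV[R]_m) (f : 'rV[R]_m -> 'rV[R]_n)
    (A : 'rV[R]_m -> 'M[R]_(m, n)) : open U ->
  (forall x, U x -> is_diff x f (fun v => v *m A x)) ->
  (forall x, U x -> {for x, continuous A}) -> class_C 1 U f.
Proof.
move=> oU H cA; split=> [x Ux|v x Ux]; first by have [] := H x Ux.
apply: (@continuous_at_near _ _ (fun y => v *m A y)).
  apply: filterS (open_nbhs_nbhs (conj oU Ux)) => y Uy.
  by have [Dy Ey] := H y Uy; rewrite deriveE// Ey.
apply: rv_continuousP => j; apply: mulmx_coord_continuous; last exact: cA.
exact: cst_continuous.
Qed.

Lemma class_C1_is_diff m n (U : set 'rV[R]_m) (f : 'rV[R]_m -> 'rV[R]_n) x :
  class_C 1 U f -> U x -> is_diff x f (fun v => v *m 'J f x).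
Proof. by move=> [Df _] /Df; exact: differentiable_is_diff. Qed.

Lemma class_C1_continuous m n (U : set 'rV[R]_m) (f : 'rV[R]_m -> 'rV[R]_n) x :
  class_C 1 U f -> U x -> {for x, continuous f}.
Proof. by move=> [Df _] /Df; exact: differentiable_continuous. Qed.

Lemma is_diff_comp_mx m n p (f : 'rV[R]_m -> 'rV[R]_n) (g : 'rV[R]_n -> 'rV[R]_p)
    A B x :
  is_diff x f (fun v => v *m A) -> is_diff (f x) g (fun v => v *m B) ->
  is_diff x (fun v => g (f v)) (fun v => v *m (A *m B)).
Proof.
move=> Hf Hg; have := is_diff_comp Hf Hg.
by congr (is_diff_def _ _ _); apply/funext => v /=; rewrite mulmxA.
Qed.

Lemma jacobian_comp m n p (f : 'rV[R]_m -> 'rV[R]_n) (g : 'rV[R]_n -> 'rV[R]_p) x :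
  differentiable f x -> differentiable g (f x) ->
  'J (fun v => g (f v)) x = 'J f x *m 'J g (f x).
Proof.
move=> /differentiable_is_diff Hf /differentiable_is_diff Hg.
exact: is_diff_jacobianE (is_diff_comp_mx Hf Hg).
Qed.

Lemma mulmx_continuous_at (T : topologicalType) m n p
    (f : T -> 'M[R]_(m, n)) (g : T -> 'M[R]_(n, p)) x :
  {for x, continuous f} -> {for x, continuous g} ->
  {for x, continuous (fun t => f t *m g t)}.
Proof. by move=> cf cg; apply: mx_continuousP => i j; exact: mulmx_coord_continuous. Qed.

Lemma class_C1_comp m n p (U : set 'rV[R]_m) (V : set 'rV[R]_n)
    (f : 'rV[R]_m -> 'rV[R]_n) (g : 'rV[R]_n -> 'rV[R]_p) :
  open U -> open V -> class_C 1 U f -> class_C 1 V g ->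
  (forall x, U x -> V (f x)) -> class_C 1 U (fun v => g (f v)).
Proof.
move=> oU oV Cf Cg fUV.
have J x : U x -> is_diff x (fun v => g (f v)) (fun v => v *m ('J f x *m 'J g (f x))).
  move=> Ux.
  apply: is_diff_comp_mx; first exact: class_C1_is_diff Cf Ux.
  exact: class_C1_is_diff Cg (fUV _ Ux).
apply: (class_C1P oU J) => x Ux.
apply: mulmx_continuous_at; first exact: jacobian_continuous Cf Ux.
apply: (@continuous_comp _ _ _ f (fun y => 'J g y)).
  exact: class_C1_continuous Cf Ux.
exact: (jacobian_continuous oV Cg (fUV _ Ux)).
Qed.

Lemma is_diff_mulmxr m n (Q : 'M[R]_(m, n)) (y : 'rV[R]_m) :
  is_diff y (fun u : 'rV[R]_m => u *m Q) (fun d : 'rV[R]_m => d *m Q).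
Proof.
apply/is_diff_rvP => j.
have := is_diff_sum (fun i => is_diff_mul (is_diff_coord y ord0 i) (is_diff_const (Q i j) y)).
rewrite (_ : (fun u : 'rV[R]_m => \sum_i u ord0 i * Q i j) = fun u => (u *m Q) ord0 j).
  congr (is_diff_def _ _ _); apply/funext => d.
  by rewrite mxE; apply: eq_bigr => i _; rewrite mulr0 add0r mulrC.
by apply/funext => u; rewrite mxE.
Qed.

Lemma class_C1_mulmxr m n (Q : 'M[R]_(m, n)) (U : set 'rV[R]_m) :
  open U -> class_C 1 U (fun u : 'rV[R]_m => u *m Q).
Proof.
move=> oU; apply: (@class_C1P _ _ _ _ (fun=> Q) oU) => y _.
  exact: is_diff_mulmxr.
exact: cst_continuous.
Qed.

Lemma mulmx_tr_eq0 n (v : 'rV[R]_n) : (v *m v^T) ord0 ord0 = 0 -> v = 0.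
Proof.
move=> vv0; apply/rowP => j; rewrite mxE; apply/eqP; rewrite -sqrf_eq0; apply/eqP.
have : \sum_j v 0 j ^+ 2 = 0.
  by rewrite -[RHS]vv0 mxE; apply: eq_bigr => k _; rewrite mxE expr2.
by move/psumr_eq0P => H; apply: H => // k _; exact: sqr_ge0.
Qed.

(** Positivity of v *m v^T makes Gram matrices of free rows invertible. *)
Lemma gram_unitmx m n (A : 'M[R]_(m, n)) : row_free A -> A *m A^T \in unitmx.
Proof.
move=> fA; rewrite -row_free_unit -kermx_eq0; apply/eqP/row_matrixP => i.
rewrite row0; set u := row i _.
have uA : u *m (A *m A^T) = 0 by rewrite /u -row_mul mulmx_ker row0.
have : u *m A = 0.
  by apply: mulmx_tr_eq0; rewrite trmx_mul mulmxA -(mulmxA u) uA mul0mx mxE.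
by move=> uA0; apply: (row_free_inj fA); rewrite mul0mx.
Qed.

Lemma unit_row_free_mul m n p (A : 'M[R]_(m, n)) (B : 'M[R]_(n, p)) :
  row_free (A *m B) -> row_free A.
Proof.
rewrite /row_free => /eqP rAB; rewrite eqn_leq rank_leq_row -{1}rAB.
exact: mxrankM_maxl.
Qed.

End differentials.

(** * The volume of cones over the unit sphere *)

Section integrals.
Local Open Scope ereal_scope.

Lemma integral_prod_mul d1 d2 (T1 : measurableType d1) (T2 : measurableType d2)
    (R : realType) (m1 : {sigma_finite_measure set T1 -> \bar R})
    (m2 : {sigma_finite_measure set T2 -> \bar R})
    (f1 : T1 -> \bar R) (f2 : T2 -> \bar R) :
  measurable_fun setT f1 -> measurable_fun setT f2 ->
  (forall x, 0 <= f1 x) -> (forall y, 0 <= f2 y) ->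
  \int[m1 \x m2]_z (f1 z.1 * f2 z.2) = \int[m1]_x f1 x * \int[m2]_y f2 y.
Proof.
move=> mf1 mf2 f10 f20; rewrite (fubini_tonelli1 (fun z => f1 z.1 * f2 z.2)).
- rewrite /fubini_F /=; under eq_integral do rewrite ge0_integralZl//.
  by rewrite ge0_integralZr//; exact: integral_ge0.
- by apply: emeasurable_funM; apply: measurableT_comp.
- by move=> z; exact: mule_ge0.
Qed.

End integrals.

Lemma integral_expr01 (R : realType) n :
  (\int[@lebesgue_measure R]_(t in `]0%R, 1%R]) (t ^+ n)%:E = (n.+1%:R^-1)%:E)%E.
Proof.
have mf : measurable_fun `]0%R, (1 : R)]%classic (fun t : R => t ^+ n).
  apply: measurable_funTS; apply: continuous_measurable_fun => x.
  exact: exprn_continuous.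
rewrite integral_itv_obnd_cbnd//; last exact/measurable_EFinP.
pose F : R -> R := n.+1%:R^-1 *: (fun t : R => t ^+ n.+1).
have DF (t : R) : derivable F t 1 by apply: derivableZ; exact: exprn_derivable.
have cF x : {for x, continuous F}.
  by apply: differentiable_continuous; exact/derivable1_diffP.
have E : forall t, derive1 F t = t ^+ n.
  move=> t; rewrite derive1E /F deriveZ; last exact: exprn_derivable.
  rewrite exp_derive/= /GRing.scale/= mulr1 mulrA mulVf ?mul1r//.
rewrite (@continuous_FTC2 _ _ F)//.
- have FE t : F t = n.+1%:R^-1 * t ^+ n.+1 by [].
  by rewrite !FE expr1n mulr1 expr0n/= mulr0 sube0.
- by apply: continuous_subspaceT => x; exact: exprn_continuous.
- split; first by move=> x _.
    by apply: cvg_at_right_filter; exact: cF.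
  by apply: cvg_at_left_filter; exact: cF.
Qed.

Lemma integral_rVS (R : realType) n (g : 'rV[R]_n.+1 -> \bar R) :
  measurable_fun setT g -> (forall v, 0 <= g v)%E ->
  (\int[lebesgue_rV R n.+1]_v g v =
   \int[@lebesgue_measure R \x lebesgue_rV R n]_z g (rv_cons z))%E.
Proof.
move=> mg g0; have g0' : {in [set: 'rV[R]_n.+1], forall v, (0 <= g v)%E} by [].
exact: (ge0_integral_pushforward (@measurable_rv_cons R n)
  (@lebesgue_measure R \x lebesgue_rV R n)%E measurableT mg g0').
Qed.

Section euclidean_norm.
Context (R : realType).

Definition enorm n (v : 'rV[R]_n) : R := Num.sqrt (\sum_i v ord0 i ^+ 2).

Lemma mulmx_trE n (v : 'rV[R]_n) : (v *m v^T) ord0 ord0 = \sum_i v ord0 i ^+ 2.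
Proof. by rewrite mxE; apply: eq_bigr => i _; rewrite mxE expr2. Qed.

Lemma enorm_ge0 n (v : 'rV[R]_n) : 0 <= enorm v.
Proof. exact: sqrtr_ge0. Qed.

Lemma sqr_enorm n (v : 'rV[R]_n) : enorm v ^+ 2 = (v *m v^T) ord0 ord0.
Proof. by rewrite mulmx_trE sqr_sqrtr// sumr_ge0// => i _; exact: sqr_ge0. Qed.

Lemma enormZ n (c : R) (v : 'rV[R]_n) : 0 <= c -> enorm (c *: v) = c * enorm v.
Proof.
move=> c0; rewrite /enorm -{2}(ger0_norm c0) -sqrtr_sqr -sqrtrM ?sqr_ge0//.
congr Num.sqrt; rewrite mulr_sumr; apply: eq_bigr => i _.
by rewrite mxE exprMn.
Qed.

Lemma enorm_eq0 n (v : 'rV[R]_n) : enorm v = 0 -> v = 0.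
Proof.
by move=> v0; apply: mulmx_tr_eq0; rewrite -sqr_enorm v0 expr0n.
Qed.

Lemma enorm0 n : enorm (0 : 'rV[R]_n) = 0.
Proof. by rewrite -(scale0r 0) enormZ// mul0r. Qed.

Lemma enorm_gt0 n (v : 'rV[R]_n) : v != 0 -> 0 < enorm v.
Proof.
move=> v0; rewrite lt_neqAle enorm_ge0 andbT eq_sym.
by apply: contra_neq v0; exact: enorm_eq0.
Qed.

Lemma sphereP n (v : 'rV[R]_n) :
  @euclidean_sphere R n v <-> v *m v^T = (1%:M : 'M[R]_1).
Proof.
rewrite /euclidean_sphere/= -/(enorm v); split => [v1|vv1].
  by rewrite [LHS]mx11_scalar -sqr_enorm v1 expr1n.
by rewrite /enorm -mulmx_trE vv1 mxE mulr1n sqrtr1.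
Qed.

Lemma enorm_continuous n (v : 'rV[R]_n) : {for v, continuous (@enorm n)}.
Proof.
rewrite /enorm; apply: (@continuous_comp _ _ _ _ (@Num.sqrt R)); last first.
  exact: sqrt_continuous.
apply: sum_continuous_at => i; apply: exprn_continuous_at.
exact: coord_continuous.
Qed.

End euclidean_norm.

Lemma trmx_continuous_at (R : realType) (T : topologicalType) m n
    (f : T -> 'M[R]_(m, n)) x :
  {for x, continuous f} -> {for x, continuous (fun t => (f t)^T)}.
Proof.
move=> cf; apply: mx_continuousP => i j.
rewrite (_ : (fun t => _) = fun t => f t j i); first exact: mx_entry_continuous.
by apply/funext => t; rewrite mxE.
Qed.

Section cones.
Context (R : realType) (n : nat).
Local Notation lam := (lebesgue_rV R).
Implicit Types (v d : 'rV[R]_n.+1) (u : 'rV[R]_n).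

Definition rv_tail v : 'rV[R]_n := \row_j v ord0 (lift ord0 j).

Lemma rv_tail_cons (t : measurableTypeR R) u : rv_tail (rv_cons (t, u)) = u.
Proof. by apply/rowP => j; rewrite mxE rv_consS. Qed.

Lemma rv_etaE v : v = rv_cons (v ord0 ord0 : measurableTypeR R, rv_tail v).
Proof.
apply/rowP => i; case: (unliftP ord0 i) => [j ->|->].
  by rewrite rv_consS mxE.
by rewrite rv_cons0.
Qed.

Lemma mulmx_rv_col m v (P : 'rV[R]_m) (Q : 'M[R]_(n, m)) :
  v *m (col_mx P Q : 'M[R]_(n.+1, m)) = v ord0 ord0 *: P + rv_tail v *m Q.
Proof.
rewrite {1}(rv_etaE v) /rv_cons/=.
by apply: etrans (@mul_row_col _ 1 1 n m _ _ _ _) _; rewrite mul_scalar_mx.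
Qed.

Lemma continuous_rv_tail v : {for v, continuous rv_tail}.
Proof.
apply: rv_continuousP => j.
rewrite (_ : (fun t => _) = fun v => v ord0 (lift ord0 j)).
  exact: coord_continuous.
by apply/funext => w; rewrite mxE.
Qed.

Lemma measurable_rv_tail : measurable_fun setT rv_tail.
Proof.
apply: (@continuous_measurable_rv_rv _ _ _ setT) => //; first exact: openT.
by move=> v _; exact: continuous_rv_tail.
Qed.

Lemma is_diff_rv_tail v : is_diff v rv_tail rv_tail.
Proof.
have lT : linear rv_tail by move=> a x y; apply/rowP => j; rewrite !mxE.
pose TM := GRing.isLinear.Build _ _ _ _ _ lT.
pose T : {linear _ -> _} := HB.pack rv_tail TM.
by apply: (@is_diff_linear _ _ _ T) => x; exact: continuous_rv_tail.
Qed.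

Variables (U : set 'rV[R]_n) (p : 'rV[R]_n -> 'rV[R]_n.+1).
Hypothesis pS : local_param (@euclidean_sphere R n.+1) U p.

Let oU : open U. Proof. by case: pS. Qed.
Let Cp : class_C 1 U p. Proof. by case: pS. Qed.

Lemma local_param_sphere u : U u -> p u *m (p u)^T = (1%:M : 'M[R]_1).
Proof. by move=> Uu; apply/sphereP; case: pS => _ _ _ + _; apply; exists u. Qed.

(** The derivative of |p|^2 = 1. *)
Lemma local_param_sphere_orth u : U u -> 'J p u *m (p u)^T = 0.
Proof.
move=> Uu; have Hp := class_C1_is_diff Cp Uu.
pose F w := \sum_j p w ord0 j * p w ord0 j.
have HF : is_diff u F (fun d : 'rV[R]_n => \sum_j (p u ord0 j * (d *m 'J p u) ord0 j
    + p u ord0 j * (d *m 'J p u) ord0 j)).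
  apply: is_diff_sum => j; apply: is_diff_mul; exact: (iffLR (is_diff_rvP _ _ _) Hp).
have F1 w : U w -> F w = 1.
  move=> /local_param_sphere /matrixP/(_ ord0 ord0); rewrite !mxE mulr1n => <-.
  by apply: eq_bigr => j _; rewrite mxE.
have D0 (d : 'rV[R]_n) : 'D_d F u = 0.
  transitivity ('D_d (cst (1 : R)) u); last exact: derive_cst.
  apply: near_eq_derive.
  by apply: filterS (open_nbhs_nbhs (conj oU Uu)) => w Uw; exact: F1.
apply/matrixP => i k; rewrite (ord1 k) [RHS]mxE; have := D0 (delta_mx ord0 i).
have [DF EF] := HF; rewrite deriveE// EF -rowE.
have -> : ('J p u *m (p u)^T) i ord0 = \sum_j p u ord0 j * row i ('J p u) ord0 j.
  by rewrite mxE; apply: eq_bigr => j _; rewrite !mxE mulrC.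
by rewrite big_split/= -mulr2n => /eqP; rewrite mulrn_eq0/= => /eqP.
Qed.

(** Polar coordinates (t, u) |-> t p(u), with t the first entry of v and u the
   remaining ones. *)
Definition cone_map v : 'rV[R]_n.+1 := v ord0 ord0 *: p (rv_tail v).

Definition cone_dom : set 'rV[R]_n.+1 := [set v : 'rV[R]_n.+1 | 0 < v ord0 ord0 /\ U (rv_tail v)].

Definition cone_set (D : set 'rV[R]_n) : set 'rV[R]_n.+1 :=
  [set v : 'rV[R]_n.+1 | 0 < v ord0 ord0 <= 1 /\ D (rv_tail v)].

Lemma open_cone_dom : open cone_dom.
Proof.
apply: openI; last by apply: open_comp => // v _; exact: continuous_rv_tail.
apply: (@open_comp _ _ (fun v : 'rV[R]_n.+1 => v ord0 ord0) [set r | 0 < r]).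
  by move=> v _; exact: coord_continuous.
exact: open_gt.
Qed.

Definition cone_jac v : 'M[R]_n.+1 :=
  col_mx (p (rv_tail v)) (v ord0 ord0 *: 'J p (rv_tail v)).

Lemma is_diff_cone_map v : cone_dom v ->
  is_diff v cone_map (fun d : 'rV[R]_n.+1 => d *m cone_jac v).
Proof.
move=> [v0 Uv]; apply/is_diff_rvP => j.
have Hp := (iffLR (is_diff_rvP _ _ _) (class_C1_is_diff Cp Uv)) j.
have := is_diff_mul (is_diff_coord v ord0 ord0) (is_diff_comp (is_diff_rv_tail v) Hp).
rewrite (_ : (fun w : 'rV[R]_n.+1 => w ord0 ord0 * _) = fun w => cone_map w ord0 j); last first.
  by apply/funext => w; rewrite /cone_map mxE.
congr (is_diff_def _ _ _); apply/funext => d /=.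
by rewrite mulmx_rv_col -scalemxAr !mxE addrC [_ * d _ _]mulrC.
Qed.

Lemma class_C1_cone_map : class_C 1 cone_dom cone_map.
Proof.
apply: (class_C1P open_cone_dom is_diff_cone_map) => v [v0 Uv].
have ct : {for v, continuous rv_tail} by exact: continuous_rv_tail.
have cp : {for v, continuous (fun v => p (rv_tail v))}.
  apply: (@continuous_comp _ _ _ rv_tail p) => //.
  exact: class_C1_continuous Cp Uv.
have cJ : {for v, continuous (fun v => 'J p (rv_tail v))}.
  apply: (@continuous_comp _ _ _ rv_tail (fun u => 'J p u)) => //.
  exact: jacobian_continuous Cp Uv.
apply: mx_continuousP => i j; case: (unliftP ord0 i) => [k ->|->].
  rewrite (_ : (fun w => _) = fun w : 'rV[R]_n.+1 => w ord0 ord0 * 'J p (rv_tail w) k j).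
    apply: continuousM; first exact: coord_continuous.
    by apply: (@mx_entry_continuous _ _ _ _ (fun w : 'rV[R]_n.+1 => 'J p (rv_tail w))).
  apply/funext => w; rewrite (_ : lift ord0 k = rshift 1 k); last exact/val_inj.
  by apply: etrans (col_mxEd _ _ _ _) _; rewrite mxE.
rewrite (_ : (fun w => _) = fun w => p (rv_tail w) ord0 j).
  by apply: (@mx_entry_continuous _ _ _ _ (fun w : 'rV[R]_n.+1 => p (rv_tail w))).
apply/funext => w; rewrite (_ : (ord0 : 'I_n.+1) = lshift n (ord0 : 'I_1)); last exact/val_inj.
exact: col_mxEu.
Qed.

(** p u is a unit vector orthogonal to the rows of 'J p u, so the Gram matrix
   of the cone Jacobian is block diagonal. *)
Lemma sqr_det_cone_jac v : cone_dom v ->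
  (\det (cone_jac v)) ^+ 2 = (v ord0 ord0 ^+ n) ^+ 2 *
     \det (induced_metric (@euclidean_metric R n.+1) p (rv_tail v)).
Proof.
move=> [v0 Uv]; set t := v ord0 ord0 in v0 *.
set u := rv_tail v in Uv *; rewrite /induced_metric /euclidean_metric mulmx1.
rewrite expr2 -{2}det_tr -det_mulmx.
have o : (p u) *m ('J p u)^T = 0.
  by apply: trmx_inj; rewrite trmx_mul trmxK local_param_sphere_orth// trmx0.
rewrite /cone_jac -/t -/u.
have -> : (col_mx (p u) (t *: 'J p u) : 'M[R]_n.+1) *m (col_mx (p u) (t *: 'J p u) : 'M[R]_n.+1)^T =
    block_mx (1%:M : 'M[R]_1) 0 0 ((t ^+ 2) *: ('J p u *m ('J p u)^T)).
  rewrite -(local_param_sphere Uv).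
  apply: etrans (congr1 (mulmx _) (@tr_col_mx _ 1 n _ _ _)) _.
  apply: etrans (@mul_col_row _ 1 n _ 1 n _ _ _ _) _.
  rewrite linearZ/= -!scalemxAr -!scalemxAl scalerA expr2.
  by rewrite o local_param_sphere_orth// !scaler0.
apply: etrans (@det_lblock _ 1 n _ _ _) _.
by rewrite det1 mul1r detZ exprAC.
Qed.

Lemma det_cone_jac v : cone_dom v ->
  `|\det (cone_jac v)| = v ord0 ord0 ^+ n *
     Num.sqrt (\det (induced_metric (@euclidean_metric R n.+1) p (rv_tail v))).
Proof.
move=> dv; case: (dv) => v0 _.
rewrite -sqrtr_sqr sqr_det_cone_jac// sqrtrM ?sqr_ge0// sqrtr_sqr.
by rewrite ger0_norm// exprn_ge0// ltW.
Qed.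

Lemma cone_jac_unit v : cone_dom v -> cone_jac v \in unitmx.
Proof.
move=> dv; case: (dv) => v0 Uv.
rewrite unitmxE unitfE -sqrf_eq0 sqr_det_cone_jac// mulf_eq0 negb_or.
apply/andP; split; first by rewrite !expf_neq0// gt_eqF.
rewrite /induced_metric /euclidean_metric mulmx1.
rewrite -unitfE -unitmxE; apply: gram_unitmx.
by case: pS => _ _ _ _; apply.
Qed.

Lemma enorm_cone_map v : cone_dom v -> enorm (cone_map v) = v ord0 ord0.
Proof.
move=> [v0 Uv]; rewrite enormZ ?ltW// /enorm -mulmx_trE local_param_sphere//.
by rewrite mxE mulr1n sqrtr1 mulr1.
Qed.

Lemma cone_map_inj : set_inj cone_dom cone_map.
Proof.
move=> v w /set_mem dv /set_mem dw e.
have e0 : v ord0 ord0 = w ord0 ord0.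
  by rewrite -enorm_cone_map// e enorm_cone_map.
case: (dv) (dw) => v0 Uv [w0 Uw].
rewrite (rv_etaE v) (rv_etaE w) e0; congr (rv_cons (_, _)).
case: pS => _ _ injp _ _; apply: injp; rewrite ?inE//.
move: e; rewrite /cone_map e0 => /(congr1 (fun x => (w ord0 ord0)^-1 *: x)).
by rewrite !scalerA mulVf ?gt_eqF// !scale1r.
Qed.

Lemma measurable_cone_set D : measurable D -> measurable (cone_set D).
Proof.
move=> mD.
rewrite (_ : cone_set D = rv_coord ord0 @^-1` `]0, 1]%classic `&` rv_tail @^-1` D).
  apply: measurableI.
    by rewrite -[X in measurable X]setTI; apply: measurable_rv_coord.
  rewrite -[X in measurable X]setTI.
  by apply: measurable_rv_tail.
by apply/seteqP; split => v; rewrite /cone_set /= in_itv.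
Qed.

Lemma continuous_gram u : U u -> {for u, continuous
  (fun u => \det (induced_metric (@euclidean_metric R n.+1) p u))}.
Proof.
move=> Uu; have cJ := jacobian_continuous oU Cp Uu.
apply: det_continuous_at; rewrite /induced_metric /euclidean_metric.
apply: mulmx_continuous_at.
  by apply: mulmx_continuous_at => //; exact: cst_continuous.
exact: trmx_continuous_at.
Qed.

Lemma continuous_area_density u : U u -> {for u, continuous
  (fun u => Num.sqrt (\det (induced_metric (@euclidean_metric R n.+1) p u)))}.
Proof.
move=> Uu; apply: (@continuous_comp _ _ _ _ (@Num.sqrt R)).
  exact: continuous_gram.
exact: sqrt_continuous.
Qed.

(** The Jacobian determinant in polar coordinates is t^n times the area
   density, and t^n has the integral 1 / (n + 1) over ]0, 1]. *)
Lemma lebesgue_cone D : measurable D -> D `<=` U ->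
  measurable (cone_map @` cone_set D) /\
  lam n.+1 (cone_map @` cone_set D) =
    ((n.+1%:R^-1)%:E * param_area (@euclidean_metric R n.+1) D p)%E.
Proof.
move=> mD DU.
have sub : cone_set D `<=` cone_dom by move=> v [/andP[? _] /DU].
have J v : cone_dom v -> 'J cone_map v = cone_jac v.
  by move=> dv; apply: is_diff_jacobianE; exact: is_diff_cone_map.
have uJ v : cone_dom v -> 'J cone_map v \in unitmx.
  by move=> dv; rewrite J//; exact: cone_jac_unit.
have [mI ->] := lebesgue_image_integral open_cone_dom class_C1_cone_map
  cone_map_inj uJ (measurable_cone_set mD) sub.
split => //.
pose b u := Num.sqrt (\det (induced_metric (@euclidean_metric R n.+1) p u)).
pose f1 := (fun t : measurableTypeR R => (t ^+ n)%:E) \_ `]0%R, 1%R]%classic.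
pose f2 := (fun u => (b u)%:E) \_ D.
have mb : measurable_fun D (fun u => (b u)%:E).
  apply/measurable_EFinP; apply: (continuous_measurable_rv oU) => //.
  exact: continuous_area_density.
have mf1 : measurable_fun setT f1.
  have mI01 : measurable (`]0%R, 1%R]%classic : set (measurableTypeR R)).
    exact: measurable_itv.
  apply/(measurable_restrictT _ mI01).
  apply/measurable_EFinP; apply: measurable_funTS.
  by apply: continuous_measurable_fun => x; exact: exprn_continuous.
have mf2 : measurable_fun setT f2 by apply/(measurable_restrictT _ mD).
have f10 t : (0 <= f1 t)%E.
  rewrite /f1 /patch; case: ifPn => //; rewrite inE/= in_itv/= => /andP[t0 _].
  by rewrite lee_fin exprn_ge0// ltW.
have f20 u : (0 <= f2 u)%E.
  by rewrite /f2 /patch; case: ifPn => // _; rewrite lee_fin sqrtr_ge0.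
have I1 : (\int[@lebesgue_measure R]_t f1 t)%E = (n.+1%:R^-1)%:E.
  by rewrite -(integral_expr01 R n) [RHS]integral_mkcond.
have I2 : param_area (@euclidean_metric R n.+1) D p = (\int[lam n]_u f2 u)%E.
  by rewrite /param_area integral_mkcond.
rewrite I2 -I1 -integral_prod_mul//.
rewrite integral_mkcond.
pose g (v : 'rV[R]_n.+1) := (f1 (v ord0 ord0) * f2 (rv_tail v))%E.
transitivity (\int[lam n.+1]_v g v)%E.
  apply: eq_integral => v _; rewrite /patch /g /f1 /f2 /patch.
  have [|] := boolP (v \in cone_set D).
    rewrite inE => Cv; have [/andP[v0 v1] Dv] := Cv.
    rewrite mem_set ?mem_set//=; last by rewrite in_itv/= v0.
    by rewrite J ?det_cone_jac ?EFinM//; exact: sub.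
  move=> /negP; rewrite inE => nC.
  case: ifPn; last by rewrite mul0e.
  rewrite inE/= in_itv/= => v01; case: ifPn; last by rewrite mule0.
  by rewrite inE => Dv; exfalso; apply: nC.
have mg : measurable_fun setT g.
  apply: emeasurable_funM; first by apply: measurableT_comp => //; exact: measurable_rv_coord.
  exact: measurableT_comp mf2 measurable_rv_tail.
have g0 v : (0 <= g v)%E by apply: mule_ge0.
apply: etrans (integral_rVS mg g0) _.
by apply: eq_integral => -[t u] _; rewrite /g/= rv_cons0 rv_tail_cons.
Qed.

End cones.

(** * The area of the unit sphere *)

Section sphere_area.
Context (R : realType) (n : nat).
Local Notation lam := (lebesgue_rV R).
Local Notation sphere := (@euclidean_sphere R n.+1).
Local Notation ball1 := (@euclidean_ball R n.+1).
Local Notation eucl := (@euclidean_metric R n.+1).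

Lemma rv_set1E m : [set 0] = rv_box (fun=> [set (0 : R)]) :> set 'rV[R]_m.
Proof.
apply/seteqP; split => v /=; first by move=> -> i; rewrite mxE.
by move=> v0; apply/rowP => i; rewrite mxE; exact: v0.
Qed.

Lemma lebesgue_rV_set1 : lam n.+1 [set 0] = 0%E.
Proof.
rewrite rv_set1E (@lebesgue_rV_box R n.+1 _ (fun=> 0)) => [|i|i].
- by rewrite prodr_const card_ord expr0n.
- exact: measurable_set1.
- exact: lebesgue_measure_set1.
Qed.

Lemma measurable_ball1 : measurable ball1.
Proof.
apply: closed_measurable_rv.
apply: (@preimage_closed _ _ (@enorm R n.+1) [set r | r <= 1]).
  by move=> v _; exact: enorm_continuous.
exact: closed_le.
Qed.

Lemma measurable_rv_set1 m : measurable [set (0 : 'rV[R]_m)].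
Proof.
by rewrite rv_set1E; apply: measurable_rv_box => i; exact: measurable_set1.
Qed.

Lemma lebesgue_ball1_fin : (lam n.+1 ball1 < +oo)%E.
Proof.
have sub : ball1 `<=` rv_box (fun=> `[(- 1 : R), 1]%classic).
  move=> v; rewrite /euclidean_ball/= -/(enorm v) => v1 i /=.
  rewrite in_itv/= -ler_norml -(@ler_pXn2r _ 2)// ?nnegrE//.
  rewrite expr1n real_normK ?num_real//.
  apply: (@le_trans _ _ (enorm v ^+ 2)); last by rewrite exprn_ile1// enorm_ge0.
  rewrite sqr_enorm mulmx_trE (bigD1 i)//= lerDl sumr_ge0// => j _.
  exact: sqr_ge0.
have mbox : measurable (rv_box (fun=> `[(- 1 : R), 1]%classic) : set 'rV[R]_n.+1).
  by apply: measurable_rv_box => i; exact: measurable_itv.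
have lbox : lam n.+1 (rv_box (fun=> `[(- 1 : R), 1]%classic)) = (2 ^+ n.+1)%:E.
  rewrite (@lebesgue_rV_box R n.+1 _ (fun=> 2)) => [|i|i].
  - by rewrite prodr_const card_ord.
  - exact: measurable_itv.
  rewrite lebesgue_measure_itv/= lte_fin.
  by rewrite (_ : -1 < 1 :> R) ?gtrN// -EFinB opprK.
apply: (@le_lt_trans _ _ (2 ^+ n.+1)%:E); last exact: ltry.
by rewrite -lbox; apply: le_measure; rewrite ?inE//; exact: measurable_ball1.
Qed.

Lemma lebesgue_ball1_gt0 : (0 < lam n.+1 ball1)%E.
Proof.
(* n + 1 squares of numbers in [0, c] have a sum of at most (n + 1) c = 1 *)
pose c : R := n.+1%:R^-1.
have c0 : 0 < c by rewrite invr_gt0.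
have sub : rv_box (fun=> `[(0 : R), c]%classic) `<=` ball1.
  move=> v vc; rewrite /euclidean_ball/= -(sqrtr1 R) ler_sqrt// ?ler01//.
  apply: (@le_trans _ _ (\sum_(i < n.+1) c)); last first.
    by rewrite sumr_const card_ord -mulr_natl divff// pnatr_eq0.
  apply: ler_sum => i _; have := vc i; rewrite /= in_itv/= => /andP[v0 vc1].
  have v1 : v ord0 i <= 1 by apply: le_trans vc1 _; rewrite invf_le1// ler1n.
  by rewrite expr2; exact: le_trans (ler_piMr v0 v1) vc1.
have mbox : measurable (rv_box (fun=> `[(0 : R), c]%classic) : set 'rV[R]_n.+1).
  by apply: measurable_rv_box => i; exact: measurable_itv.
have lbox : lam n.+1 (rv_box (fun=> `[(0 : R), c]%classic)) = (c ^+ n.+1)%:E.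
  rewrite (@lebesgue_rV_box R n.+1 _ (fun=> c)) => [|i|i].
  - by rewrite prodr_const card_ord.
  - exact: measurable_itv.
  by rewrite lebesgue_measure_itv/= lte_fin c0 -EFinB subr0.
apply: (@lt_le_trans _ _ (c ^+ n.+1)%:E); first by rewrite lte_fin exprn_gt0.
by rewrite -lbox; apply: le_measure; rewrite ?inE//; exact: measurable_ball1.
Qed.

Lemma riem_volume_euclidean B : measurable B -> riem_volume eucl B = lam n.+1 B.
Proof.
move=> mB; rewrite /riem_volume /euclidean_metric.
under eq_integral do rewrite det1 sqrtr1.
by rewrite integral_cst// mul1e.
Qed.

(** The punctured ball is the disjoint union of the cones over the pieces of
   any decomposition of the sphere, so that all decompositions give the same
   area. *)
Lemma is_riem_area_sphere A : is_riem_area eucl sphere A ->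
  A = ((n.+1%:R)%:E * lam n.+1 ball1)%E.
Proof.
move=> [U [D [p [Hp HD tD uD ->]]]].
pose C k := cone_map (p k) @` cone_set (D k).
have CE k := lebesgue_cone (Hp k) (HD k).1 (HD k).2.
have dom k v : cone_set (D k) v -> cone_dom (U k) v.
  by move=> [/andP[v0 _] Dv]; split => //; exact: (HD k).2.
have ballE : ball1 = \bigcup_k C k `|` [set 0].
  apply/seteqP; split => [w|w [[k _ [v Cv <-]]| ->]].
  - rewrite /euclidean_ball/= -/(enorm w) => w1.
    have [->|w0] := eqVneq w 0; first by right.
    left; have t0 := enorm_gt0 w0; set t := enorm w in w1 t0.
    have : sphere (t^-1 *: w).
      by rewrite /euclidean_sphere/= -/(enorm _) enormZ ?invr_ge0 ?ltW// mulVf// gt_eqF.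
    rewrite -uD => -[k _ [u Du pu]]; exists k => //.
    exists (rv_cons ((t : measurableTypeR R), u)).
      by rewrite /cone_set/= rv_cons0 rv_tail_cons/= t0.
    by rewrite /cone_map rv_cons0 rv_tail_cons pu/= scalerA divff ?gt_eqF// scale1r.
  - rewrite /euclidean_ball/= -/(enorm _) (enorm_cone_map (Hp k)); last exact: dom.
    by have [/andP[]] := Cv.
  - by rewrite /euclidean_ball/= -/(enorm _) enorm0.
have tC : trivIset setT C.
  move=> i j _ _ [_ [[v Cv <-] [w Cw e]]].
  have e0 : v ord0 ord0 = w ord0 ord0.
    rewrite -(enorm_cone_map (Hp i) (dom _ _ Cv)) -e.
    by rewrite (enorm_cone_map (Hp j) (dom _ _ Cw)).
  apply: tD => //; exists (p i (rv_tail v)); split.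
    by exists (rv_tail v) => //; case: Cv.
  exists (rv_tail w); first by case: Cw.
  have [v0 _] := dom _ _ Cv.
  move: e; rewrite /cone_map -e0 => /(congr1 (fun x => (v ord0 ord0)^-1 *: x)).
  by rewrite !scalerA mulVf ?gt_eqF// !scale1r.
have mC : measurable (\bigcup_k C k).
  by apply: bigcupT_measurable => k; have [] := CE k.
rewrite ballE measureU0//; [|exact: measurable_rv_set1|exact: lebesgue_rV_set1].
rewrite measure_semi_bigcup//; last by move=> k; have [] := CE k.
have -> : (\sum_(k <oo) lam n.+1 (C k) = \sum_(k <oo)
    (n.+1%:R^-1)%:E * param_area eucl (D k) (p k))%E.
  by apply: eq_eseriesr => k _; exact: (CE k).2.
rewrite nneseriesZl; last by move=> k _; apply: integral_ge0 => u _; rewrite lee_fin sqrtr_ge0.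
by rewrite muleA -EFinM divff ?pnatr_eq0// mul1e.
Qed.

End sphere_area.

(** * Stereographic charts of the sphere *)

Section stereographic.
Context (R : realType) (n : nat).
Local Notation lam := (lebesgue_rV R).
Local Notation eucl := (@euclidean_metric R n.+1).
Implicit Types u d : 'rV[R]_n.

(** The conformal factor 2 / (1 + |u|^2) of stereographic projection. *)
Definition stereo_factor u : R := 2 * (\sum_i u ord0 i * u ord0 i + 1)^-1.

(** Inverse stereographic projection from the pole (e, 0), for e = 1 or -1. *)
Definition stereo (e : R) u : 'rV[R]_n.+1 :=
  rv_cons (e * (1 - stereo_factor u) : measurableTypeR R, stereo_factor u *: u).

Lemma stereo_den_gt0 u : 0 < \sum_i u ord0 i * u ord0 i + 1.
Proof. by rewrite ltr_wpDl// sumr_ge0// => i _; rewrite -expr2 sqr_ge0. Qed.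

Lemma stereo_factor_gt0 u : 0 < stereo_factor u.
Proof. by rewrite mulr_gt0// invr_gt0 stereo_den_gt0. Qed.

Lemma sqr_stereo_factor u :
  stereo_factor u ^+ 2 * (u *m u^T) ord0 ord0 = 2 * stereo_factor u - stereo_factor u ^+ 2.
Proof.
have q0 := stereo_den_gt0 u; rewrite mulmx_trE /stereo_factor.
under [X in _ * X = _]eq_bigr do rewrite expr2.
move: q0; set q := \sum_i _ => q0; have : q + 1 != 0 by rewrite gt_eqF.
by move=> ?; field.
Qed.

Lemma is_diff_stereo_factor u : is_diff u stereo_factor
  (fun d : 'rV[R]_n => - stereo_factor u ^+ 2 * (d *m u^T) ord0 ord0).
Proof.
have Hq : is_diff u (fun w : 'rV[R]_n => \sum_i w ord0 i * w ord0 i)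
    (fun d => \sum_i (u ord0 i * d ord0 i + u ord0 i * d ord0 i)).
  by apply: is_diff_sum => i; apply: is_diff_mul; exact: is_diff_coord.
have phi : is_derive (\sum_i u ord0 i * u ord0 i) 1 (fun t : R => 2 * (t + 1)^-1)
    (- stereo_factor u ^+ 2 / 2).
  have q0 : \sum_i u ord0 i * u ord0 i + 1 != 0 by rewrite gt_eqF// stereo_den_gt0.
  rewrite /stereo_factor; set q := \sum_i _ in q0 *.
  have D1 : is_derive q 1 (fun t : R => t + 1) 1 by exact: is_derive_shift.
  have D2 : is_derive q 1 (fun t : R => (t + 1)^-1) (- (q + 1) ^- 2 *: 1).
    apply: DeriveDef.
      by apply: (@derivableV _ _ (fun t : R => t + 1)) => //; have [] := D1.
    have [Dd Ed] := D1.
    by rewrite (@deriveV _ _ (fun t : R => t + 1) q 1 q0 Dd) Ed.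
  have D3 : is_derive q 1 (fun t : R => 2 * (t + 1)^-1) (2 *: (- (q + 1) ^- 2 *: 1)).
    exact: (is_deriveZ 2 D2).
  apply: (is_derive_eq D3); rewrite /GRing.scale/=; field; exact: q0.
have := is_diff_comp1 phi Hq.
congr (is_diff_def _ _ _); apply/funext => d.
rewrite big_split/= -mulr2n -mulr_natl mxE.
under [in RHS]eq_bigr do rewrite mxE mulrC.
by field.
Qed.

Lemma is_diff_affine (V : normedModType R) (f df : V -> R) (a b : R) x :
  is_diff x f df -> is_diff x (fun v => a + b * f v) (fun d : V => b * df d).
Proof.
move=> Hf; have := is_diffD (is_diff_const a x) (is_diff_mul (is_diff_const b x) Hf).
congr (is_diff_def _ _ _); apply/funext => v.
by rewrite -[LHS]/(0 + (b * df v + f x * 0)) mulr0 addr0 add0r.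
Qed.

Definition stereo_jac (e : R) u : 'M[R]_(n, n.+1) :=
  row_mx ((e * stereo_factor u ^+ 2) *: u^T)
    ((stereo_factor u)%:M - stereo_factor u ^+ 2 *: (u^T *m u)).

Lemma is_diff_stereo (e : R) u :
  is_diff u (stereo e) (fun d : 'rV[R]_n => d *m stereo_jac e u).
Proof.
have Hc := is_diff_stereo_factor u.
apply/is_diff_rvP => j; case: (unliftP ord0 j) => [k ->|->].
  have := is_diff_mul Hc (is_diff_coord u ord0 k).
  rewrite (_ : (fun w : 'rV[R]_n => stereo_factor w * _) =
      fun w => stereo e w ord0 (lift ord0 k)); last first.
    by apply/funext => w; rewrite /stereo rv_consS mxE.
  congr (is_diff_def _ _ _); apply/funext => d.
  rewrite (_ : lift ord0 k = rshift 1 k); last exact/val_inj.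
  rewrite /stereo_jac (@mul_mx_row _ 1 n 1 n).
  rewrite [RHS](@row_mxEr _ 1 1 n) mulmxBr mul_mx_scalar -scalemxAr mulmxA.
  rewrite [d *m u^T]mx11_scalar mul_scalar_mx !mxE.
  by rewrite mulr1n; ring.
have := is_diff_affine e (- e) Hc.
rewrite (_ : (fun w : 'rV[R]_n => e + _) = fun w => stereo e w ord0 ord0); last first.
  by apply/funext => w; rewrite /stereo rv_cons0/=; ring.
congr (is_diff_def _ _ _); apply/funext => d.
rewrite (_ : (ord0 : 'I_n.+1) = lshift n (ord0 : 'I_1)); last exact/val_inj.
rewrite /stereo_jac (@mul_mx_row _ 1 n 1 n).
by rewrite [RHS](@row_mxEl _ 1 1 n) -scalemxAr [in RHS]mxE; ring.
Qed.

(** Inverse stereographic projection is conformal. *)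
Lemma stereo_gram (e : R) u : e ^+ 2 = 1 ->
  stereo_jac e u *m (stereo_jac e u)^T = (stereo_factor u ^+ 2)%:M.
Proof.
move=> e1; have := sqr_stereo_factor u; rewrite /stereo_jac.
set c := stereo_factor u => cq; set W := u^T *m u.
have WT : W^T = W by rewrite /W trmx_mul trmxK.
have WW : W *m W = (u *m u^T) ord0 ord0 *: W.
  rewrite /W mulmxA -(mulmxA u^T u u^T) [u *m u^T]mx11_scalar mul_mx_scalar.
  by rewrite -scalemxAl [in RHS]mxE mulr1n.
have T1 (k : R) : (k *: u^T) *m (k *: u^T)^T = (k * k) *: W.
  by rewrite linearZ/= trmxK -scalemxAr -scalemxAl scalerA.
have BT : (c%:M - c ^+ 2 *: W)^T = c%:M - c ^+ 2 *: W.
  by rewrite linearB/= linearZ/= tr_scalar_mx WT.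
set q : R := (u *m u^T) ord0 ord0 in cq WW.
have BB : (c%:M - c ^+ 2 *: W) *m (c%:M - c ^+ 2 *: W) =
    (c ^+ 2)%:M + (c ^+ 2 * c ^+ 2 * q - 2 * c ^+ 3) *: W.
  rewrite mulmxBl !mulmxBr -!scalemxAr -!scalemxAl WW.
  rewrite -scalar_mxM -expr2 mul_mx_scalar mul_scalar_mx !scalerA.
  rewrite -addrA; congr (_ + _).
  by rewrite -scalerBl -scaleNr -scalerBl; congr (_ *: _); ring.
rewrite (@tr_row_mx _ n 1 n) (@mul_row_col _ n 1 n n) T1 BT BB addrCA -scalerDl.
rewrite [X in X *: W](_ : _ = 0) ?scale0r ?addr0//.
rewrite (_ : e * c ^+ 2 * (e * c ^+ 2) = e ^+ 2 * (c ^+ 2) ^+ 2); last by ring.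
have -> : c ^+ 2 * c ^+ 2 * q = c ^+ 2 * (2 * c - c ^+ 2) by rewrite -cq mulrA.
by rewrite e1; ring.
Qed.

Lemma continuous_stereo_factor u : {for u, continuous stereo_factor}.
Proof. by apply: differentiable_continuous; have [] := is_diff_stereo_factor u. Qed.

Lemma class_C1_stereo (e : R) : class_C 1 setT (stereo e).
Proof.
apply: (@class_C1P _ _ _ _ _ (stereo_jac e) openT) => u _.
  exact: is_diff_stereo.
have cc := continuous_stereo_factor (u := u).
have c2 : {for u, continuous (fun w => stereo_factor w ^+ 2)}.
  exact: exprn_continuous_at.
apply: mx_continuousP => i j; case: (unliftP ord0 j) => [k ->|->].
  rewrite (_ : (fun t => _) = fun t : 'rV[R]_n => stereo_factor t *+ (i == k) -
      stereo_factor t ^+ 2 * (t ord0 i * t ord0 k)).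
    apply: continuousB.
      rewrite (_ : (fun t => _) = fun t => stereo_factor t * (i == k)%:R).
        by apply: continuousM => //; exact: cst_continuous.
      by apply/funext => t; rewrite mulr_natr.
    by apply: continuousM => //; apply: continuousM; exact: coord_continuous.
  apply/funext => t; rewrite /stereo_jac (_ : lift ord0 k = rshift 1 k); last exact/val_inj.
  by rewrite [LHS](@row_mxEr _ n 1 n) !mxE big_ord1 !mxE.
rewrite (_ : (fun t => _) = fun t : 'rV[R]_n => e * stereo_factor t ^+ 2 * t ord0 i).
  apply: continuousM; last exact: coord_continuous.
  by apply: continuousM => //; exact: cst_continuous.
apply/funext => t; rewrite /stereo_jac (_ : (ord0 : 'I_n.+1) = lshift n (ord0 : 'I_1)); last exact/val_inj.
by rewrite [LHS](@row_mxEl _ n 1 n) !mxE.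
Qed.

Lemma jacobian_stereo (e : R) u : 'J (stereo e) u = stereo_jac e u.
Proof. exact: is_diff_jacobianE (is_diff_stereo e u). Qed.

Lemma mulmx_tr_rv_cons (t : R) u :
  (rv_cons (t : measurableTypeR R, u) *m (rv_cons (t : measurableTypeR R, u))^T) ord0 ord0 =
  t ^+ 2 + (u *m u^T) ord0 ord0.
Proof.
rewrite !mulmx_trE big_ord_recl rv_cons0/=; congr (_ + _).
by apply: eq_bigr => i _; rewrite rv_consS.
Qed.

Lemma stereo_sphere (e : R) u : e ^+ 2 = 1 -> @euclidean_sphere R n.+1 (stereo e u).
Proof.
move=> e1; apply/sphereP; rewrite [LHS]mx11_scalar; congr (_%:M).
rewrite /stereo mulmx_tr_rv_cons.
have -> (k : R) : ((k *: u) *m (k *: u)^T) ord0 ord0 = k ^+ 2 * (u *m u^T) ord0 ord0.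
  by rewrite linearZ/= -scalemxAr -scalemxAl scalerA mxE.
by rewrite sqr_stereo_factor exprMn e1; ring.
Qed.

Lemma stereo_inj (e : R) : e != 0 -> injective (stereo e).
Proof.
move=> e0 u w; rewrite /stereo => E.
have E0 : stereo_factor u = stereo_factor w.
  have := congr1 (fun v : 'rV[R]_n.+1 => v ord0 ord0) E; rewrite !rv_cons0/=.
  by move/(mulfI e0) => H; apply: oppr_inj; apply: (addrI 1).
have := congr1 (@rv_tail R n) E; rewrite !rv_tail_cons/= E0.
move=> /(congr1 (fun x => (stereo_factor w)^-1 *: x)).
by rewrite !scalerA mulVf ?scale1r// gt_eqF// stereo_factor_gt0.
Qed.

Lemma local_param_stereo (e : R) : e ^+ 2 = 1 ->
  local_param (@euclidean_sphere R n.+1) setT (stereo e).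
Proof.
move=> e1; have e0 : e != 0 by rewrite -sqrf_eq0 e1 oner_eq0.
split.
- exact: openT.
- exact: class_C1_stereo.
- by move=> u w _ _; exact: stereo_inj.
- by move=> _ [u _ <-]; exact: stereo_sphere.
move=> u _; rewrite jacobian_stereo.
apply: (@unit_row_free_mul _ _ _ _ _ (stereo_jac e u)^T).
rewrite stereo_gram// row_free_unit unitmxE det_scalar unitfE expf_neq0//.
by rewrite expf_neq0// gt_eqF// stereo_factor_gt0.
Qed.

Lemma stereo_onto (y : 'rV[R]_n.+1) : @euclidean_sphere R n.+1 y ->
  y ord0 ord0 != 1 -> exists u, stereo 1 u = y.
Proof.
move=> /sphereP/matrixP/(_ ord0 ord0); rewrite (rv_etaE y) !rv_cons0/=.
set t := y ord0 ord0; set w := rv_tail y; rewrite mulmx_tr_rv_cons [in X in _ = X -> _]mxE mulr1n.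
move=> tw t1; have c0 : 1 - t != 0 by rewrite subr_eq0 eq_sym.
exists ((1 - t)^-1 *: w).
have cE : stereo_factor ((1 - t)^-1 *: w) = 1 - t.
  rewrite /stereo_factor.
  have -> : \sum_i ((1 - t)^-1 *: w) ord0 i * ((1 - t)^-1 *: w) ord0 i =
     (1 - t)^-1 ^+ 2 * (1 - t ^+ 2).
    rewrite -tw [t ^+ 2 + _]addrC addrK mulmx_trE mulr_sumr.
    by apply: eq_bigr => i _; rewrite mxE -expr2 exprMn.
  have tpos : (1 - t) ^- 2 * (1 - t ^+ 2) + 1 = 2 / (1 - t) by field.
  by rewrite -exprVn in tpos; rewrite tpos; field.
rewrite /stereo cE mul1r subKr scalerA divff// scale1r.
by [].
Qed.

(** Inverse stereographic projection from one pole covers all but that pole,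
   which is the value at 0 of the projection from the other pole. *)
Definition stereo_domain (k : nat) : set 'rV[R]_n :=
  match k with 0 => setT | 1 => [set 0] | _ => set0 end.

Definition stereo_chart (k : nat) : 'rV[R]_n -> 'rV[R]_n.+1 :=
  if k is 0%N then stereo 1 else stereo (- 1).

Lemma stereo_pole : stereo (- 1) 0 = rv_cons (1 : measurableTypeR R, 0).
Proof.
have c0 : stereo_factor 0 = 2.
  by rewrite /stereo_factor big1 ?add0r ?invr1 ?mulr1// => i _; rewrite mxE mul0r.
by rewrite /stereo c0 scaler0; congr (rv_cons (_, _)); ring.
Qed.

Lemma is_riem_area_stereo :
  is_riem_area eucl (@euclidean_sphere R n.+1)
    (\sum_(0 <= k <oo) param_area eucl (stereo_domain k) (stereo_chart k))%E.
Proof.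
exists (fun=> setT), stereo_domain, stereo_chart; split => //.
- by case=> [|k]; apply: local_param_stereo; rewrite ?expr1n ?sqrrN ?expr1n.
- by case=> [|[|k]]; split => //=; exact: measurable_rv_set1.
- have npole u : stereo 1 u ord0 ord0 != 1.
    rewrite /stereo rv_cons0/= mul1r -subr_eq0 addrAC subrr add0r oppr_eq0.
    by rewrite gt_eqF// stereo_factor_gt0.
  move=> [|[|i]] [|[|j]] _ _ //= [y [[u Du <-] [w Dw e]]] //.
    by have := npole u; rewrite -e Dw stereo_pole rv_cons0 eqxx.
  by have := npole w; rewrite e Du stereo_pole rv_cons0 eqxx.
apply/seteqP; split => [_ [k _ [u _ <-]]|y Sy].
  by case: k => [|k]; apply: stereo_sphere; rewrite ?expr1n ?sqrrN ?expr1n.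
have [y1|y1] := eqVneq (y ord0 ord0) 1; last first.
  by have [u <-] := stereo_onto Sy y1; exists 0%N => //; exists u.
exists 1%N => //; exists 0 => //; rewrite /= stereo_pole (rv_etaE y) y1.
congr (rv_cons (_, _)); apply/esym; apply: mulmx_tr_eq0.
move: Sy => /sphereP/matrixP/(_ ord0 ord0).
rewrite {1 2}(rv_etaE y) mulmx_tr_rv_cons y1 expr1n [in X in _ = X -> _]mxE mulr1n.
by rewrite -[X in _ = X -> _]addr0 => /addrI.
Qed.

End stereographic.

(** * The values for the unit sphere and the unit disc *)

Lemma area_unit_sphereE (R : realType) n :
  area_unit_sphere R n.+1 =
    (n.+1%:R%:E * lebesgue_rV R n.+1 (@euclidean_ball R n.+1))%E.
Proof.
apply: is_riem_area_sphere.
exact: (xgetI (P := is_riem_area _ _) 0%E (is_riem_area_stereo R n)).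
Qed.

Lemma volume_unit_ballE (R : realType) n :
  volume_unit_ball R n.+1 = lebesgue_rV R n.+1 (@euclidean_ball R n.+1).
Proof. by apply: riem_volume_euclidean; exact: measurable_ball1. Qed.

Section disc.
Context (R : realType).
Local Notation mu := (@lebesgue_measure R).

Lemma sqrt_det_stereo n (e : R) (u : 'rV[R]_n) : e ^+ 2 = 1 ->
  Num.sqrt (\det (induced_metric (@euclidean_metric R n.+1) (stereo e) u)) =
  stereo_factor u ^+ n.
Proof.
move=> e1; rewrite /induced_metric jacobian_stereo mulmx1 stereo_gram// det_scalar.
by rewrite exprAC sqrtr_sqr ger0_norm// exprn_ge0// ltW// stereo_factor_gt0.
Qed.

Lemma integral_stereo_factor :
  (\int[lebesgue_rV R 1]_u (stereo_factor u)%:E = (2 * pi)%:E)%E.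
Proof.
have m0 : measurable_fun setT (fun u : 'rV[R]_1 => (stereo_factor u)%:E).
  apply/measurable_EFinP.
  apply: (@continuous_measurable_rv _ _ setT) => //; first exact: openT.
  by move=> u _; exact: continuous_stereo_factor.
apply: etrans (integral_rVS m0 _) _.
  by move=> u; rewrite lee_fin ltW// stereo_factor_gt0.
have fE t : stereo_factor (rv_cons (t : measurableTypeR R, 0 : 'rV[R]_0)) =
    2 * (oneDsqr t)^-1.
  by rewrite /stereo_factor /oneDsqr big_ord1 rv_cons0/= -expr2 addrC.
have v0 (v : 'rV[R]_0) : v = 0 by apply/rowP => -[].
pose g (z : measurableTypeR R * 'rV[R]_0) : \bar R :=
  ((2 * (oneDsqr z.1)^-1)%:E * cst 1%E z.2)%E.
apply: (@etrans _ _ (\int[mu \x lebesgue_rV R 0]_z g z)%E).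
  apply: eq_integral.
  rewrite /g; by move=> [t v] _; rewrite [in LHS](v0 v) fE mule1.
have mo : measurable_fun setT (fun t : measurableTypeR R => (2 * (oneDsqr t)^-1)%:E).
  apply/measurable_EFinP; apply: measurable_funM => //.
  by apply: continuous_measurable_fun; exact: continuous_oneDsqrV.
apply: etrans (integral_prod_mul mu (lebesgue_rV R 0) mo _ _ _) _ => //.
rewrite integral_cst//= diracT !mul1e mule1.
rewrite ge0_symfun_integralT//=; last 2 first.
- by move=> t; apply: cvgM; [exact: cvg_cst|exact: continuous_oneDsqrV].
- by move=> t /=; rewrite /oneDsqr sqrrN.
rewrite (_ : [set x | _] = `[0, +oo[%classic); last first.
  by apply/seteqP; split => t /=; rewrite in_itv/= andbT.
under eq_integral do rewrite EFinM.
rewrite ge0_integralZl_EFin//; last first.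
  apply/measurable_EFinP; apply: measurable_funTS.
  by apply: continuous_measurable_fun; exact: continuous_oneDsqrV.
by rewrite integral0y_oneDsqr -!EFinM; congr EFin; field.
Qed.

(** The pole left out by the first chart contributes nothing to the length of
   the circle, which is twice the area of the disc. *)
Lemma lebesgue_disc : lebesgue_rV R 2 (@euclidean_ball R 2) = pi%:E.
Proof.
have := is_riem_area_sphere (is_riem_area_stereo R 1).
rewrite nneseries_recl//; last first.
  by move=> k _; apply: integral_ge0 => u _; rewrite lee_fin sqrtr_ge0.
rewrite eseries0 => [|[|[|k]] // _ _]; last 2 first.
- rewrite /param_area; apply: null_set_integral => //=.
  + exact: measurable_rv_set1.
  + exact: measurable_fun_set1.
  + exact: lebesgue_rV_set1.
- exact: integral_set0.
rewrite adde0 (_ : param_area _ _ _ = (2 * pi)%:E); last first.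
  rewrite -integral_stereo_factor; apply: eq_integral => u _.
  by rewrite /stereo_chart sqrt_det_stereo ?expr1n.
have [b bE] : exists b : R, lebesgue_rV R 2 (@euclidean_ball R 2) = b%:E.
  exists (fine (lebesgue_rV R 2 (@euclidean_ball R 2))); rewrite fineK//.
  by rewrite ge0_fin_numE// lebesgue_ball1_fin.
rewrite bE -EFinM => -[/(mulfI _) ->] //.
Qed.

End disc.

(** * Change of metric by a diffeomorphism *)

Section posdef.
Context (R : realType).

(** Cholesky decomposition, by induction on the size: the Schur complement of
   the corner of a positive definite matrix is positive definite. *)
Lemma posdef_factor n (a : 'M[R]_n) : posdef a ->
  exists2 P : 'M[R]_n, P \in unitmx & a = P *m P^T.
Proof.
elim: n a => [|n IH] a.
  move=> _; exists 1%:M; first by rewrite unitmx1.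
  by apply/matrixP => -[].
rewrite -[a](@submxK _ 1 n 1 n); set al := ulsubmx _; set b := ursubmx _.
set b' := dlsubmx _; set D := drsubmx _; rewrite [al]mx11_scalar.
set s := al ord0 ord0; move=> [].
rewrite (@tr_block_mx _ 1 n 1 n) => /(@eq_block_mx _ 1 n 1 n)[_ b'E bE DT] pos.
have b'b : b' = b^T by rewrite -bE.
rewrite b'b in pos *.
have s0 : 0 < s.
  have v0 : row_mx 1%:M 0 != 0 :> 'rV[R]_n.+1.
    apply/eqP => /(congr1 (@lsubmx _ 1 1 n)); rewrite row_mxKl linear0.
    by move/matrixP/(_ ord0 ord0)/eqP; rewrite !mxE oner_eq0.
  have := pos _ v0.
  rewrite (@mul_row_block _ 1 1 n 1 n) (@tr_row_mx _ 1 1 n) (@mul_row_col _ 1 1 n 1).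
  by rewrite !mul0mx !addr0 !mul1mx trmx1 mulmx1 trmx0 mulmx0 addr0 mxE mulr1n.
(* the value of the Schur complement at w is that of a at (- s^-1 w b^T, w) *)
have [|Q uQ QE] := IH (D - s^-1 *: (b^T *m b)).
  split; first by rewrite linearB/= linearZ/= trmx_mul trmxK DT.
  move=> w w0; pose t : 'M[R]_1 := - s^-1 *: (w *m b^T).
  have v0 : row_mx t w != 0 :> 'rV[R]_n.+1.
    by apply: contra_neq w0 => /(congr1 (@rsubmx _ 1 1 n)); rewrite row_mxKr linear0.
  have := pos _ v0.
  rewrite (@mul_row_block _ 1 1 n 1 n) (@tr_row_mx _ 1 1 n) (@mul_row_col _ 1 1 n 1).
  rewrite [t *m s%:M]mul_mx_scalar {1}/t scalerA mulrN divff ?gt_eqF// scaleN1r.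
  rewrite addNr mul0mx add0r.
  rewrite (_ : t *m b + w *m D = w *m (D - s^-1 *: (b^T *m b)))//.
  by rewrite /t -scalemxAl scaleNr mulmxBr -scalemxAr mulmxA addrC.
pose r := Num.sqrt s; have r0 : 0 < r by rewrite sqrtr_gt0.
have rs : r * r = s by rewrite -expr2 sqr_sqrtr// ltW.
exists (block_mx (r%:M : 'M[R]_1) 0 (r^-1 *: b^T) Q : 'M[R]_n.+1).
  rewrite unitmxE (@det_lblock R 1 n) det_scalar1 unitrM -unitmxE uQ andbT.
  by rewrite unitfE gt_eqF.
rewrite (@tr_block_mx _ 1 n 1 n) (@mulmx_block _ 1 n 1 n 1 n) trmx0 !mulmx0 !mul0mx !addr0.
have -> : (r%:M : 'M[R]_1) *m (r%:M)^T = s%:M by rewrite tr_scalar_mx -scalar_mxM rs.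
have -> : (r%:M : 'M[R]_1) *m (r^-1 *: b^T)^T = b.
  by rewrite linearZ/= trmxK mul_scalar_mx scalerA divff ?gt_eqF// scale1r.
have -> : (r^-1 *: b^T) *m (r%:M : 'M[R]_1)^T = b^T.
  by rewrite tr_scalar_mx mul_mx_scalar scalerA divff ?gt_eqF// scale1r.
congr (@block_mx _ 1 n 1 n _ _ _ _); rewrite -QE linearZ/= trmxK -scalemxAl -scalemxAr scalerA -invfM rs.
by rewrite addrC subrK.
Qed.

End posdef.

Section pullback.
Context (R : realType) (n : nat).
Local Notation lam := (lebesgue_rV R).
Local Notation eucl := (@euclidean_metric R n.+1).
Implicit Types (H W V : set 'rV[R]_n.+1) (f g : 'rV[R]_n.+1 -> 'rV[R]_n.+1).

(** The chain rule, g o f being the identity near y. *)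
Lemma jacobian_inverse W V f g y : open W -> open V ->
  class_C 1 W f -> class_C 1 V g -> (forall x, W x -> V (f x)) ->
  (forall x, W x -> g (f x) = x) -> W y -> 'J f y *m 'J g (f y) = 1%:M.
Proof.
move=> oW oV Cf Cg fWV gf Wy.
have [Df _] := class_C1_is_diff Cf Wy; have [Dg _] := class_C1_is_diff Cg (fWV _ Wy).
rewrite -(jacobian_comp Df Dg); apply/row_matrixP => i.
rewrite !rowE -deriveEjacobian; last exact: differentiable_comp.
transitivity ('D_(delta_mx ord0 i) (fun x : 'rV[R]_n.+1 => x) y).
  apply: near_eq_derive.
  by apply: filterS (open_nbhs_nbhs (conj oW Wy)) => w Ww; exact: gf.
by rewrite derive_id mulmx1.
Qed.

Lemma local_param_comp W H H' U (p : 'rV[R]_n -> 'rV[R]_n.+1) f :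
  open W -> class_C 1 W f -> set_inj W f -> (forall y, W y -> 'J f y \in unitmx) ->
  H `<=` W -> f @` H `<=` H' ->
  local_param H U p -> local_param H' U (fun u => f (p u)).
Proof.
move=> oW Cf injf uJ HW fH [oU Cp injp pH fp].
have pW u : U u -> W (p u) by move=> Uu; apply: HW; apply: pH; exists u.
split.
- exact: oU.
- exact: class_C1_comp oU oW Cp Cf pW.
- move=> u v Uu Uv e; apply: injp => //; apply: injf => //.
    by apply/mem_set/pW/set_mem.
  by apply/mem_set/pW/set_mem.
- by move=> _ [u Uu <-]; apply: fH; exists (p u) => //; apply: pH; exists u.
move=> u Uu; have [Dp _] := class_C1_is_diff Cp Uu.
have [Df _] := class_C1_is_diff Cf (pW _ Uu).
rewrite (jacobian_comp Dp Df) /row_free mxrankMfree; first exact: fp.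
by rewrite row_free_unit; exact: uJ (pW _ Uu).
Qed.

(** Composition with f keeps the parametrizations immersive, and the pieces
   stay disjoint because f is injective. *)
Lemma decomposition_comp W H f (U D : (set 'rV[R]_n)^nat)
    (p : ('rV[R]_n -> 'rV[R]_n.+1)^nat) (g : 'rV[R]_n.+1 -> 'M[R]_n.+1) :
  open W -> class_C 1 W f -> set_inj W f -> (forall y, W y -> 'J f y \in unitmx) ->
  H `<=` W ->
  (forall k, local_param H (U k) (p k)) ->
  (forall k, measurable (D k) /\ D k `<=` U k) ->
  trivIset setT (fun k => p k @` D k) -> \bigcup_k (p k @` D k) = H ->
  is_riem_area g (f @` H)
    (\sum_(0 <= k <oo) param_area g (D k) (fun u => f (p k u)))%E.
Proof.
move=> oW Cf injf uJ HW Hp HD tD cD; exists U, D, (fun k u => f (p k u)).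
have pW k u : D k u -> W (p k u).
  by move=> Du; apply: HW; rewrite -cD; exists k => //; exists u.
split; last by [].
- by move=> k; apply: (local_param_comp oW Cf injf uJ HW _ (Hp k)).
- exact: HD.
- move=> i j _ _ [_ [[u Du <-] [v Dv e]]]; apply: tD => //; exists (p i u).
  split; first by exists u.
  by exists v => //; apply: injf => //; apply/mem_set; apply: pW; eassumption.
rewrite -cD; apply/seteqP; split.
  by move=> _ [k _ [u Du <-]]; exists (p k u) => //; exists k => //; exists u.
by move=> _ [_ [k _ [u Du <-]] <-]; exists k => //; exists u.
Qed.

(** If the metric g is c^2 times the pull-back of the Euclidean one under f,
   lengths along a hypersurface H are c times those along f(H), hence areas
   are c^n times as large. *)
Lemma is_riem_area_pullback W H f (g : 'rV[R]_n.+1 -> 'M[R]_n.+1) (c : R) A :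
  open W -> class_C 1 W f -> set_inj W f -> (forall y, W y -> 'J f y \in unitmx) ->
  H `<=` W -> 0 <= c ->
  (forall y, H y -> g y = c ^+ 2 *: ('J f y *m ('J f y)^T)) ->
  is_riem_area g H A ->
  exists2 B, is_riem_area eucl (f @` H) B & A = ((c ^+ n)%:E * B)%E.
Proof.
move=> oW Cf injf uJ HW c0 gE [U [D [p [Hp HD tD cD ->]]]].
have fp k : local_param (f @` H) (U k) (fun u => f (p k u)).
  exact: (local_param_comp oW Cf injf uJ HW _ (Hp k)).
eexists; first exact: (decomposition_comp _ oW Cf injf uJ HW Hp HD tD cD).
rewrite -nneseriesZl; last first.
  by move=> k _; apply: integral_ge0 => u _; rewrite lee_fin sqrtr_ge0.
apply: eq_eseriesr => k _; have [mD DU] := HD k.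
have [oU Cfp _ _ _] := fp k; have [_ Cp _ pH _] := Hp k.
rewrite /param_area.
have E u : U k u -> Num.sqrt (\det (induced_metric g (p k) u)) =
    c ^+ n * Num.sqrt (\det (induced_metric eucl (fun u => f (p k u)) u)).
  move=> Uu; have Hpu : H (p k u) by apply: pH; exists u.
  have [Dp _] := class_C1_is_diff Cp Uu.
  have [Df _] := class_C1_is_diff Cf (HW _ Hpu).
  rewrite /induced_metric (jacobian_comp Dp Df) gE// mulmx1.
  rewrite -scalemxAr -scalemxAl detZ trmx_mul !mulmxA.
  by rewrite sqrtrM ?exprn_ge0// exprAC sqrtr_sqr ger0_norm// exprn_ge0.
rewrite -ge0_integralZl_EFin//; last 2 first.
- apply/measurable_EFinP; apply: (continuous_measurable_rv oU) => //.
  move=> u Uu; apply: (@continuous_comp _ _ _ _ (@Num.sqrt R)); last exact: sqrt_continuous.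
  have cJ := jacobian_continuous oU Cfp Uu.
  apply: det_continuous_at; rewrite /induced_metric /euclidean_metric.
  apply: mulmx_continuous_at.
    by apply: mulmx_continuous_at => //; exact: cst_continuous.
  exact: trmx_continuous_at.
- by rewrite exprn_ge0.
apply: eq_integral => u /set_mem Du; rewrite -EFinM; congr EFin.
exact: E _ (DU _ Du).
Qed.

End pullback.

(** * Radial maps *)

Section radial.
Context (R : realType).

(** The block matrix with rows (1, -v) and (u^T, 1) factors into block
   triangular ones in two ways. *)
Lemma det_add1_rank1 n (u v : 'rV[R]_n) :
  \det (1%:M + u^T *m v) = 1 + (v *m u^T) ord0 ord0.
Proof.
have E1 : block_mx (1%:M : 'M[R]_1) (- v) u^T (1%:M : 'M[R]_n) =
    block_mx (1%:M : 'M[R]_1) 0 u^T 1%:M *m block_mx 1%:M (- v) 0 (1%:M + u^T *m v).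
  rewrite mulmx_block !mul1mx !mulmx1 !mul0mx !addr0.
  by rewrite mulmxN addrC addrK.
have E2 : block_mx (1%:M : 'M[R]_1) (- v) u^T (1%:M : 'M[R]_n) =
    block_mx (1%:M + v *m u^T : 'M[R]_1) (- v) 0 1%:M *m block_mx 1%:M 0 u^T 1%:M.
  rewrite mulmx_block !mul1mx !mulmx1 !mulmx0 !add0r.
  by rewrite mulNmx addrK.
have := congr1 (fun M => \det M) E1; rewrite E2 !det_mulmx !det_ublock !det_lblock.
by rewrite !det1 !mul1r !mulr1 det_mx11 !mxE mulr1n => <-.
Qed.

Definition radial n (q : R) (v : 'rV[R]_n) : 'rV[R]_n := (enorm v `^ q) *: v.

Definition radial_jac n (q : R) (v : 'rV[R]_n) : 'M[R]_n :=
  (enorm v `^ q) *: (1%:M + (q / enorm v ^+ 2) *: (v^T *m v)).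

Lemma enorm_neq0 n (v : 'rV[R]_n) : v != 0 -> enorm v != 0.
Proof. by move=> v0; rewrite gt_eqF// enorm_gt0. Qed.

Lemma enorm_radial n q (v : 'rV[R]_n) : v != 0 ->
  enorm (radial q v) = enorm v `^ (q + 1).
Proof.
move=> v0; rewrite /radial enormZ ?powR_ge0// powRD ?powRr1 ?enorm_ge0//.
by rewrite (enorm_neq0 v0) implybT.
Qed.

Lemma radial_neq0 n q (v : 'rV[R]_n) : v != 0 -> radial q v != 0.
Proof.
by move=> v0; rewrite scaler_eq0 negb_or v0 andbT gt_eqF// powR_gt0// enorm_gt0.
Qed.

(** radial (h - 1) raises the norm to the power h and keeps directions. *)
Lemma radialK n (h k : R) (v : 'rV[R]_n) : h * k = 1 -> v != 0 ->
  radial (k - 1) (radial (h - 1) v) = v.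
Proof.
move=> hk v0; rewrite {1}/radial enorm_radial// subrK -powRrM /radial scalerA.
rewrite -powRD ?(enorm_neq0 v0) ?implybT//.
rewrite (_ : _ + _ = 0) ?powRr0 ?scale1r//.
by rewrite mulrBr hk mulr1 addrC -addrA addKr subrr.
Qed.

(** The Jacobian is a multiple of a rank one perturbation of the identity. *)
Lemma det_radial_jac n q (v : 'rV[R]_n) : v != 0 ->
  \det (radial_jac q v) = (enorm v `^ q) ^+ n * (1 + q).
Proof.
move=> v0; rewrite /radial_jac detZ.
have -> c : c *: (v^T *m v) = (c *: v)^T *m v by rewrite linearZ/= scalemxAl.
rewrite det_add1_rank1 linearZ/= -scalemxAr mxE -sqr_enorm divfK//.
by rewrite expf_neq0// enorm_neq0.
Qed.

Lemma is_diff_enorm_powR n q (v : 'rV[R]_n) : v != 0 ->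
  is_diff v (fun w : 'rV[R]_n => enorm w `^ q)
    (fun d : 'rV[R]_n => enorm v `^ q * (q / enorm v ^+ 2) * (d *m v^T) ord0 ord0).
Proof.
move=> v0; have e0 := enorm_gt0 v0.
have sE (w : 'rV[R]_n) : \sum_i w ord0 i * w ord0 i = enorm w ^+ 2.
  by rewrite sqr_enorm mulmx_trE; apply: eq_bigr => i _; rewrite expr2.
have pE (w : 'rV[R]_n) (r : R) : (enorm w ^+ 2) `^ r = enorm w `^ (2 * r).
  by rewrite -powR_mulrn ?enorm_ge0// -powRrM.
have Hs : is_diff v (fun w : 'rV[R]_n => \sum_i w ord0 i * w ord0 i)
    (fun d => \sum_i (v ord0 i * d ord0 i + v ord0 i * d ord0 i)).
  by apply: is_diff_sum => i; apply: is_diff_mul; exact: is_diff_coord.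
have s0 : 0 < \sum_i v ord0 i * v ord0 i by rewrite sE exprn_gt0.
have := is_diff_comp1 (is_derive1_powR (q / 2) s0) Hs.
rewrite (_ : (fun w : 'rV[R]_n => (\sum_i _) `^ _) = fun w => enorm w `^ q); last first.
  by apply/funext => w; rewrite sE pE mulrCA divff ?mulr1 ?pnatr_eq0.
congr (is_diff_def _ _ _); apply/funext => d.
rewrite sE pE (_ : 2 * (q / 2 - 1) = q - 2%:R); last by field.
rewrite powRB ?(enorm_neq0 v0) ?implybT// powR_mulrn ?enorm_ge0//.
rewrite big_split/= -mulr2n -mulr_natl mxE.
under [in RHS]eq_bigr do rewrite mxE mulrC.
by field; rewrite gt_eqF.
Qed.

Lemma is_diff_radial n q (v : 'rV[R]_n) : v != 0 ->
  is_diff v (radial q) (fun d : 'rV[R]_n => d *m radial_jac q v).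
Proof.
move=> v0; apply/is_diff_rvP => j.
have := is_diff_mul (is_diff_enorm_powR q v0) (is_diff_coord v ord0 j).
rewrite (_ : (fun w : 'rV[R]_n => _ * _) = fun w => radial q w ord0 j); last first.
  by apply/funext => w; rewrite /radial mxE.
congr (is_diff_def _ _ _); apply/funext => d.
rewrite /radial_jac -scalemxAr mulmxDr mulmx1 -scalemxAr mulmxA.
rewrite [d *m v^T]mx11_scalar mul_scalar_mx !mxE.
by rewrite !mulr1n; ring.
Qed.

Lemma open_nonzero n : open (@nonzero 'rV[R]_n).
Proof.
rewrite (_ : @nonzero _ = @enorm R n @^-1` [set r | 0 < r]).
  by apply: open_comp; [move=> v _; exact: enorm_continuous|exact: open_gt].
apply/seteqP; split => v /=; first exact: enorm_gt0.
by apply: contraTneq => ->; rewrite enorm0 ltxx.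
Qed.

Lemma class_C1_radial n q : class_C 1 (@nonzero _) (@radial n q).
Proof.
apply: (@class_C1P _ _ _ _ _ (radial_jac q) (@open_nonzero n)) => v v0.
  exact: is_diff_radial.
have ce (s : R) : {for v, continuous (fun w : 'rV[R]_n => enorm w `^ s)}.
  by apply: differentiable_continuous; have [] := is_diff_enorm_powR s v0.
apply: mx_continuousP => i j.
rewrite (_ : (fun t => _) = fun t : 'rV[R]_n => enorm t `^ q *
    ((1%:M : 'M[R]_n) i j + q * enorm t `^ (- 2%:R) * (t ord0 i * t ord0 j))).
  apply: continuousM => //; apply: continuousD; first exact: cst_continuous.
  apply: continuousM; last by apply: continuousM; exact: coord_continuous.
  by apply: continuousM => //; exact: cst_continuous.
apply/funext => t; rewrite /radial_jac powR_invn ?enorm_ge0//.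
by rewrite !mxE big_ord1 !mxE.
Qed.

End radial.

(** * Finsleroids of conformally Euclidean tangent spaces *)

Section finsleroid.
Context (R : realType) (n : nat).
Local Notation lam := (lebesgue_rV R).
Local Notation eucl := (@euclidean_metric R n.+1).
Local Notation sphere := (@euclidean_sphere R n.+1).
Local Notation ball1 := (@euclidean_ball R n.+1).
Local Notation nz := (@nonzero 'rV[R]_n.+1).
Variables (K : 'rV[R]_n.+1 -> R) (h : R) (z w : 'rV[R]_n.+1 -> 'rV[R]_n.+1).
Hypotheses (normK : finsler_norm K) (h0 : 0 < h).
Hypotheses (Cz : class_C 1 nz z) (Cw : class_C 1 nz w).
Hypothesis zK : forall y : 'rV[R]_n.+1, y != 0 -> z y != 0 /\ w (z y) = y.
Hypothesis wK : forall y : 'rV[R]_n.+1, y != 0 -> w y != 0 /\ z (w y) = y.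
Hypothesis zZ : forall (c : R) (y : 'rV[R]_n.+1), 0 < c -> y != 0 -> z (c *: y) = (c `^ h) *: z y.
Hypothesis z_unit : forall y : 'rV[R]_n.+1, y != 0 -> K y = 1 <-> enorm (z y) = 1.
Hypothesis gE : forall y : 'rV[R]_n.+1, y != 0 -> finsler_tensor K y =
  (h^-1 * (K y `^ (1 - h))) ^+ 2 *: ('J z y *m ('J z y)^T).

Let K0 (y : 'rV[R]_n.+1) : y != 0 -> 0 < K y.
Proof. by case: normK => _ H _ _; exact: H. Qed.

Let onz : open nz. Proof. exact: open_nonzero. Qed.

(** Both sides are homogeneous of degree h and agree on the indicatrix. *)
Lemma enorm_conformal (y : 'rV[R]_n.+1) : y != 0 -> enorm (z y) = K y `^ h.
Proof.
move=> y0; have [_ _ KZ _] := normK; have Ky := K0 y0.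
have c0 : 0 < (K y)^-1 by rewrite invr_gt0.
have cy0 : (K y)^-1 *: y != 0 by rewrite scaler_eq0 negb_or y0 gt_eqF.
have /(z_unit cy0) : K ((K y)^-1 *: y) = 1 by rewrite KZ// mulVf// gt_eqF.
rewrite zZ// enormZ ?powR_ge0// => e1.
rewrite -[LHS](mulKf (x := (K y)^-1 `^ h)); last by rewrite gt_eqF// powR_gt0.
by rewrite e1 mulr1 -powRN -powR_inv1 ?ltW// -powRrM mulN1r opprK.
Qed.

Lemma inj_conformal : set_inj nz z.
Proof.
move=> x y /set_mem x0 /set_mem y0 e.
by rewrite -(proj2 (zK x0)) e (proj2 (zK y0)).
Qed.

Lemma inj_conformal_inv : set_inj nz w.
Proof.
move=> x y /set_mem x0 /set_mem y0 e.
by rewrite -(proj2 (wK x0)) e (proj2 (wK y0)).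
Qed.

Lemma jacobian_conformal_unit (y : 'rV[R]_n.+1) : y != 0 -> 'J z y \in unitmx.
Proof.
move=> y0; have H := jacobian_inverse onz onz
  Cz Cw (fun x x0 => (zK x0).1) (fun x x0 => (zK x0).2) y0.
exact: proj1 (mulmx1_unit H).
Qed.

Lemma jacobian_conformal_inv_unit (y : 'rV[R]_n.+1) : y != 0 -> 'J w y \in unitmx.
Proof.
move=> y0; have H := jacobian_inverse onz onz
  Cw Cz (fun x x0 => (wK x0).1) (fun x x0 => (wK x0).2) y0.
exact: proj1 (mulmx1_unit H).
Qed.

Lemma indicatrix_nonzero : indicatrix K `<=` nz.
Proof.
move=> y Ky; apply/eqP => y0; move: Ky.
by rewrite /indicatrix/= y0; have [-> _ _ _] := normK => /esym/eqP; rewrite oner_eq0.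
Qed.

Lemma sphere_nonzero : sphere `<=` nz.
Proof.
move=> y; rewrite /euclidean_sphere/= -/(enorm y) => y1.
by apply/eqP => y0; move: y1; rewrite y0 enorm0 => /esym/eqP; rewrite oner_eq0.
Qed.

Lemma image_indicatrix : z @` indicatrix K = sphere.
Proof.
apply/seteqP; split=> [_ [y Ky <-]|v v1].
  exact/(z_unit (indicatrix_nonzero Ky)).
have v0 := sphere_nonzero v1; have [wv0 zwv] := wK v0.
by exists (w v) => //; apply/(z_unit wv0); rewrite zwv.
Qed.

Lemma image_sphere : w @` sphere = indicatrix K.
Proof.
rewrite -image_indicatrix; apply/seteqP; split=> [_ [_ [y Ky <-] <-]|y Ky].
  by rewrite (zK (indicatrix_nonzero Ky)).2.
by exists (z y); [exists y|rewrite (zK (indicatrix_nonzero Ky)).2].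
Qed.

(** On the indicatrix the conformal factor is the constant 1 / h; w carries
   the stereographic decomposition of the sphere to the indicatrix, so that
   the area of the indicatrix is the value of some decomposition. *)
Lemma area_indicatrix_conformal :
  area_indicatrix K = ((h ^- n)%:E * (n.+1%:R%:E * lam n.+1 ball1))%E.
Proof.
have [U [D [p [Hp HD tD cD _]]]] := is_riem_area_stereo R n.
have := decomposition_comp (finsler_tensor K) onz Cw
  inj_conformal_inv jacobian_conformal_inv_unit sphere_nonzero Hp HD tD cD.
rewrite image_sphere => HA; rewrite /area_indicatrix /riem_area.
have gI y : indicatrix K y ->
    finsler_tensor K y = h^-1 ^+ 2 *: ('J z y *m ('J z y)^T).
  move=> Ky; rewrite gE; last exact: indicatrix_nonzero.
  by rewrite (Ky : K y = 1) powR1 mulr1.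
have hV : 0 <= h^-1 by rewrite invr_ge0 ltW.
have [B HB ->] := is_riem_area_pullback onz Cz
  inj_conformal jacobian_conformal_unit indicatrix_nonzero hV gI (xgetI 0%E HA).
rewrite image_indicatrix in HB.
by rewrite (is_riem_area_sphere HB) exprVn.
Qed.

(** The conformal map made homogeneous of degree 1; its norm is K. *)
Definition normalized y : 'rV[R]_n.+1 := radial (h^-1 - 1) (z y).

Lemma class_C1_normalized : class_C 1 nz normalized.
Proof.
apply: (class_C1_comp onz onz Cz).
  exact: class_C1_radial.
by move=> y y0; case: (zK y0).
Qed.

Lemma enorm_normalized (y : 'rV[R]_n.+1) : y != 0 -> enorm (normalized y) = K y.
Proof.
move=> y0; have [zy0 _] := zK y0.
rewrite enorm_radial// enorm_conformal// subrK -powRrM divff ?gt_eqF//.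
by rewrite powRr1// ltW// K0.
Qed.

Lemma inj_normalized : set_inj nz normalized.
Proof.
move=> x y /set_mem x0 /set_mem y0 /(congr1 (@radial R n.+1 (h - 1))).
have hV : h^-1 * h = 1 by rewrite mulVf// gt_eqF.
rewrite /normalized !(radialK hV); [|by case: (zK y0)|by case: (zK x0)].
by apply: inj_conformal; rewrite inE.
Qed.

Lemma det_jacobian_normalized (y : 'rV[R]_n.+1) : y != 0 ->
  `|\det ('J normalized y)| = h^-1 * (K y `^ (1 - h)) ^+ n.+1 * `|\det ('J z y)|.
Proof.
move=> y0; have [zy0 _] := zK y0.
have [Dz _] := class_C1_is_diff Cz y0.
have Hr := is_diff_radial (h^-1 - 1) zy0; have [Dr _] := Hr.
rewrite /normalized (jacobian_comp Dz Dr) (is_diff_jacobianE Hr) det_mulmx.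
rewrite det_radial_jac// [1 + _]addrC subrK enorm_conformal// -powRrM.
rewrite mulrBr mulfV ?gt_eqF// mulr1 !normrM.
rewrite (ger0_norm (x := h^-1)) ?invr_ge0 ?ltW//.
rewrite (ger0_norm (x := _ ^+ n.+1)) ?exprn_ge0 ?powR_ge0//.
by rewrite mulrC [_ * h^-1]mulrC.
Qed.

(** sqrt (det g) is h^-N K^(N (1 - h)) times the Jacobian of z, while making z
   homogeneous of degree 1 multiplies that Jacobian by K^(N (1 - h)) / h. *)
Lemma sqrt_det_finsler_tensor (y : 'rV[R]_n.+1) : y != 0 ->
  Num.sqrt (\det (finsler_tensor K y)) = h ^- n * `|\det ('J normalized y)|.
Proof.
move=> y0; rewrite gE// det_jacobian_normalized// detZ det_mulmx det_tr.
have c0 : 0 <= h^-1 * K y `^ (1 - h) by rewrite mulr_ge0 ?powR_ge0// invr_ge0 ltW.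
rewrite exprAC -expr2 -exprMn sqrtr_sqr normrM ger0_norm ?exprn_ge0//.
rewrite exprMn mulrA; congr (_ * _).
by rewrite mulrA -exprVn -exprSr.
Qed.

Lemma jacobian_normalized_unit (y : 'rV[R]_n.+1) : y != 0 -> 'J normalized y \in unitmx.
Proof.
move=> y0; rewrite unitmxE unitfE -normr_eq0 det_jacobian_normalized//.
rewrite !mulf_neq0 ?invr_eq0 ?normr_eq0 ?(gt_eqF h0)//.
- by rewrite gt_eqF// exprn_gt0// powR_gt0// K0.
- by rewrite -unitfE -unitmxE; exact: jacobian_conformal_unit.
Qed.

Let B := nz `&` [set y | enorm (normalized y) <= 1].

Lemma finsleroidE : finsleroid K = B `|` [set 0].
Proof.
apply/seteqP; split => [y Ky|y [[y0]|->]].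
- have [->|y0] := eqVneq y 0; [by right|left; split => //].
  by rewrite /= enorm_normalized.
- by rewrite /= enorm_normalized.
by rewrite /finsleroid/=; have [-> _ _ _] := normK; exact: ler01.
Qed.

Lemma image_finsleroid : normalized @` B = nz `&` ball1.
Proof.
apply/seteqP; split=> [_ [y [y0 y1] <-]|v [v0 v1]].
  by split=> //; apply: radial_neq0; case: (zK y0).
have r0 : radial (h - 1) v != 0 by exact: radial_neq0.
have [w0 zw] := wK r0.
have hV : h * h^-1 = 1 by rewrite divff// gt_eqF.
have E : normalized (w (radial (h - 1) v)) = v.
  by rewrite /normalized zw (radialK hV).
by exists (w (radial (h - 1) v)) => //; split=> //=; rewrite E.
Qed.

Lemma measurable_punctured_finsleroid : measurable B.
Proof.
have mnz : measurable nz by apply: open_measurable_rv; exact: open_nonzero.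
have := continuous_measurable_rv_rv onz
  (fun y y0 => class_C1_continuous class_C1_normalized y0) mnz (@subset_refl _ nz).
by move=> /(_ mnz _ (@measurable_ball1 R n)).
Qed.

(** The origin, where g is not given by the conformal relation, is a null set
   both in the Finsleroid and in the ball. *)
Lemma volume_finsleroid_conformal :
  volume_finsleroid K = ((h ^- n)%:E * lam n.+1 ball1)%E.
Proof.
have mB := measurable_punctured_finsleroid.
have m0 := @measurable_rv_set1 R n.+1.
have Bnz : B `<=` nz by move=> y [].
have mJ : measurable_fun B (fun y => (`|\det ('J normalized y)|)%:E).
  apply/measurable_EFinP.
  apply: (continuous_measurable_rv onz) => // y y0.
  apply: normr_continuous_at; apply: det_continuous_at.
  exact: (jacobian_continuous onz class_C1_normalized y0).
have gB y : B y -> (Num.sqrt (\det (finsler_tensor K y)))%:E =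
    ((h ^- n)%:E * (`|\det ('J normalized y)|)%:E)%E.
  by move=> [y0 _]; rewrite sqrt_det_finsler_tensor// EFinM.
have mg : measurable_fun B (fun y => (Num.sqrt (\det (finsler_tensor K y)))%:E).
  apply: (eq_measurable_fun _ (fun y yB => esym (gB y (set_mem yB)))).
  exact: measurable_funeM.
have mg0 : measurable_fun [set 0 : 'rV[R]_n.+1] (fun y : 'rV[R]_n.+1 => (Num.sqrt (\det (finsler_tensor K y)))%:E).
  exact: measurable_fun_set1.
rewrite /volume_finsleroid /riem_volume finsleroidE.
apply: etrans (ge0_integral_setU _ mB m0 _ _ _) _.
- by apply/(measurable_funU _ mB m0).
- by move=> y _; rewrite lee_fin sqrtr_ge0.
- by apply/disj_setPS => y [[y0 _] /= y1]; move: y0; rewrite y1 /nonzero/= eqxx.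
rewrite (null_set_integral m0 mg0); last exact: lebesgue_rV_set1.
rewrite adde0.
have [_ LB] := lebesgue_image_integral onz class_C1_normalized
  inj_normalized jacobian_normalized_unit mB Bnz.
have -> : (\int[lam n.+1]_(y in B) (Num.sqrt (\det (finsler_tensor K y)))%:E =
    \int[lam n.+1]_(y in B) ((h ^- n)%:E * (`|\det ('J normalized y)|)%:E))%E.
  by apply: eq_integral => y yB; exact: gB y (set_mem yB).
rewrite ge0_integralZl_EFin//; last by rewrite invr_ge0 exprn_ge0// ltW.
rewrite -LB image_finsleroid; congr (_ * _)%E.
have mnz : measurable nz by apply: open_measurable_rv; exact: open_nonzero.
have -> : ball1 = (nz `&` ball1) `|` [set 0].
  apply/seteqP; split => [y y1|y [[_]//|->]].
    by have [->|y0] := eqVneq y 0; [right|left].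
  by rewrite /euclidean_ball/= -/(enorm _) enorm0.
rewrite setIUr (_ : nz `&` [set 0] = set0); last first.
  by apply/seteqP; split => // y [y0 /= y1]; move: y0; rewrite y1 /nonzero/= eqxx.
rewrite setU0 setIA setIid measureU0//; last exact: lebesgue_rV_set1.
by apply: measurableI => //; exact: measurable_ball1.
Qed.

End finsleroid.

(** * The theorem *)

(** Writing a = P P^T and z = zeta P reduces a to the Euclidean tensor. *)
Lemma finsleroid_area_volume (R : realType) n (K : 'rV[R]_n.+1 -> R)
    (a : 'M[R]_n.+1) (h : R) (zeta : 'rV[R]_n.+1 -> 'rV[R]_n.+1) :
  finsler_norm K -> posdef a -> 0 < h -> punctured_diffeo 5 zeta ->
  (forall (c : R) (y : 'rV[R]_n.+1), 0 < c -> y != 0 ->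
     zeta (c *: y) = (c `^ h) *: zeta y) ->
  (forall y : 'rV[R]_n.+1, y != 0 -> K y = 1 <-> riem_norm a (zeta y) = 1) ->
  (forall y : 'rV[R]_n.+1, y != 0 -> finsler_tensor K y =
     (h^-1 * (K y `^ (1 - h))) ^+ 2 *: ('J zeta y *m a *m ('J zeta y)^T)) ->
  area_indicatrix K = ((h ^- n)%:E * area_unit_sphere R n.+1)%E /\
  volume_finsleroid K = ((h ^- n)%:E * volume_unit_ball R n.+1)%E.
Proof.
move=> normK /posdef_factor[P uP ->] h0 [Czeta [v [Cv zv vz]]] zetaZ zeta1 gE.
have C15 (f : 'rV[R]_n.+1 -> 'rV[R]_n.+1) : class_C 5 (@nonzero _) f -> class_C 1 (@nonzero _) f.
  move=> [Df DDf]; split=> // d y y0; have [D2 _] := DDf d.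
  exact: differentiable_continuous (D2 y y0).
have P0 (Q : 'M[R]_n.+1) (y : 'rV[R]_n.+1) : Q \in unitmx -> y != 0 -> y *m Q != 0.
  by move=> uQ; apply: contra_neq => yQ; rewrite -(mulmxK uQ y) yQ mul0mx.
have uV : invmx P \in unitmx by rewrite unitmx_inv.
have onz := @open_nonzero R n.+1.
have Jz y : y != 0 -> 'J (fun y => zeta y *m P) y = 'J zeta y *m P.
  move=> y0; have Hz := class_C1_is_diff (C15 _ Czeta) y0.
  exact: is_diff_jacobianE (is_diff_comp_mx Hz (is_diff_mulmxr P _)).
have Cz : class_C 1 (@nonzero _) (fun y => zeta y *m P).
  apply: (class_C1_comp onz onz (C15 _ Czeta) (class_C1_mulmxr P onz)) => y y0.
  by case: (zv y y0).
have Cw : class_C 1 (@nonzero _) (fun y => v (y *m invmx P)).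
  apply: (class_C1_comp onz onz (class_C1_mulmxr (invmx P) onz) (C15 _ Cv)) => y y0.
  exact: P0.
have zK (y : 'rV[R]_n.+1) : y != 0 -> zeta y *m P != 0 /\ v (zeta y *m P *m invmx P) = y.
  move=> y0; have [z0 zK] := zv y y0; split; first exact: P0.
  by rewrite mulmxK.
have wK (y : 'rV[R]_n.+1) : y != 0 -> v (y *m invmx P) != 0 /\ zeta (v (y *m invmx P)) *m P = y.
  move=> y0; have [v0 vK] := vz _ (P0 _ _ uV y0); split=> //.
  by rewrite vK mulmxKV.
have zZ (c : R) (y : 'rV[R]_n.+1) : 0 < c -> y != 0 ->
    zeta (c *: y) *m P = (c `^ h) *: (zeta y *m P).
  by move=> c0 y0; rewrite zetaZ// scalemxAl.
have z1 (y : 'rV[R]_n.+1) : y != 0 -> K y = 1 <-> enorm (zeta y *m P) = 1.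
  move=> y0; apply: (iff_trans (zeta1 y y0)).
  by rewrite /riem_norm /enorm -mulmx_trE trmx_mul !mulmxA.
have gz (y : 'rV[R]_n.+1) : y != 0 -> finsler_tensor K y =
    (h^-1 * (K y `^ (1 - h))) ^+ 2 *:
      ('J (fun y => zeta y *m P) y *m ('J (fun y => zeta y *m P) y)^T).
  by move=> y0; rewrite (gE y y0) (Jz y y0) trmx_mul !mulmxA.
rewrite area_unit_sphereE volume_unit_ballE; split.
  exact: (area_indicatrix_conformal normK h0 Cz Cw zK wK z1 gz).
exact: (volume_finsleroid_conformal normK h0 Cz Cw zK wK zZ z1 gz).
Qed.

Theorem mainTheorem12 (R : realType) (N : nat) (N_gt0 : (0 < N)%N)
  (M : manifold R N)
  (K : charts M -> M -> 'rV[R]_N -> R)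
  (a : charts M -> M -> 'M[R]_N)
  (h : M -> R)
  (zeta : charts M -> M -> 'rV[R]_N -> 'rV[R]_N)
  (K_finsler : finsler_metric K)
  (a_riemannian : riemannian_metric a)
  (h_gt0 : forall x, 0 < h x)
  (zeta_fibrewise : fibrewise_transformation zeta)
  (zeta_homogeneous : homogeneous_of_degree h zeta)
  (zeta_unit : unit_to_unit K a zeta)
  (zeta_conformal : conformal_relation K a h zeta)
  (x : M) (i : charts M) (x_in_i : chart_dom i x) :
  [/\ fine (area_indicatrix (K i x)) / fine (area_unit_sphere R N)
        = 1 / h x ^+ N.-1,
      fine (volume_finsleroid (K i x)) / fine (volume_unit_ball R N)
        = 1 / h x ^+ N.-1,
      (3 <= N)%N ->
        fine (area_indicatrix (K i x)) / fine (volume_finsleroid (K i x))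
        = fine (area_unit_sphere R N) / fine (volume_unit_ball R N) &
      N = 2%N ->
        [/\ fine (area_indicatrix (K i x)) = 2 * pi / h x,
            fine (volume_finsleroid (K i x)) = pi / h x &
            fine (area_indicatrix (K i x)) / fine (volume_finsleroid (K i x))
            = 2]].
Proof.
case: N N_gt0 => // n _ in M K a h zeta K_finsler a_riemannian h_gt0 zeta_fibrewise
  zeta_homogeneous zeta_unit zeta_conformal x i x_in_i *.
have hx := h_gt0 x; have hn0 : h x ^+ n != 0 by rewrite expf_neq0// gt_eqF.
have [AE VE] : area_indicatrix (K i x) = ((h x ^- n)%:E * area_unit_sphere R n.+1)%E /\
    volume_finsleroid (K i x) = ((h x ^- n)%:E * volume_unit_ball R n.+1)%E.
  apply: (@finsleroid_area_volume R n (K i x) (a i x) (h x) (zeta i x)) => //.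
  - by case: K_finsler => _ _ H; exact: H.
  - by case: a_riemannian => _ _ H; exact: H.
  - by case: zeta_fibrewise => _ _ H; exact: H.
  - exact: zeta_homogeneous.
  - exact: zeta_unit.
  - exact: zeta_conformal.
have [b b0 bE] : exists2 b : R, 0 < b & lebesgue_rV R n.+1 (@euclidean_ball R n.+1) = b%:E.
  have b0 := lebesgue_ball1_gt0 R n; have by' := lebesgue_ball1_fin R n.
  exists (fine (lebesgue_rV R n.+1 (@euclidean_ball R n.+1))).
    by rewrite fine_gt0// b0.
  by rewrite fineK// ge0_fin_numE.
rewrite AE VE area_unit_sphereE volume_unit_ballE bE -!EFinM/=.
have bn0 : b != 0 by rewrite gt_eqF.
have n0 : n.+1%:R != 0 :> R by rewrite pnatr_eq0.
split.
- by rewrite mulfK ?mul1r// mulf_neq0.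
- by field; rewrite bn0 hn0.
- by move=> _; field; rewrite bn0 hn0.
move=> [n1]; have bpi : b = pi.
  by move: bE; rewrite n1 lebesgue_disc => -[->].
rewrite bpi n1 expr1; have hx0 : h x != 0 by rewrite gt_eqF.
have pi0 : pi != 0 :> R by rewrite gt_eqF// pi_gt0.
split.
- by field.
- by field.
- by rewrite mulrCA mulfK// mulf_neq0// invr_eq0.
Qed.
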